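(* Let $\nu\in(0,1]$. Let $x_1,x_2,\dots$ be generated by the stagewise algorithm with SPG as subproblem solver, suppose there exists $\Delta>0$ such that $\mathbb{E}[F(x_k)-\min_xF(x)]\le\Delta$ for all $k\in\{1,\dots,K\}$, let $\tau\in\{1,\dots,K\}$ be sampled according to $p(\tau=k)=k^\alpha/\sum_{j=1}^Kj^\alpha$ with $\alpha\ge1$, and suppose that one of the following holds: (a) condition (S) holds and SPG is run with Option 1 and $\gamma_k=3Lk^{\frac{1-\nu}{1+\nu}}$, $\eta_t=3/(\gamma_k(t+1))$, $T_k=3Lk/\gamma_k+3$ at stage $k$; (b) condition (N) holds and SPG is run with Option 2 and $\gamma_k=ck^{\frac{1-\nu}{1+\nu}}$ ($c>0$ a constant), $\eta_t=4/(\gamma_kt)$, $T_k=k/\gamma_k+1$ at stage $k$. (1) If $g+r$ is differentiable and has $(L,\nu)$-H\''older continuous gradient, then by setting $K=O(1/\epsilon^{\frac{1+\nu}{\nu}})$ we have $$\mathbb{E}\big[\mathrm{dist}\big(\partial h(x_\tau),\nabla g(x_\tau)+\nabla r(x_\tau)\big)\big]\le O(\epsilon),$$ and the total iteration complexity is $\sum_{k=1}^KT_k=O(1/\epsilon^{\frac{1+3\nu}{\nu}})$. (2) If $h$ is differentiable and has $(L,\nu)$-H\''older continuous gradient, then by setting $K=O(1/\epsilon^{\frac{1+\nu}{\nu}})$ we have $$\mathbb{E}[\|x_\tau-z_\tau\|]\le O(\epsilon^{1/\nu}),\qquad\mathbb{E}\big[\mathrm{dist}\big(\nabla h(z_\tau),\partial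 g(z_\tau)+\partial r(z_\tau)\big)\big]\le O(\epsilon),$$ where $z_\tau=P_{\gamma_\tau}(x_\tau)$, and the total iteration complexity is $\sum_{k=1}^KT_k=O(1/\epsilon^{\frac{1+3\nu}{\nu}})$.
   Context: Problem: $\min_{x\in\mathbb{R}^d}F(x):=g(x)+r(x)-h(x)$ with $g(x)=\mathbb{E}_\xi[g(x;\xi)]$, $h(x)=\mathbb{E}_\varsigma[h(x;\varsigma)]$, where $g,h:\mathbb{R}^d\to\mathbb{R}$ are lower-semicontinuous convex and $r:\mathbb{R}^d\to\mathbb{R}\cup\{+\infty\}$ is proper lower-semicontinuous convex. $\|\cdot\|$ is the Euclidean norm and $\mathrm{dist}$ is the distance between sets. A differentiable $f$ has $(L,\nu)$-H\''older continuous gradient if $\|\nabla f(x)-\nabla f(y)\|\le L\|x-y\|^\nu$ for all $x,y$. When $\partial h(z)$ is used as a vector it denotes a chosen subgradient of $h$ at $z$; inside $\mathrm{dist}$ it is the subdifferential. $\partial g(x;\xi)$, $\partial h(x;\varsigma)$ denote stochastic subgradients: $\mathbb{E}_\xi[\partial g(x;\xi)]\in\partial g(x)$, $\mathbb{E}_\varsigma[\partial h(x;\varsigma)]=\partial h(x)$. For $\gamma>0$, $z\in\mathbb{R}^d$: $$F^{\gamma}_{z}(x)=g(x)+r(x)-\big(h(z)+\partial h(z)^{\top}(x-z)\big)+\tfrac{\gamma}{2}\|x-z\|^2,\qquad P_\gamma(z)=\arg\min_xF^\gamma_z(x).$$ Stagewise algorithm: $x_1\in\mathrm{dom}(r)$;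 for $k=1,\dots,K$, $x_{k+1}$ is the output of SPG$(F^{\gamma_k}_{x_k},x_k,T_k)$. SPG$(F^\gamma_{y_1},y_1,T)$ with step sizes $\eta_t$: let $\Omega=\{x\in\mathrm{dom}(r):\|x-y_1\|\le3G/\gamma\}$. For $t=1,\dots,T$, draw fresh independent samples $\xi_t,\varsigma_t$, and set $$y_{t+1}=\arg\min_x\; x^\top(\partial g(y_t;\xi_t)-\partial h(y_1;\varsigma_t))+r(x)+\tfrac{\gamma}{2}\|x-y_1\|^2+\tfrac{1}{2\eta_t}\|x-y_t\|^2,$$ the minimum being over $\mathbb{R}^d$ in Option 1 and over $\Omega$ in Option 2. Output $\sum_{t=2}^{T+1}t\,y_t/\sum_{t=2}^{T+1}t$ (Option 1) or $\sum_{t=1}^{T}t\,y_t/\sum_{t=1}^{T}t$ (Option 2). Non-integer iteration numbers are understood as rounded up. Condition (S): $g$ is $L$-smooth (differentiable with $L$-Lipschitz gradient) and there exists $G>0$ such that $\mathbb{E}\big[\|(\nabla g(x;\xi)-\partial h(x;\varsigma))-\mathbb{E}[\nabla g(x;\xi)-\partial h(x;\varsigma)]\|^2\big]\le G^2$. Condition (N): there exists $G>0$ such that $\mathbb{E}[\|\partial g(x;\xi)\|^2]\le G^2$ and $\mathbb{E}[\|\partial h(x;\varsigma)\|^2]\le G^2$ for $x\in\mathrm{dom}(r)$, and either $r=\delta_{\mathcal X}$ is the indicator function of a closed convex set $\mathcal X$ or $\|\partial r(x)\|\le G$ for $x\in\mathrm{dom}(r)$. ''Setting $K=O(q(\epsilon))$''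 means choosing $K=\lceil Cq(\epsilon)\rceil$ for a constant $C>0$ independent of $\epsilon\in(0,1]$; all $O(\cdot)$ constants are independent of $\epsilon$. *)

(* Defs.v *)
From HB Require Import structures.
From mathcomp Require Import all_boot all_order all_algebra.
From mathcomp Require Import all_classical all_reals all_analysis.

Set Implicit Arguments.
Unset Strict Implicit.
Unset Printing Implicit Defensive.

Import Order.TTheory GRing.Theory Num.Theory.
Import numFieldNormedType.Exports.

Local Open Scope classical_set_scope.
Local Open Scope ring_scope.

(** ** Euclidean space

    The norm [`| x |] carried by ['rV[R]_d] in the library is the sup norm; it
    induces the same topology and the same notion of differentiability as the
    Euclidean norm [enorm], which is the one used in all estimates. *)

Definition dotp (R : realType) (d : nat) (u v : 'rV[R]_d) : R :=
  \sum_(i < d) u 0 i * v 0 i.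

Definition enorm (R : realType) (d : nat) (u : 'rV[R]_d) : R :=
  Num.sqrt (dotp u u).

Definition setdist (R : realType) (d : nat) (A B : set 'rV[R]_d) : \bar R :=
  ereal_inf [set (enorm (p.1 - p.2))%:E | p in A `*` B].

Definition mink_sum (R : realType) (d : nat) (A B : set 'rV[R]_d) :
    set 'rV[R]_d :=
  [set p.1 + p.2 | p in A `*` B].

(** The Borel space of R^d. *)
Notation borelV R d := (g_sigma_algebraType (@open 'rV[R]_d)).

(** ** Convex analysis *)

Definition edom (R : realType) (d : nat) (f : 'rV[R]_d -> \bar R) :
    set 'rV[R]_d :=
  [set x | (f x < +oo)%E].

Definition eproper (R : realType) (d : nat) (f : 'rV[R]_d -> \bar R) : Prop :=
  edom f !=set0 /\ forall x, (-oo < f x)%E.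

Definition econvex (R : realType) (d : nat) (f : 'rV[R]_d -> \bar R) : Prop :=
  forall (x y : 'rV[R]_d) (t : R), 0 <= t <= 1 ->
    (f (t *: x + (1 - t) *: y)%R
      <= t%:E * f x + (1 - t)%:E * f y)%E.

(** The subdifferential; it is used for real-valued [f] through [EFin \o f]. *)
Definition subdiff (R : realType) (d : nat) (f : 'rV[R]_d -> \bar R)
    (x : 'rV[R]_d) : set 'rV[R]_d :=
  [set v | forall y, (f x + (dotp v (y - x))%:E <= f y)%E].

Definition argmin (R : realType) (d : nat) (S : set 'rV[R]_d)
    (f : 'rV[R]_d -> \bar R) : set 'rV[R]_d :=
  [set x | S x /\ forall y, S y -> (f x <= f y)%E].

Definition convex_indicator (R : realType) (d : nat) (r : 'rV[R]_d -> \bar R) :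
    Prop :=
  exists X : set 'rV[R]_d,
    [/\ closed X, convex_set (X : set (convex_lmodType 'rV[R]_d))
      & forall x, r x = if x \in X then 0%E else +oo%E].

Definition grad (R : realType) (d : nat) (f : 'rV[R]_d -> R) (x : 'rV[R]_d) :
    'rV[R]_d :=
  \row_(i < d) 'D_(delta_mx 0 i) (f : 'rV[R]_d -> R^o) x.

Definition holder_gradient (R : realType) (d : nat) (f : 'rV[R]_d -> R)
    (L nu : R) : Prop :=
  (forall x, differentiable (f : 'rV[R]_d -> R^o) x) /\
  forall x y, enorm (grad f x - grad f y) <= L * enorm (x - y) `^ nu.

Definition smooth (R : realType) (d : nat) (f : 'rV[R]_d -> R) (L : R) : Prop :=
  (forall x, differentiable (f : 'rV[R]_d -> R^o) x) /\
  forall x y, enorm (grad f x - grad f y) <= L * enorm (x - y).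

(** ** Probability *)

Definition vmean (R : realType) (d : nat) (dT : measure_display)
    (T : measurableType dT) (mu : {measure set T -> \bar R})
    (f : T -> 'rV[R]_d) : 'rV[R]_d :=
  \row_(i < d) (\int[mu]_w (f w 0 i))%R.

Definition mutually_independent (R : realType) (dT : measure_display)
    (T : measurableType dT) (P : probability T R) (I : eqType) (D : set I)
    (E : I -> set (set T)) : Prop :=
  forall (s : seq I) (A : I -> set T), uniq s ->
    (forall i, i \in s -> D i /\ E i (A i)) ->
    P (\bigcap_(i in [set` s]) A i) = (\prod_(i <- s) P (A i))%E.

(** ** The problem min g + r - h

    [sg x xi] and [sh x zeta] are the stochastic subgradients of g and h; the
    chosen subgradient of h at [x] is the mean [dh D x] of [sh x]. *)

Record dc_data (R : realType) (d : nat) (dX dZ : measure_display)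
    (X : measurableType dX) (Z : measurableType dZ) := DCData {
  mu_g : probability X R;
  mu_h : probability Z R;
  gs : 'rV[R]_d -> X -> R;
  hs : 'rV[R]_d -> Z -> R;
  reg : 'rV[R]_d -> \bar R;
  sg : 'rV[R]_d -> X -> 'rV[R]_d;
  sh : 'rV[R]_d -> Z -> 'rV[R]_d }.

Section Problem.
Context (R : realType) (d : nat) (dX dZ : measure_display).
Context (X : measurableType dX) (Z : measurableType dZ).
Implicit Types (D : dc_data R d X Z) (x y z : 'rV[R]_d).

Definition gfun D x : R := (\int[mu_g D]_w gs D x w)%R.
Definition hfun D x : R := (\int[mu_h D]_w hs D x w)%R.
Definition dg D x : 'rV[R]_d := vmean (mu_g D) (sg D x).
Definition dh D x : 'rV[R]_d := vmean (mu_h D) (sh D x).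

Definition objective D x : \bar R :=
  ((gfun D x)%:E + reg D x - (hfun D x)%:E)%E.

Definition min_objective D : \bar R := ereal_inf (range (objective D)).

(** The joint Borel measurability of the oracles [sg] and [sh] is what makes
    their values at random iterates random vectors. *)
Record is_dc_problem D : Prop := {
  gs_integrable : forall x, (mu_g D).-integrable setT (EFin \o gs D x);
  hs_integrable : forall x, (mu_h D).-integrable setT (EFin \o hs D x);
  g_lsc : lower_semicontinuous (EFin \o gfun D);
  h_lsc : lower_semicontinuous (EFin \o hfun D);
  g_convex : convex_function setT (gfun D : convex_lmodType 'rV[R]_d -> R^o);
  h_convex : convex_function setT (hfun D : convex_lmodType 'rV[R]_d -> R^o);
  reg_proper : eproper (reg D);
  reg_lsc : lower_semicontinuous (reg D);
  reg_convex : econvex (reg D);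
  sg_measurable : measurable_fun setT
    (fun p : borelV R d * X => sg D p.1 p.2 : borelV R d);
  sh_measurable : measurable_fun setT
    (fun p : borelV R d * Z => sh D p.1 p.2 : borelV R d);
  sg_integrable : forall x i,
    (mu_g D).-integrable setT (fun w => (sg D x w 0 i)%:E);
  sh_integrable : forall x i,
    (mu_h D).-integrable setT (fun w => (sh D x w 0 i)%:E);
  sg_unbiased : forall x, subdiff (EFin \o gfun D) x (dg D x);
  sh_unbiased : forall x, subdiff (EFin \o hfun D) x (dh D x) }.

(** xi and zeta are independent, hence the product measure. *)
Definition condition_S D (L G : R) : Prop :=
  smooth (gfun D) L /\
  let mu := (mu_g D \x mu_h D)%E in
  forall x,
    let noise := fun p : X * Z => sg D x p.1 - sh D x p.2 in
    (\int[mu]_p (enorm (noise p - vmean mu noise) ^+ 2)%:E <= (G ^+ 2)%:E)%E.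

(** The bound on the subgradients of r is a bound on one subgradient at each
    point of dom(r): the others may be unbounded, as they include all normal
    vectors to dom(r). *)
Definition condition_N D (G : R) : Prop :=
  (forall x, edom (reg D) x ->
     (\int[mu_g D]_w (enorm (sg D x w) ^+ 2)%:E <= (G ^+ 2)%:E)%E /\
     (\int[mu_h D]_w (enorm (sh D x w) ^+ 2)%:E <= (G ^+ 2)%:E)%E) /\
  (convex_indicator (reg D) \/
   forall x, edom (reg D) x ->
     exists2 v, subdiff (reg D) x v & enorm v <= G).

Definition subproblem D (gamma : R) z x : \bar R :=
  ((gfun D x)%:E + reg D x - (hfun D z + dotp (dh D z) (x - z))%:E
   + (gamma / 2 * enorm (x - z) ^+ 2)%:E)%E.

Definition prox_pt D (gamma : R) z : 'rV[R]_d :=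
  xget z (argmin setT (subproblem D gamma z)).

End Problem.

(** ** The algorithm *)

Inductive spg_option := Option1 | Option2.

Record schedule (R : realType) := Schedule {
  gam : nat -> R;
  eta : nat -> nat -> R;
  iters : nat -> nat }.

Definition ceiln (R : realType) (a : R) : nat := `|Num.ceil a|%N.

Definition schedule_S (R : realType) (L nu : R) : schedule R :=
  let gamma k := 3 * L * k%:R `^ ((1 - nu) / (1 + nu)) in
  Schedule gamma
    (fun k t => 3 / (gamma k * (t%:R + 1)))
    (fun k => ceiln (3 * L * k%:R / gamma k + 3)).

Definition schedule_N (R : realType) (c nu : R) : schedule R :=
  let gamma k := c * k%:R `^ ((1 - nu) / (1 + nu)) in
  Schedule gamma
    (fun k t => 4 / (gamma k * t%:R))
    (fun k => ceiln (k%:R / gamma k + 1)).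

Section Algorithm.
Context (R : realType) (d : nat) (dX dZ : measure_display).
Context (X : measurableType dX) (Z : measurableType dZ).
Implicit Types (D : dc_data R d X Z).

Definition spg_region D (opt : spg_option) (G gamma : R) (y1 : 'rV[R]_d) :
    set 'rV[R]_d :=
  match opt with
  | Option1 => setT
  | Option2 => [set x | edom (reg D) x /\ enorm (x - y1) <= 3 * G / gamma]
  end.

Definition spg_objective D (gamma eta : R) (y1 yt v x : 'rV[R]_d) : \bar R :=
  ((dotp x v)%:E + reg D x + (gamma / 2 * enorm (x - y1) ^+ 2)%:E
   + (1 / (2 * eta) * enorm (x - yt) ^+ 2)%:E)%E.

Definition weighted_mean (m n : nat) (y : nat -> 'rV[R]_d) : 'rV[R]_d :=
  (\sum_(m <= t < n) t%:R)^-1 *: \sum_(m <= t < n) (t%:R *: y t).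

Definition spg_output (opt : spg_option) (T : nat) (y : nat -> 'rV[R]_d) :
    'rV[R]_d :=
  match opt with
  | Option1 => weighted_mean 2 T.+2 y
  | Option2 => weighted_mean 1 T.+1 y
  end.

(** [inl (inl (k, t))] indexes xi_t of stage k, [inl (inr (k, t))] indexes
    zeta_t of stage k, and [inr tt] indexes the sampled stage tau. *)
Definition sample_index : eqType := (nat * nat + nat * nat + unit)%type.

Definition drawn (sch : schedule R) (K k t : nat) : bool :=
  (1 <= k <= K)%N && (1 <= t <= iters sch k)%N.

Definition used_samples (sch : schedule R) (K : nat) : set sample_index :=
  [set i | match i with
           | inl (inl (k, t)) => drawn sch K k t
           | inl (inr (k, t)) => drawn sch K k t
           | inr _ => True
           end].

Definition sample_events (dT : measure_display) (T : measurableType dT)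
    (xi : nat -> nat -> T -> X) (zeta : nat -> nat -> T -> Z) (tau : T -> nat)
    (i : sample_index) : set (set T) :=
  match i with
  | inl (inl (k, t)) => preimage_set_system setT (xi k t) measurable
  | inl (inr (k, t)) => preimage_set_system setT (zeta k t) measurable
  | inr _ => preimage_set_system setT tau measurable
  end.

(** A run of K stages from [x1], with the sampled stage tau. [x_ k] is x_k and
    [y_ k t] is the iterate y_t of SPG at stage k. *)
Record stagewise_run D (opt : spg_option) (sch : schedule R) (G alpha : R)
    (x1 : 'rV[R]_d) (K : nat) := StagewiseRun {
  run_disp : measure_display;
  run_space : measurableType run_disp;
  run_prob : probability run_space R;
  xi_ : nat -> nat -> {RV run_prob >-> X};
  zeta_ : nat -> nat -> {RV run_prob >-> Z};
  tau_ : {RV run_prob >-> nat};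
  x_ : nat -> run_space -> 'rV[R]_d;
  y_ : nat -> nat -> run_space -> 'rV[R]_d;
  xi_law : forall k t, drawn sch K k t ->
    forall B, measurable B -> run_prob (xi_ k t @^-1` B) = mu_g D B;
  zeta_law : forall k t, drawn sch K k t ->
    forall B, measurable B -> run_prob (zeta_ k t @^-1` B) = mu_h D B;
  tau_range : forall w, (1 <= tau_ w <= K)%N;
  tau_law : forall k, (1 <= k <= K)%N ->
    run_prob (tau_ @^-1` [set k]) =
      (k%:R `^ alpha / \sum_(1 <= j < K.+1) j%:R `^ alpha)%:E;
  samples_independent : mutually_independent run_prob (used_samples sch K)
    (sample_events xi_ zeta_ tau_);
  x_init : forall w, x_ 1 w = x1;
  y_init : forall k w, (1 <= k <= K)%N -> y_ k 1 w = x_ k w;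
  y_step : forall k t w, drawn sch K k t ->
    argmin (spg_region D opt G (gam sch k) (y_ k 1 w))
      (spg_objective D (gam sch k) (eta sch k t) (y_ k 1 w) (y_ k t w)
         (sg D (y_ k t w) (xi_ k t w) - sh D (y_ k 1 w) (zeta_ k t w)))
      (y_ k t.+1 w);
  x_step : forall k w, (1 <= k <= K)%N ->
    x_ k.+1 w = spg_output opt (iters sch k) (fun t => y_ k t w) }.

Arguments x_ {D opt sch G alpha x1 K} W k w : rename.
Arguments y_ {D opt sch G alpha x1 K} W k t w : rename.

Definition gap_bounded D opt sch G alpha x1 K
    (W : stagewise_run D opt sch G alpha x1 K) (Delta : R) : Prop :=
  forall k, (1 <= k <= K)%N ->
    (\int[run_prob W]_w (objective D (x_ W k w) - min_objective D)
       <= Delta%:E)%E.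

Definition x_tau D opt sch G alpha x1 K
    (W : stagewise_run D opt sch G alpha x1 K) (w : run_space W) : 'rV[R]_d :=
  x_ W (tau_ W w) w.

Definition z_tau D opt sch G alpha x1 K
    (W : stagewise_run D opt sch G alpha x1 K) (w : run_space W) : 'rV[R]_d :=
  prox_pt D (gam sch (tau_ W w)) (x_tau w).

Definition total_iterations (sch : schedule R) (K : nat) : nat :=
  (\sum_(1 <= k < K.+1) iters sch k)%N.

End Algorithm.

(* Main.v *)
Require Import Defs.
From HB Require Import structures.
From mathcomp Require Import all_boot all_order all_algebra.
From mathcomp Require Import all_classical all_reals all_analysis.
From mathcomp Require Import measurable_realfun.
From mathcomp Require Import ring lra zify.

Set Implicit Arguments.
Unset Strict Implicit.
Unset Printing Implicit Defensive.

Import Order.TTheory GRing.Theory Num.Theory.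
Import numFieldNormedType.Exports.

Local Open Scope classical_set_scope.
Local Open Scope ring_scope.

(* Comparing with the proximal point z_k of x_k, whose optimality condition
   bounds both criticality measures by L |x_k - z_k|^nu + gamma_k |x_k - z_k|, it
   is enough to control the second moments of d_k = |x_k - z_k|. Along one call of
   SPG, the weighted optimality gap of the iterates plus a multiple of
   gamma_k t^2 |y_t - z_k|^2 is a potential whose conditional expectation grows by
   O(G^2 / gamma_k) per step. Hence E F(x_{k+1}) + gamma_k / 4 E d_k^2 <=
   E F(x_k) + O(G^2 / (gamma_k T_k)), where gamma_k T_k is at least of order k.
   Summation by parts against k^alpha gives E gamma_tau d_tau^2 = O(1 / K), and the
   rates follow from Young's inequality with weights tuned to epsilon. *)

(** * Euclidean space and convex functions *)

(** No integrability of the iterates is assumed, and neither the minimizers chosen by a run nor the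
    set distances of the conclusion come with measurability. Iterates are measurable for the earlier
    samples because each SPG step is a proximal step whose minimizer is unique and depends
    continuously on its data; the hard case is Option 2, where the feasible ball moves with its
    centre. Conditional expectation is replaced by Tonelli's theorem on the product of the past with
    the law of the fresh sample. This requires nonnegative integrands: the inner product of the
    noise with y_t - z_k is absorbed, through Young's inequality, by the distance term of the
    potential. Distances to subdifferentials are bounded pointwise by functions of d_tau, and
    monotonicity of the integral is used in a form that covers non-measurable functions. The tuning
    is governed by s = epsilon^(1/nu): K is of order 1/(epsilon s), so gamma_k is at most of order
    epsilon / s and E gamma_tau d_tau^2 is O(epsilon s), which makes d_tau of order s and gamma_tau
    d_tau of order epsilon. *)

Section Euclid.
Context (R : realType) (d : nat).
Implicit Types (u v w x y z : 'rV[R]_d) (a b t : R).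

Lemma dotpC u v : dotp u v = dotp v u.
Proof. by apply: eq_bigr => i _; rewrite mulrC. Qed.

Lemma dotpDl u v w : dotp (u + v) w = dotp u w + dotp v w.
Proof. by rewrite /dotp -big_split; apply: eq_bigr => i _; rewrite mxE mulrDl. Qed.

Lemma dotpZl a u w : dotp (a *: u) w = a * dotp u w.
Proof. by rewrite /dotp mulr_sumr; apply: eq_bigr => i _; rewrite mxE mulrA. Qed.

Lemma dotpDr u v w : dotp u (v + w) = dotp u v + dotp u w.
Proof. by rewrite !(dotpC u) dotpDl. Qed.

Lemma dotpZr a u w : dotp u (a *: w) = a * dotp u w.
Proof. by rewrite !(dotpC u) dotpZl. Qed.

Lemma dotpNl u v : dotp (- u) v = - dotp u v.
Proof. by rewrite -scaleN1r dotpZl mulN1r. Qed.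

Lemma dotpNr u v : dotp u (- v) = - dotp u v.
Proof. by rewrite -scaleN1r dotpZr mulN1r. Qed.

Lemma dotp0l u : dotp 0 u = 0.
Proof. by rewrite -(scale0r u) dotpZl mul0r. Qed.

Lemma dotp0r u : dotp u 0 = 0.
Proof. by rewrite dotpC dotp0l. Qed.

Definition dotpE := (dotpDl, dotpDr, dotpNl, dotpNr, dotpZl, dotpZr, dotp0l, dotp0r).

Lemma dotp_delta u i : dotp u (delta_mx 0 i) = u 0 i.
Proof.
rewrite /dotp (bigD1 i)//= mxE !eqxx mulr1 big1 ?addr0// => j ji.
by rewrite mxE eqxx (negbTE ji) mulr0.
Qed.

Lemma dotp_ge0 u : 0 <= dotp u u.
Proof. by apply: sumr_ge0 => i _; rewrite -expr2 sqr_ge0. Qed.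

Lemma enorm_ge0 u : 0 <= enorm u. Proof. exact: sqrtr_ge0. Qed.

Lemma enorm2E u : enorm u ^+ 2 = dotp u u.
Proof. by rewrite sqr_sqrtr// dotp_ge0. Qed.

Lemma enormN u : enorm (- u) = enorm u.
Proof. by rewrite /enorm !dotpE opprK. Qed.

Lemma enormBC u v : enorm (u - v) = enorm (v - u).
Proof. by rewrite -enormN opprB. Qed.

Lemma enorm0 : enorm (0 : 'rV[R]_d) = 0.
Proof. by rewrite /enorm dotp0l sqrtr0. Qed.

Lemma enormZ a u : enorm (a *: u) = `|a| * enorm u.
Proof.
by rewrite /enorm !dotpE mulrA -expr2 sqrtrM ?sqr_ge0// sqrtr_sqr.
Qed.

Lemma coord_le_enorm u i : `|u 0 i| <= enorm u.
Proof.
rewrite -sqrtr_sqr; apply: ler_wsqrtr; rewrite /dotp (bigD1 i)//= -expr2 lerDl.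
by apply: sumr_ge0 => j _; rewrite -expr2 sqr_ge0.
Qed.

Lemma enorm_eq0 u : enorm u = 0 -> u = 0.
Proof.
move=> u0; apply/rowP => i; rewrite mxE; apply/eqP; rewrite -normr_le0 -u0.
exact: coord_le_enorm.
Qed.

Lemma dotp_le_enorm u v : dotp u v <= enorm u * enorm v.
Proof.
have [/enorm_eq0 ->|u0] := eqVneq (enorm u) 0; first by rewrite dotp0l enorm0 mul0r.
have [/enorm_eq0 ->|v0] := eqVneq (enorm v) 0; first by rewrite dotp0r enorm0 mulr0.
have uv0 : 0 < enorm u * enorm v by rewrite mulr_gt0// lt0r ?u0 ?v0 enorm_ge0.
have := dotp_ge0 (enorm v *: u - enorm u *: v).
rewrite !dotpE -!enorm2E (dotpC v u) => h.
by rewrite -(ler_pM2l uv0); lra.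
Qed.

Lemma dotp_ge_enorm u v : - (enorm u * enorm v) <= dotp u v.
Proof. by rewrite lerNl -dotpNl -(enormN u) dotp_le_enorm. Qed.

Lemma enormD u v : enorm (u + v) <= enorm u + enorm v.
Proof.
rewrite -ler_sqr ?nnegrE ?enorm_ge0 ?addr_ge0 ?enorm_ge0// enorm2E !dotpE.
have := dotp_le_enorm u v; rewrite sqrrD !enorm2E (dotpC v u); lra.
Qed.

Lemma enormB u v : enorm (u - v) <= enorm u + enorm v.
Proof. by rewrite -(enormN v) enormD. Qed.

Lemma enorm_triangle v u w : enorm (u - w) <= enorm (u - v) + enorm (v - w).
Proof. by rewrite -[u - w](subrKA v) enormD. Qed.

Lemma dotp_young a u v : 0 < a ->
  dotp u v <= a / 2 * enorm u ^+ 2 + (2 * a)^-1 * enorm v ^+ 2.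
Proof.
move=> a0; have := dotp_ge0 (a *: u - v); rewrite !dotpE (dotpC v u) !enorm2E => h.
rewrite -(ler_pM2l (mulr_gt0 (ltr0n R 2) a0)).
rewrite [leRHS](_ : _ = a * a * dotp u u + dotp v v); last by field; rewrite gt_eqF.
by nra.
Qed.

Lemma enormD2 u v : enorm (u + v) ^+ 2 = enorm u ^+ 2 + 2 * dotp u v + enorm v ^+ 2.
Proof. by rewrite !enorm2E !dotpE (dotpC v u); lra. Qed.

Lemma enormB2 u v : enorm (u - v) ^+ 2 = enorm u ^+ 2 - 2 * dotp u v + enorm v ^+ 2.
Proof. by rewrite !enorm2E !dotpE (dotpC v u); lra. Qed.

Lemma enorm2_conv t u v :
  enorm (t *: u + (1 - t) *: v) ^+ 2
  = t * enorm u ^+ 2 + (1 - t) * enorm v ^+ 2 - t * (1 - t) * enorm (u - v) ^+ 2.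
Proof. by rewrite !enorm2E !dotpE (dotpC v u); ring. Qed.

Lemma norm_le_enorm u : `|u| <= enorm u.
Proof.
rewrite /Num.norm/= mx_normrE; apply: bigmax_le; first exact: enorm_ge0.
by move=> [i j] _; rewrite (ord1 i) coord_le_enorm.
Qed.

Lemma coord_le_norm u i : `|u 0 i| <= `|u|.
Proof.
rewrite [leRHS]/Num.norm/= mx_normrE.
by apply: (le_bigmax_cond _ (fun j => `|u j.1 j.2|) (j := (0, i))).
Qed.

(** The summand 1 keeps the constant positive when d = 0, so that radii can be divided by it. *)
Lemma enorm_le_norm u : enorm u <= (1 + d%:R) * `|u|.
Proof.
rewrite -ler_sqr ?nnegrE ?enorm_ge0 ?mulr_ge0//.
rewrite enorm2E exprMn (@le_trans _ _ (d%:R * `|u| ^+ 2))//.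
  have -> : d%:R * `|u| ^+ 2 = \sum_(i < d) `|u| ^+ 2.
    by rewrite sumr_const card_ord mulr_natl.
  apply: ler_sum => i _.
  rewrite -expr2 -real_normK ?num_real// lerXn2r ?nnegrE//.
  exact: coord_le_norm.
apply: ler_wpM2r; first exact: sqr_ge0.
by have : 0 <= d%:R :> R by []; nra.
Qed.

Lemma nbhs_enormP x (A : set 'rV[R]_d) :
  nbhs x A <-> exists2 e : R, 0 < e & forall y, enorm (y - x) < e -> A y.
Proof.
split.
- move/nbhs_ballP => [e /= e0 h]; exists e => // y yx; apply: h.
  by rewrite -ball_normE/= distrC (le_lt_trans (norm_le_enorm _)).
- move=> [e e0 h]; apply/nbhs_ballP; exists (e / (1 + d%:R)) => /=.
    by rewrite divr_gt0// ltr_wpDr.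
  move=> y; rewrite -ball_normE/= => yx; apply: h.
  rewrite enormBC (le_lt_trans (enorm_le_norm _))// mulrC -ltr_pdivlMr//.
Qed.

Lemma continuous_enorm : continuous (@enorm R d).
Proof.
move=> x; apply/(@cvgrPdist_lt _ R^o _ (nbhs x)) => e e0.
apply/nbhs_enormP; exists e => // y yx.
rewrite (le_lt_trans _ yx)// ler_norml.
have := enorm_triangle 0 x 0; have := enorm_triangle y x 0; have := enorm_triangle x y 0.
by rewrite !subr0 (enormBC x y); lra.
Qed.

End Euclid.

(** An extended-valued convex function as a pair: its domain E, convex by the first conjunct, and a
    real function whose values off E are irrelevant. *)
Definition convex_on (R : realType) (d : nat) (E : set 'rV[R]_d)
    (phi : 'rV[R]_d -> R) : Prop :=
  forall x y t, 0 <= t <= 1 -> E x -> E y ->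
    E (t *: x + (1 - t) *: y) /\
    phi (t *: x + (1 - t) *: y) <= t * phi x + (1 - t) * phi y.

(** * First-order conditions for proximal minimizers, affine minorants *)

Section ConvexAnalysis.
Context (R : realType) (d : nat).
Implicit Types (x y z m p u v w : 'rV[R]_d) (E : set 'rV[R]_d).
Implicit Types (phi : 'rV[R]_d -> R) (f : 'rV[R]_d -> \bar R).

Lemma convex_comb m y (t : R) : t *: y + (1 - t) *: m = m + t *: (y - m).
Proof. by rewrite scalerBl scale1r scalerBr addrCA addrA. Qed.

(* Dividing the inequality at m + t (y - m) by t and letting t tend to 0. *)
Lemma minimizer_first_order E phi q m y (l c : R) :
  convex_on E phi -> E m -> E y ->
  (forall t, 0 <= t <= 1 -> q (m + t *: (y - m)) = q m + t * l + t ^+ 2 * c) ->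
  (forall x, E x -> phi m + q m <= phi x + q x) ->
  phi m <= phi y + l.
Proof.
move=> cphi Em Ey qE mmin; rewrite leNgt; apply/negP => lt.
pose D := phi m - phi y - l; have D0 : 0 < D by rewrite /D; lra.
(* Small enough for t <= 1 and t c < D, so that the first-order gain beats the quadratic term. *)
pose t := D / (D + `|c| + 1).
have den0 : 0 < D + `|c| + 1 by rewrite ltr_wpDl// addr_ge0// ltW.
have t0 : 0 < t by rewrite divr_gt0.
have t1 : t <= 1 by rewrite ler_pdivrMr// mul1r -addrA lerDl addr_ge0.
have tc : t * c < D.
  have tden : t * (D + `|c| + 1) = D by rewrite mulfVK// gt_eqF.
  by have := ler_norm c; nra.
have t01 : 0 <= t <= 1 by rewrite ltW.
have [Ez le1] := cphi y m t t01 Ey Em.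
have := mmin _ Ez; move: le1; rewrite convex_comb qE// => le1 le2.
have : 0 <= t * (- D + t * c) by rewrite /D; lra.
by rewrite pmulr_rge0//; lra.
Qed.

Lemma prox_first_order E phi (s : R) m y p :
  convex_on E phi -> E m -> E y ->
  (forall x, E x ->
    phi m + s / 2 * enorm (m - p) ^+ 2 <= phi x + s / 2 * enorm (x - p) ^+ 2) ->
  phi m + s * dotp (p - m) (y - m) <= phi y.
Proof.
move=> cphi Em Ey mmin.
have := @minimizer_first_order E phi (fun x => s / 2 * enorm (x - p) ^+ 2) m y
  (s * dotp (m - p) (y - m)) (s / 2 * enorm (y - m) ^+ 2) cphi Em Ey _ mmin.
rewrite -(opprB m p) dotpNl; set a := dotp _ _ => h.
suff /h : forall t : R, 0 <= t <= 1 -> s / 2 * enorm (m + t *: (y - m) - p) ^+ 2 =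
  s / 2 * enorm (m - p) ^+ 2 + t * (s * a) + t ^+ 2 * (s / 2 * enorm (y - m) ^+ 2).
  by lra.
move=> t _; rewrite (addrAC m _ (- p)).
by rewrite (enormD2 (m - p)) dotpZr enormZ exprMn real_normK ?num_real// -/a; field.
Qed.

Lemma prox_three_point E phi (s : R) m y p :
  convex_on E phi -> E m -> E y ->
  (forall x, E x ->
    phi m + s / 2 * enorm (m - p) ^+ 2 <= phi x + s / 2 * enorm (x - p) ^+ 2) ->
  phi m + s / 2 * enorm (m - p) ^+ 2 + s / 2 * enorm (y - m) ^+ 2
  <= phi y + s / 2 * enorm (y - p) ^+ 2.
Proof.
move=> cphi Em Ey /(prox_first_order cphi Em Ey).
have -> : y - p = (y - m) - (p - m) by rewrite opprB addrA subrK.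
rewrite -(opprB p m) enormN (enormB2 (y - m)) (dotpC (y - m)).
by set a := dotp _ _; nra.
Qed.

(* f >= f x0 - 1 near x0, and convexity propagates this to an affine lower bound
   along each ray from x0. *)
Lemma lsc_convex_minorant f x0 :
  lower_semicontinuous f -> econvex f -> (forall x, (-oo < f x)%E) -> edom f x0 ->
  exists a b : R, 0 <= b /\ forall x, ((a - b * enorm (x - x0))%:E <= f x)%E.
Proof.
move=> lf cf fNy f0; have f0fin : f x0 \is a fin_num.
  by rewrite fin_numE -ltNye -ltey fNy f0.
have [|V nV fV] := lf x0 (fine (f x0) - 1).
  by rewrite EFinB fineK// lteBlDr// lteDl// lte_fin.
have /nbhs_enormP[e e0 he] := nV.
exists (fine (f x0) - 1), (2 / e); split; first by rewrite divr_ge0// ltW.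
move=> x; have [xe|ex] := ltP (enorm (x - x0)) e.
  have := fV _ (he _ xe); move/ltW; apply: le_trans; rewrite lee_fin.
  by rewrite gerDl oppr_le0 mulr_ge0 ?enorm_ge0// divr_ge0// ltW.
case fxE : (f x) => [fx| |]; last 2 first.
- by rewrite leey.
- by have := fNy x; rewrite fxE.
have n0 : 0 < enorm (x - x0) by rewrite (lt_le_trans e0).
(* The point with parameter t lies on the segment from x0 to x, at distance e / 2 from x0, hence in
   the ball where f is bounded below. *)
pose t := e / (2 * enorm (x - x0)).
have t0 : 0 < t by rewrite divr_gt0// mulr_gt0.
have t1 : t <= 1 by rewrite ler_pdivrMr ?mulr_gt0// mul1r; lra.
have := cf x x0 t; rewrite ltW//= t1 => /(_ isT).
rewrite convex_comb fxE -(fineK f0fin) -!EFinM -EFinD => le1.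
have zV : V (x0 + t *: (x - x0)).
  apply: he; rewrite addrC addKr enormZ gtr0_norm// /t.
  rewrite [ltLHS](_ : _ = e / 2); last by field; rewrite !gt_eqF.
  by lra.
have := fV _ zV; case: (f (x0 + _)) le1 => [c| |]//; rewrite lee_fin lte_fin => le1 lt1.
rewrite lee_fin.
have tn : 2 / e * enorm (x - x0) = t^-1 by rewrite /t; field; rewrite !gt_eqF.
rewrite tn; have tV : t * t^-1 = 1 by rewrite divff// gt_eqF.
have : 0 < t * (fx - fine (f x0) + t^-1).
  by rewrite mulrDr tV; nra.
by rewrite pmulr_rgt0//; lra.
Qed.

End ConvexAnalysis.

(** * Existence of proximal points *)

Section ProxExistence.
Context (R : realType) (d : nat).
Implicit Types (x y z m p u v w : 'rV[R]_d) (f : 'rV[R]_d -> \bar R).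

Lemma econvex_fine f : econvex f -> (forall x, (-oo < f x)%E) ->
  convex_on (edom f) (fine \o f).
Proof.
move=> cf fNy x y t t01 fx fy.
have xfin : f x \is a fin_num by rewrite fin_numE -ltNye -ltey fNy.
have yfin : f y \is a fin_num by rewrite fin_numE -ltNye -ltey fNy.
have := cf x y t t01; rewrite -{1}(fineK xfin) -{1}(fineK yfin) -!EFinM -EFinD.
move=> le; split; first by rewrite /edom/= (le_lt_trans le)// ltey.
by move: le (fNy (t *: x + (1 - t) *: y)) => /=; case: (f (t *: x + _)).
Qed.

(* A minimizing sequence is Cauchy by strong convexity, and its limit is a
   minimizer by lower semicontinuity. *)
Lemma prox_exists f (s : R) p : 0 < s ->
  lower_semicontinuous f -> econvex f -> eproper f ->
  exists2 m, edom f m & forall y, edom f y ->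
    fine (f m) + s / 2 * enorm (m - p) ^+ 2 <= fine (f y) + s / 2 * enorm (y - p) ^+ 2.
Proof.
move=> s0 lf cf [[x0 f0] fNy].
have ffin x : edom f x -> f x \is a fin_num.
  by move=> fx; rewrite fin_numE -ltNye -ltey fNy.
pose q x := fine (f x) + s / 2 * enorm (x - p) ^+ 2.
have [a [b [b0 hab]]] := lsc_convex_minorant lf cf fNy f0.
pose S := [set q x | x in edom f].
(* The quadratic term dominates the linear decrease of the minorant: complete the square in s |x -
   p| - b. *)
have lbS : has_lbound S.
  exists (a - b * enorm (p - x0) - b ^+ 2 / (2 * s)) => _ [x fx <-].
  have := hab x; rewrite -(fineK (ffin _ fx)) lee_fin => hx.
  have tri := enorm_triangle p x x0.
  have sq : 0 <= (s * enorm (x - p) - b) ^+ 2 / (2 * s).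
    by rewrite divr_ge0 ?sqr_ge0// mulr_ge0// ltW.
  have E : (s * enorm (x - p) - b) ^+ 2 / (2 * s) =
    s / 2 * enorm (x - p) ^+ 2 - b * enorm (x - p) + b ^+ 2 / (2 * s).
    by field; rewrite gt_eqF.
  rewrite /q; rewrite E in sq.
  have : b * enorm (x - x0) <= b * (enorm (x - p) + enorm (p - x0)).
    by rewrite ler_wpM2l.
  lra.
have infS : has_inf S by split => //; exists (q x0), x0.
pose I := inf S.
have Iq x : edom f x -> I <= q x by move=> fx; apply: ge_inf => //; exists x.
have /choice[u hu] : forall n : nat, exists x, edom f x /\ q x < I + n.+1%:R^-1.
  move=> n; have n0 : (0 : R) < n.+1%:R^-1 by rewrite invr_gt0.
  by have [_ [x fx <-] lt] := inf_adherent n0 infS; exists x.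
(* The midpoint of u n and u k has value at least I, while strong convexity puts it s / 8 |u n - u
   k|^2 below the mean of the two values. *)
have close n k : s / 8 * enorm (u n - u k) ^+ 2 <= (n.+1%:R^-1 + k.+1%:R^-1) / 2.
  have [fn qn] := hu n; have [fk qk] := hu k.
  have h01 : (0 <= 1 / 2 :> R) && (1 / 2 <= 1 :> R) by apply/andP; split; lra.
  have [fmid lemid] := econvex_fine cf fNy h01 fn fk.
  have := Iq _ fmid; move: qn qk lemid; rewrite /q /=.
  have -> : (1 / 2) *: u n + (1 - 1 / 2) *: u k - p =
    (1 / 2) *: (u n - p) + (1 - 1 / 2) *: (u k - p).
    by rewrite !scalerBr addrACA -opprD -scalerDl subrKC scale1r.
  rewrite enorm2_conv [u n - p - _](_ : _ = u n - u k); last first.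
    by rewrite opprB addrA subrK.
  move: (n.+1%:R^-1 : R) (k.+1%:R^-1 : R) => a1 a2; lra.
have cvgV : (n.+1%:R^-1 : R) @[n --> \oo] --> (0 : R) := @cvg_harmonic R.
have : cvg (u @ \oo).
  apply: cauchy_cvg; apply: cauchy_exP => e e0.
  have e'0 : 0 < s / 8 * e ^+ 2 by rewrite mulr_gt0 ?exprn_gt0// divr_gt0.
  have := cvgV; move/(@cvgrPdist_lt _ R^o) => /(_ _ e'0) [N _ hN].
  exists (u N); exists N => // k /= Nk; rewrite -ball_normE/=.
  rewrite (le_lt_trans (norm_le_enorm _))// -ltr_sqr ?nnegrE ?enorm_ge0 ?(ltW e0)//.
  rewrite -(ltr_pM2l (_ : 0 < s / 8)) ?divr_gt0//.
  rewrite (le_lt_trans (close _ _))//.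
  have := hN N (leqnn _); have := hN k Nk.
  rewrite /= !sub0r !normrN !ger0_norm ?invr_ge0//.
  by move: (N.+1%:R^-1 : R) (k.+1%:R^-1 : R) => a1 a2; lra.
move/cvg_ex => [m um].
have cvgn : enorm (u n - p) @[n --> \oo] --> enorm (m - p).
  apply: (@cvg_comp _ _ _ (fun n => u n - p) (@enorm R d) _ (nbhs (m - p))).
    by apply: (@cvgB _ 'rV[R]_d) => //; exact: cvg_cst.
  exact: continuous_enorm.
have cvgq : s / 2 * enorm (u n - p) ^+ 2 @[n --> \oo] --> s / 2 * enorm (m - p) ^+ 2.
  by apply: (@cvgM R); [exact: (@cvg_cst R^o)|exact: (@cvgM R)].
(* Lower semicontinuity keeps f (u n) above c eventually, and the bound passes to the limit. It
   serves twice: with a large c to exclude f m = +oo, then with c halfway between f m and the value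
   that would attain I. *)
have key (c : R) : (c%:E < f m)%E -> c + s / 2 * enorm (m - p) ^+ 2 <= I.
  move=> cm; have [V nV fV] := lf _ _ cm.
  have cI : I + n.+1%:R^-1 @[n --> \oo] --> I.
    by rewrite -[X in _ --> X]addr0; apply: (@cvgD _ R^o) => //; exact: (@cvg_cst R^o).
  have cc : c + s / 2 * enorm (u n - p) ^+ 2 @[n --> \oo] -->
      c + s / 2 * enorm (m - p) ^+ 2.
    by apply: (@cvgD _ R^o) => //; exact: (@cvg_cst R^o).
  apply: (ler_cvg_to cc cI).
  have [N _ hN] := um _ nV; exists N => // n /= Nn; have Vn := hN n Nn.
  have [fn qn] := hu n; rewrite (le_trans _ (ltW qn))// /q lerD2r.
  by rewrite -lee_fin fineK ?ffin// ltW// fV.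
have fm : edom f m.
  rewrite /edom/= ltey; apply/eqP => fmy.
  have := key (I - s / 2 * enorm (m - p) ^+ 2 + 1); rewrite fmy ltey => /(_ isT); lra.
exists m => // y fy; apply: le_trans (Iq _ fy).
rewrite leNgt; apply/negP => lt.
pose c := (fine (f m) + (I - s / 2 * enorm (m - p) ^+ 2)) / 2.
have : (c%:E < f m)%E by rewrite -(fineK (ffin _ fm)) lte_fin /c; lra.
by move/key; rewrite /c; lra.
Qed.

End ProxExistence.

(** * Hahn-Banach, the sum rule for subdifferentials, and gradients *)

Section Subgradients.
Context (R : realType) (d : nat).
Implicit Types (x y z m p u v w : 'rV[R]_d) (E : set 'rV[R]_d).

(* Hahn-Banach, extending the linear functional one coordinate at a time. *)
Lemma convex_linear_minorant (phi : 'rV[R]_d -> R) :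
  convex_on setT phi -> phi 0 = 0 -> exists v, forall x, dotp v x <= phi x.
Proof.
move=> cphi phi0.
suff /(_ d (leqnn d))[v hv] : forall k, (k <= d)%N -> exists v, forall x,
    (forall i : 'I_d, (k <= i)%N -> x 0 i = 0) -> dotp v x <= phi x.
  by exists v => x; apply: hv => i; rewrite leqNgt ltn_ord.
elim=> [_|k IH kd].
  exists 0 => x x0; have -> : x = 0 by apply/rowP => i; rewrite mxE x0.
  by rewrite dotp0r phi0.
have [v hv] := IH (ltnW kd).
pose j := Ordinal kd; pose e : 'rV[R]_d := delta_mx 0 j.
pose W := [set x : 'rV[R]_d | forall i : 'I_d, (k <= i)%N -> x 0 i = 0].
(* Every lower bound on the new coordinate is below every upper bound: in the convex combination of
   y + t e and x - s e with weight s / (s + t), the direction e cancels and the induction hypothesis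
   applies. *)
have key x y s t : W x -> W y -> 0 < s -> 0 < t ->
    (dotp v x - phi (x - s *: e)) / s <= (phi (y + t *: e) - dotp v y) / t.
  move=> Wx Wy s0 t0.
  rewrite ler_pdivrMr// mulrAC ler_pdivlMr//.
  pose l := s / (s + t); have st0 : 0 < s + t by rewrite addr_gt0.
  have l01 : 0 <= l <= 1.
    by rewrite /l divr_ge0 ?(ltW s0) ?(ltW st0)//= ler_pdivrMr// mul1r lerDl ltW.
  have ls : l * (s + t) = s by rewrite mulfVK// gt_eqF.
  have := cphi (y + t *: e) (x - s *: e) l l01 I I => -[_].
  have -> : l *: (y + t *: e) + (1 - l) *: (x - s *: e) = l *: y + (1 - l) *: x.
    rewrite !scalerDr addrACA !scalerN !scalerA -scalerBl.
    suff -> : l * t - (1 - l) * s = 0 by rewrite scale0r addr0.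
    by move: ls; rewrite mulrDr; lra.
  have : dotp v (l *: y + (1 - l) *: x) <= phi (l *: y + (1 - l) *: x).
    by apply: hv => i ki; rewrite !mxE Wx// Wy// !mulr0 addr0.
  rewrite !dotpE => h1 h2.
  have lt : (1 - l) * (s + t) = t by rewrite mulrBl ls mul1r [s + t]addrC addrK.
  pose a := phi (y + t *: e) - dotp v y; pose b := phi (x - s *: e) - dotp v x.
  have {h1 h2} h : 0 <= l * a + (1 - l) * b by rewrite /a /b; lra.
  have : 0 <= (s + t) * (l * a + (1 - l) * b) by rewrite mulr_ge0 ?(ltW st0).
  have -> : (s + t) * (l * a + (1 - l) * b) = (l * (s + t)) * a + ((1 - l) * (s + t)) * b.
    by ring.
  by rewrite ls lt /a /b; lra.
pose S := [set r : R | exists x s, [/\ W x, 0 < s & r = (dotp v x - phi (x - s *: e)) / s]].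
have W0 : W 0 by move=> i _; rewrite mxE.
have supS : has_sup S.
  split; first by exists ((dotp v 0 - phi (0 - 1 *: e)) / 1), 0, 1.
  exists ((phi (0 + 1 *: e) - dotp v 0) / 1) => _ [x [s [Wx s0 ->]]].
  exact: key.
pose a := sup S.
have le_a x s : W x -> 0 < s -> (dotp v x - phi (x - s *: e)) / s <= a.
  by move=> Wx s0; apply: ub_le_sup; [case: supS|exists x, s].
have a_le y t : W y -> 0 < t -> a <= (phi (y + t *: e) - dotp v y) / t.
  move=> Wy t0; apply: ge_sup; first by case: supS.
  by move=> _ [x [s [Wx s0 ->]]]; exact: key.
(* The j-th coordinate of v, unconstrained so far, is overwritten by a. *)
exists (v + (a - v 0 j) *: e) => w hw.
pose x := w - w 0 j *: e.
have Wx : W x.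
  move=> i; rewrite leq_eqVlt => /predU1P[ki|ki].
    have -> : i = j by apply/val_inj.
    by rewrite !mxE !eqxx mulr1 subrr.
  have ij : i != j by rewrite -val_eqE/= gtn_eqF.
  by rewrite !mxE (hw i ki) (negbTE ij) andbF mulr0 subr0.
have wx : w = x + w 0 j *: e by rewrite subrK.
rewrite dotpDl dotpZl (dotpC e) dotp_delta.
have -> : dotp v w = dotp v x + w 0 j * v 0 j.
  by rewrite {1}wx dotpDr dotpZr dotp_delta.
have [w0|w0|w0] := ltgtP (w 0 j) 0.
- have := le_a x (- w 0 j) Wx; rewrite oppr_gt0 => /(_ w0).
  rewrite scaleNr opprK -wx ler_pdivrMr ?oppr_gt0//; lra.
- have := a_le x (w 0 j) Wx w0; rewrite -wx ler_pdivlMr//; lra.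
- have xw : x = w by rewrite /x w0 scale0r subr0.
  by have := hv _ Wx; rewrite xw w0; lra.
Qed.

(* Hahn-Banach applied to the infimal convolution
   x |-> inf_y (g (x + y) - g m + r y - r m - w . (y - m)). *)
Lemma subgradient_sum (g r : 'rV[R]_d -> R) E m w :
  convex_on setT g -> convex_on E r -> E m ->
  (forall y, E y -> g m + r m + dotp w (y - m) <= g y + r y) ->
  exists u v, [/\ w = u + v, forall y, g m + dotp u (y - m) <= g y &
    forall y, E y -> r m + dotp v (y - m) <= r y].
Proof.
move=> cg cr Em hw.
pose A x y := g (x + y) - g m + r y - r m - dotp w (y - m).
have A0 y : E y -> 0 <= A 0 y by move=> /hw; rewrite /A add0r; lra.
have Am x : A x m = g (x + m) - g m by rewrite /A subrr dotp0r; lra.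
have cA x1 x2 y1 y2 t : 0 <= t <= 1 -> E y1 -> E y2 ->
    E (t *: y1 + (1 - t) *: y2) /\ A (t *: x1 + (1 - t) *: x2) (t *: y1 + (1 - t) *: y2)
      <= t * A x1 y1 + (1 - t) * A x2 y2.
  move=> t01 E1 E2; have [Et rt] := cr _ _ _ t01 E1 E2; split => //.
  have [_] := cg (x1 + y1) (x2 + y2) _ t01 I I.
  rewrite /A !scalerDr addrACA.
  have -> : t *: y1 + (1 - t) *: y2 - m = t *: (y1 - m) + (1 - t) *: (y2 - m).
    by rewrite !scalerBr addrACA -opprD -scalerDl subrKC scale1r.
  rewrite (dotpDr w (t *: _)) !dotpZr; lra.
(* 0 is the midpoint of x and - x, so A 0 >= 0 and joint convexity bound A x below, which makes the
   infimal convolution finite. *)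
have lbA x y : E y -> - A (- x) m <= A x y.
  move=> Ey; have h01 : (0 <= 1 / 2 :> R) && (1 / 2 <= 1 :> R) by apply/andP; split; lra.
  have [Et] := cA x (- x) _ _ _ h01 Ey Em.
  have -> : (1 / 2) *: x + (1 - 1 / 2) *: - x = 0.
    by rewrite (_ : 1 - 1 / 2 = 1 / 2) ?scalerN ?subrr//; lra.
  by have := A0 _ Et; lra.
pose S x := [set A x y | y in E].
have infS x : has_inf (S x).
  by split; [exists (A x m), m|exists (- A (- x) m) => _ [y Ey <-]; exact: lbA].
pose phi x := inf (S x).
have phi_le x y : E y -> phi x <= A x y.
  by move=> Ey; apply: ge_inf; [case: (infS x)|exists y].
have phi0 : phi 0 = 0.
  apply/eqP; rewrite eq_le; apply/andP; split.
    by rewrite (le_trans (phi_le _ _ Em))// Am add0r subrr.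
  by apply: lb_le_inf; [case: (infS 0)|move=> _ [y Ey <-]; exact: A0].
have cphi : convex_on setT phi.
  move=> x1 x2 t t01 _ _; split => //; apply/ler_addgt0Pr => e e0.
  have [_ [y1 E1 <-] lt1] := inf_adherent e0 (infS x1).
  have [_ [y2 E2 <-] lt2] := inf_adherent e0 (infS x2).
  have [Et] := cA x1 x2 _ _ _ t01 E1 E2 => leA.
  apply: (le_trans (phi_le _ _ Et)); apply: (le_trans leA).
  case/andP: t01 => t0 t1.
  have := ler_wpM2l t0 (ltW lt1).
  have t10 : 0 <= 1 - t by lra.
  have := ler_wpM2l t10 (ltW lt2).
  rewrite -/(phi x1) -/(phi x2); lra.
have [u hu] := convex_linear_minorant cphi phi0.
exists u, (w - u); split; first by rewrite subrKC.
- move=> y; have := le_trans (hu (y - m)) (phi_le _ _ Em).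
  by rewrite Am subrK; lra.
- move=> y Ey; have := le_trans (hu (m - y)) (phi_le _ _ Ey).
  by rewrite /A subrK -(opprB y m) dotpNr dotpDl dotpNl; lra.
Qed.

(** The first-order error of f lies between 0 and that of G, which is o(t). *)
Lemma derivable_dominated (G f : 'rV[R]_d -> R) x v (l a : R) :
  is_derive x v (G : 'rV[R]_d -> R^o) l ->
  (forall t : R, 0 <= f (x + t *: v) - f x - t * a <= G (x + t *: v) - G x - t * l) ->
  is_derive x v (f : 'rV[R]_d -> R^o) a.
Proof.
move=> [dG Gl] hf.
have cf : (fun h : R => h^-1 *: ((f \o shift x) (h *: v) - f x)) @ 0^' --> (a : R^o).
  have cG : (fun h : R => h^-1 *: ((G \o shift x) (h *: v) - G x)) @ 0^' --> (l : R^o).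
    by rewrite -Gl; exact: dG.
  apply/(@cvgrPdist_lt _ R^o) => e e0.
  move/(@cvgrPdist_lt _ R^o) : cG => /(_ _ e0).
  apply: filter_app; near=> t.
  have t0 : t != 0 by near: t; exact: nbhs_dnbhs_neq.
  rewrite /= ![_ + x]addrC; have /andP[f0 fG] := hf t.
  have eqs (F : R) (c : R) : c - t^-1 *: F = - (t^-1 * (F - t * c)).
    by rewrite /GRing.scale/= mulrBr mulKf//; lra.
  rewrite !eqs !normrN !normrM; apply: le_lt_trans.
  by rewrite ler_wpM2l// ger0_norm// (le_trans fG)// ler_norm.
split; first by apply/cvg_ex; exists a.
by apply: cvg_lim => //; exact: norm_hausdorff.
Unshelve. all: by end_near. Qed.

(** Dividing by t > 0 and by t < 0 encloses a between difference quotients that all tend to l. *)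
Lemma subgradient_derive (G : 'rV[R]_d -> R) x v (l a : R) :
  is_derive x v (G : 'rV[R]_d -> R^o) l ->
  (forall t : R, t * a <= G (x + t *: v) - G x) -> l = a.
Proof.
move=> dG hG.
have cG : (fun h : R => h^-1 *: ((G \o shift x) (h *: v) - G x)) @ 0^' --> (l : R^o).
  by have [dG' <-] := dG.
apply/eqP; rewrite -subr_eq0 -normr_le0; apply/ler_addgt0Pr => e e0; rewrite add0r.
move/(@cvgrPdist_lt _ R^o) : cG => /(_ _ e0)/nbhs_ballP[del /= del0 hdel].
have del2 : 0 < del / 2 by rewrite divr_gt0.
have hball (t : R) : `|t| = del / 2 -> t != 0 ->
    `|l - t^-1 * (G (x + t *: v) - G x)| < e.
  move=> td t0; have := hdel t; rewrite /= (addrC _ x); apply => //.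
  by rewrite /ball/= sub0r normrN td; lra.
have := hball (del / 2); rewrite gtr0_norm// gt_eqF// => /(_ erefl isT).
have := hball (- (del / 2)).
rewrite normrN gtr0_norm// oppr_eq0 gt_eqF// => /(_ erefl isT).
have h1 := hG (del / 2); have h2 := hG (- (del / 2)).
have {h1} h1 : a <= (del / 2)^-1 * (G (x + (del / 2) *: v) - G x).
  by rewrite -(ler_pM2l del2) mulVKf// gt_eqF.
have {h2} h2 : (- (del / 2))^-1 * (G (x + (- (del / 2)) *: v) - G x) <= a.
  by rewrite invrN mulNr -mulrN -(ler_pM2l del2) mulVKf ?gt_eqF//; lra.
rewrite ler_norml !ltr_norml; move: h1 h2.
move: (_^-1 * _) => r1; move: (_^-1 * _) => r2; lra.
Qed.

Lemma subgradient_grad (f : 'rV[R]_d -> R) x v :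
  differentiable (f : 'rV[R]_d -> R^o) x ->
  (forall y, f x + dotp v (y - x) <= f y) -> grad f x = v.
Proof.
move=> df hv; apply/rowP => i; rewrite mxE.
apply: (@subgradient_derive f x (delta_mx 0 i)).
  by apply: derivableP; exact: diff_derivable.
move=> t; have := hv (x + t *: delta_mx 0 i).
by rewrite [x + _ - x]addrAC subrr add0r dotpZr dotp_delta; lra.
Qed.

(* Both summands are squeezed between a linear function and the differentiable
   sum, hence have partial derivatives. *)
Lemma grad_convex_sum (g r : 'rV[R]_d -> R) x :
  convex_on setT g -> convex_on setT r ->
  differentiable ((fun y => g y + r y) : 'rV[R]_d -> R^o) x ->
  (exists w, forall y, g x + r x + dotp w (y - x) <= g y + r y) ->
  grad (fun y => g y + r y) x = grad g x + grad r x.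
Proof.
move=> cg cr dgr [w hw].
have [u [v [wuv hu hv]]] := subgradient_sum cg cr I (fun y _ => hw y).
have hv' y : r x + dotp v (y - x) <= r y by exact: hv.
have wE : grad (fun y => g y + r y) x = w by exact: subgradient_grad.
(* The linearization error of f2 is nonnegative, so that of f1 is at most the error of the sum. The
   roles of g and r are exchanged afterwards. *)
have half (f1 f2 : 'rV[R]_d -> R) (u1 u2 : 'rV[R]_d) : w = u1 + u2 ->
    (forall y, f1 y + f2 y = g y + r y) ->
    (forall y, f1 x + dotp u1 (y - x) <= f1 y) ->
    (forall y, f2 x + dotp u2 (y - x) <= f2 y) -> grad f1 x = u1.
  move=> w12 f12 h1 h2; apply/rowP => i; rewrite mxE.
  suff [] : is_derive x (delta_mx 0 i) (f1 : 'rV[R]_d -> R^o) (u1 0 i) by [].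
  apply: (@derivable_dominated (fun y => g y + r y) _ _ _ (w 0 i)).
    rewrite -wE mxE; apply: derivableP; exact: diff_derivable.
  move=> t; have := h1 (x + t *: delta_mx 0 i); have := h2 (x + t *: delta_mx 0 i).
  rewrite [x + _ - x]addrAC subrr add0r !dotpZr !dotp_delta -!f12 w12 mxE; lra.
rewrite wE wuv; congr (_ + _); symmetry; first by exact: (half g r u v wuv _ hu hv').
apply: (half r g v u); [by rewrite wuv addrC|by move=> y; rewrite addrC|exact: hv'|exact: hu].
Qed.

End Subgradients.

(** * Measurability, independence and moments *)

Section BorelVectors.
Context (R : realType) (dT : measure_display) (T : measurableType dT).

Lemma lsc_measurable (n : nat) (f : 'rV[R]_n -> \bar R) :
  lower_semicontinuous f -> measurable_fun [set: borelV R n] f.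
Proof.
move=> lf; apply: (measurability _ (ErealGenOInfty.measurableE R)).
move=> /= _ [_ [a ->]] <-; rewrite setTI preimage_itvoy.
by apply: sub_sigma_algebra; move/lower_semicontinuousP : lf; exact.
Qed.

Lemma coord_measurable (n : nat) (i : 'I_n) :
  measurable_fun [set: borelV R n] (fun v => v 0 i).
Proof.
apply/measurable_EFinP; apply: lsc_measurable => x a ax.
exists [set y : 'rV[R]_n | a < y 0 i]; last by move=> y /=; rewrite lte_fin.
apply/nbhs_enormP; exists (x 0 i - a); first by rewrite subr_gt0 -lte_fin.
move=> y yx; have := coord_le_enorm (y - x) i; rewrite !mxE ler_norml /=; lra.
Qed.

Lemma measurable_coord n (f : T -> borelV R n) i :
  measurable_fun setT f -> measurable_fun setT (fun w => f w 0 i).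
Proof.
by move=> mf; exact: (measurableT_comp (coord_measurable i) mf).
Qed.

(* An open set is a countable union of rational cubes. *)
Lemma measurable_row n (f : T -> borelV R n) :
  (forall i, measurable_fun setT (fun w => f w 0 i)) -> measurable_fun setT f.
Proof.
move=> mf; apply: (@measurability _ _ T (borelV R n) setT f (@open 'rV[R]_n) erefl) => _ [U oU <-].
rewrite setTI.
pose q (p : 'rV[rat]_n * nat) : 'rV[R]_n := \row_i ratr (p.1 0 i).
pose good (p : 'rV[rat]_n * nat) := forall y : 'rV[R]_n,
  (forall i, `|y 0 i - q p 0 i| < p.2.+1%:R^-1) -> U y.
pose cube p := [set w | good p /\ forall i, `|f w 0 i - q p 0 i| < p.2.+1%:R^-1].
suff -> : f @^-1` U = \bigcup_p cube p.
  apply: countable_bigcupT_measurable => // p.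
  have [gp|gp] := pselect (good p); last first.
    by rewrite (_ : cube p = set0)//; apply/seteqP; split => // w [].
  have -> : cube p = \bigcap_(i in [set: 'I_n])
      [set w | `|f w 0 i - q p 0 i| < p.2.+1%:R^-1].
    by apply/seteqP; split => w /=; [move=> [_ h] i _; exact: h|move=> h; split => // i; exact: h].
  apply: fin_bigcap_measurable => // i _.
  rewrite (_ : [set w | _] = setT `&` (fun w => f w 0 i) @^-1` ball (q p 0 i) p.2.+1%:R^-1).
    by apply: mf => //; exact: measurable_ball.
  by rewrite setTI; apply/seteqP; split => w; rewrite /ball/= distrC.
apply/seteqP; split => [w /= Ufw|w [p _ [gp h]]]; last exact: gp.
have /nbhs_ballP[e /= e0 he] : nbhs (f w : 'rV[R]_n) U by exact: open_nbhs_nbhs.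
have [k ke] : exists k : nat, k.+1%:R^-1 < e / 2.
  have e2 : 0 < e / 2 by rewrite divr_gt0.
  have /(@cvgrPdist_lt _ R^o)/(_ _ e2)[k _ hk] := @cvg_harmonic R.
  exists k; have := hk k (leqnn k).
  by rewrite /= sub0r normrN ger0_norm// invr_ge0.
have k0 : 0 < (k.+1%:R^-1 : R) by rewrite invr_gt0.
have /choice[r hr] : forall i, exists r : rat, `|f w 0 i - ratr r| < k.+1%:R^-1.
  move=> i; have [] := @rat_in_itvoo R (f w 0 i - k.+1%:R^-1) (f w 0 i + k.+1%:R^-1).
    by rewrite ltrBlDr -addrA ltrDl addr_gt0.
  move=> r; rewrite in_itv/= => /andP[h1 h2]; exists r.
  move: (k.+1%:R^-1 : R) h1 h2 => a h1 h2; rewrite ltr_norml; lra.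
exists (\row_i r i, k) => //; split => /= [y hy|i]; last by rewrite !mxE.
apply: he; split => // i j; rewrite (ord1 i) /ball/=.
have := hy j; rewrite !mxE; have := hr j; move: (k.+1%:R^-1 : R) ke => a ae h1 h2.
by rewrite (le_lt_trans (ler_distD (ratr (r j)) _ _))// [`|ratr _ - _|]distrC; lra.
Qed.

Lemma measurable_rowD n (f g : T -> borelV R n) :
  measurable_fun setT f -> measurable_fun setT g ->
  measurable_fun setT ((fun w => f w + g w) : T -> borelV R n).
Proof.
move=> mf mg; apply: measurable_row => i; under eq_fun do rewrite mxE.
by apply: measurable_funD; exact: measurable_coord.
Qed.

Lemma measurable_rowZ n (c : T -> R) (f : T -> borelV R n) :
  measurable_fun setT c -> measurable_fun setT f ->
  measurable_fun setT ((fun w => c w *: f w) : T -> borelV R n).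
Proof.
move=> mc mf; apply: measurable_row => i; under eq_fun do rewrite mxE.
by apply: measurable_funM => //; exact: measurable_coord.
Qed.

Lemma measurable_rowB n (f g : T -> borelV R n) :
  measurable_fun setT f -> measurable_fun setT g ->
  measurable_fun setT ((fun w => f w - g w) : T -> borelV R n).
Proof.
move=> mf mg; apply: measurable_row => i; under eq_fun do rewrite !mxE.
by apply: measurable_funB; exact: measurable_coord.
Qed.

Lemma measurable_row_sum n (I : Type) (s : seq I) (f : I -> T -> borelV R n) :
  (forall i, measurable_fun setT (f i)) ->
  measurable_fun setT ((fun w => \sum_(i <- s) f i w) : T -> borelV R n).
Proof.
move=> mf; apply: measurable_row => j; under eq_fun do rewrite summxE.
by apply: measurable_sum => i; exact: measurable_coord.
Qed.

Lemma measurable_dotp n (f g : T -> borelV R n) :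
  measurable_fun setT f -> measurable_fun setT g ->
  measurable_fun setT (fun w => dotp (f w) (g w)).
Proof.
move=> mf mg; apply: measurable_sum => i.
by apply: measurable_funM; exact: measurable_coord.
Qed.

Lemma measurable_enorm2 n (f : T -> borelV R n) :
  measurable_fun setT f -> measurable_fun setT (fun w => enorm (f w) ^+ 2).
Proof.
by move=> mf; under eq_fun do rewrite enorm2E; exact: measurable_dotp.
Qed.

Lemma measurable_enorm n (f : T -> borelV R n) :
  measurable_fun setT f -> measurable_fun setT (fun w => enorm (f w)).
Proof.
move=> mf; have lE : lower_semicontinuous (EFin \o @enorm R n).
  apply/lower_semicontinuousP => a.
  have -> : [set x | (a%:E < (EFin \o @enorm R n) x)%E] = @enorm R n @^-1` [set y | a < y].
    by apply/seteqP; split => x /=; rewrite lte_fin.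
  by apply: open_comp => [x _|]; [exact: continuous_enorm|exact: open_gt].
by apply/measurable_EFinP; exact: (measurableT_comp (lsc_measurable lE) mf).
Qed.

(** Continuity holds only relative to E, so the preimage of an open U under h may fail to be open;
    on E it coincides with the open set O of points whose E-neighbours are sent into U. *)
Lemma measurable_comp_continuous n k (E : set 'rV[R]_n) (h : 'rV[R]_n -> 'rV[R]_k)
    (f : T -> borelV R n) :
  (forall w, E (f w)) ->
  (forall x, E x -> forall e : R, 0 < e -> exists2 del : R, 0 < del &
    forall y, E y -> enorm (y - x) < del -> enorm (h y - h x) < e) ->
  measurable_fun setT f -> measurable_fun setT ((fun w => h (f w)) : T -> borelV R k).
Proof.
move=> Ef ch mf; apply: (@measurability _ _ T (borelV R k) setT _ (@open 'rV[R]_k) erefl) => _ [U oU <-].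
rewrite setTI.
pose O := [set z : 'rV[R]_n | exists2 e : R, 0 < e &
  forall y, E y -> enorm (y - z) < e -> U (h y)].
have oO : open O.
  rewrite openE => z [e e0 he]; apply/nbhs_enormP.
  exists (e / 2); first by rewrite divr_gt0.
  move=> z' zz'; exists (e / 2); first by rewrite divr_gt0.
  by move=> y Ey yz'; apply: he => //; rewrite (le_lt_trans (enorm_triangle z' _ _))//; lra.
rewrite (_ : _ @^-1` U = f @^-1` O); last first.
  apply/seteqP; split => w /=.
    move=> Uw; have /nbhs_enormP[e e0 he] : nbhs (h (f w)) U by exact: open_nbhs_nbhs.
    have [del del0 hdel] := ch _ (Ef w) _ e0.
    by exists del => // y Ey yw; apply: he; exact: hdel.
  by move=> [e e0 he]; apply: he => //; rewrite subrr enorm0.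
by rewrite -[X in measurable X]setTI; apply: mf => //; exact: sub_sigma_algebra.
Qed.

End BorelVectors.

(** Tonelli's theorem applied to the positive and negative parts of each coordinate. *)
Lemma measurable_vmean (R : realType) (n : nat) (dX dT : measure_display)
    (X : measurableType dX) (T : measurableType dT) (mu : probability X R)
    (s : T -> X -> 'rV[R]_n) :
  measurable_fun setT ((fun p => s p.1 p.2) : T * X -> borelV R n) ->
  measurable_fun setT ((fun x => vmean mu (s x)) : T -> borelV R n).
Proof.
move=> ms; apply: measurable_row => i; under eq_fun do rewrite mxE.
have mi : measurable_fun setT (fun p : T * X => (s p.1 p.2 0 i)%:E).
  by apply/measurable_EFinP; exact: measurable_coord.
rewrite /Rintegral; apply: measurableT_comp => //.
under eq_fun do rewrite integralE.
apply: emeasurable_funB.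
- rewrite [X in measurable_fun _ X](_ : _ =
    fubini_F mu (fun p : T * X => (s p.1 p.2 0 i)%:E)^\+%E).
    exact: (@measurable_fun_fubini_tonelli_F _ _ T X R mu _ (measurable_funepos mi)).
  by apply/funext => x; apply: eq_integral => y _; rewrite !funeposE.
- rewrite [X in measurable_fun _ X](_ : _ =
    fubini_F mu (fun p : T * X => (s p.1 p.2 0 i)%:E)^\-%E).
    exact: (@measurable_fun_fubini_tonelli_F _ _ T X R mu _ (measurable_funeneg mi)).
  by apply/funext => x; apply: eq_integral => y _; rewrite !funenegE.
Qed.

(** * Independence of the past and a fresh sample *)

Section Independence.
Context (R : realType) (dT : measure_display) (T : measurableType dT).
Context (P : probability T R).
Local Open Scope ereal_scope.

(** The substitute for conditioning on the past: w seen through G and the sample S have a product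
    joint law, so Tonelli lets the sample be averaged with w frozen. Measurability of H is asked for
    the sigma-algebra generated by G, not for that of T. *)
Lemma integral_independent dX (X : measurableType dX) (nu : probability X R)
    (G : set (set T)) (S : T -> X) (H : g_sigma_algebraType G * X -> \bar R) :
  G `<=` measurable -> measurable_fun setT S ->
  (forall A B, <<s G >> A -> measurable B -> P (A `&` S @^-1` B) = P A * nu B) ->
  measurable_fun setT H -> (forall p, 0 <= H p) ->
  \int[P]_w H (w, S w) = \int[P]_w \int[nu]_x H (w, x).
Proof.
move=> mG mS indep mH H0.
have mid : measurable_fun setT (id : T -> g_sigma_algebraType G).
  move=> _ B mB; rewrite setTI preimage_id.
  by apply: (smallest_sub (@sigma_algebra_measurable _ T) mG); exact: mB.
have mh : measurable_fun setT ((fun w => (w, S w)) : T -> g_sigma_algebraType G * X).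
  by apply/measurable_fun_pairP; split.
(* The identity into T with the smaller sigma-algebra; its law is the restriction of P. *)
pose idP : {mfun T >-> g_sigma_algebraType G} :=
  HB.pack (id : T -> g_sigma_algebraType G) (isMeasurableFun.Build _ _ _ _ _ mid).
pose hP : {mfun T >-> (g_sigma_algebraType G * X)%type} :=
  HB.pack ((fun w => (w, S w)) : T -> g_sigma_algebraType G * X)
    (isMeasurableFun.Build _ _ _ _ _ mh).
pose PG : probability _ R := distribution P idP.
pose J : probability _ R := distribution P hP.
transitivity (\int[J]_p H p).
  by rewrite ge0_integral_distribution.
transitivity (\int[PG \x nu]_p H p).
  apply: eq_measure_integral => A mA _; apply/esym.
  exact: (@product_measure_unique _ _ _ _ R PG nu J).
transitivity (\int[PG]_w \int[nu]_x H (w, x)).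
  by rewrite fubini_tonelli1.
rewrite ge0_integral_distribution//.
- exact: (@measurable_fun_fubini_tonelli_F _ _ _ X R nu H mH).
- by move=> w; exact: integral_ge0.
Qed.

Section Past.
Context (I : eqType) (D : set I) (E : I -> set (set T)).
Hypothesis E_measurable : forall i, E i `<=` measurable.
Hypothesis E_setT : forall i, E i setT.
Hypothesis E_setI : forall i, setI_closed (E i).
Hypothesis indep : mutually_independent P D E.

(** Only a generating family; the information carried by J is the sigma-algebra [<<s past J >>]. *)
Definition past (J : set I) : set (set T) := \bigcup_(i in J) E i.

Lemma past_measurable (J : set I) : past J `<=` measurable.
Proof. by move=> A [i _ EA]; exact: E_measurable EA. Qed.

(** Dynkin's argument: finite intersections of events indexed by J form a pi-system generating the
    past. On it the measures A |-> P (A [&] B) and A |-> P B * P A agree by mutual independence,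
    applied to the finite index list extended by j. *)
Lemma past_independent (J : set I) (j : I) A B :
  J `<=` D -> D j -> ~ J j -> <<s past J >> A -> E j B ->
  P (A `&` B) = P A * P B.
Proof.
move=> JD Dj nJj sA EB.
pose G := [set A : set T | exists (s : seq I) (f : I -> set T), [/\ uniq s,
  forall i, i \in s -> J i /\ E i (f i) & A = \bigcap_(i in [set` s]) f i]].
have mbig (s : seq I) (f : I -> set T) : (forall i, i \in s -> E i (f i)) ->
    measurable (\bigcap_(i in [set` s]) f i).
  move=> h; apply: fin_bigcap_measurable => [|i si]; first exact: finite_seq.
  by apply: (@E_measurable i); exact: h.
have mB : measurable B by exact: E_measurable EB.
have GT : G setT.
  by exists [::], (fun=> setT); split => //; apply/seteqP; split.
have mG : G `<=` measurable.
  by move=> _ [s [f [_ h ->]]]; apply: mbig => i /h[].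
have GI : setI_closed G.
  move=> _ _ [s1 [f1 [u1 h1 ->]]] [s2 [f2 [u2 h2 ->]]].
  exists (undup (s1 ++ s2)), (fun i => (if i \in s1 then f1 i else setT) `&`
     (if i \in s2 then f2 i else setT)); split; first exact: undup_uniq.
    move=> i; rewrite mem_undup mem_cat => i12; split.
      by case/orP : i12 => [/h1[]|/h2[]].
    by apply: E_setI; case: ifPn => [si|_]; [have [] := h1 i si|exact: E_setT|
      have [] := h2 i si|exact: E_setT].
  apply/seteqP; split => [w [w1 w2] i /= _|w h].
    by split; case: ifPn => // ?; [exact: w1|exact: w2].
  split=> i /= si; have := h i; rewrite /= mem_undup mem_cat si ?orbT => /(_ isT)[] //.
have sub : <<s past J >> `<=` <<s G >>.
  apply: smallest_sub; first exact: smallest_sigma_algebra.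
  move=> C [i Ji EC]; apply: sub_sigma_algebra; exists [:: i], (fun=> C); split => //.
    by move=> k; rewrite inE => /eqP ->.
  by apply/seteqP; split => [w Cw k|w] //= h; apply: (h i); rewrite /= inE.
have PBfin : (0 <= fine (P B))%R by rewrite fine_ge0.
pose m1 : {measure set T -> \bar R} := mrestr P mB.
pose m2 : {measure set T -> \bar R} := mscale (NngNum PBfin) P.
have m2E C : m2 C = P B * P C.
  by rewrite /m2 /= /mscale/=; congr (_ * _); rewrite fineK// fin_num_measure.
have m12 C : G C -> m1 C = m2 C.
  move=> [s [f [us h ->]]]; rewrite m2E /m1 /= /mrestr.
  have js : j \notin s by apply/negP => /h[].
  have hs : forall i, i \in s -> D i /\ E i (f i) by move=> i /h[/JD].
  rewrite (indep us hs).
  pose f' i := if i == j then B else f i.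
  have := @indep (j :: s) f'; rewrite /= js us => /(_ isT).
  have f'j : f' j = B by rewrite /f' eqxx.
  rewrite big_cons f'j.
  have -> : \prod_(i <- s) P (f' i) = \prod_(i <- s) P (f i).
    by apply: eq_big_seq => i si; rewrite /f'; case: eqVneq si js => // -> ->.
  move=> <-; last first.
    move=> i; rewrite inE /f'; case: eqVneq => [->//|_ /= si]; exact: hs.
  congr (P _); apply/seteqP; split => [w [h1 Bw] i|w h1].
    by rewrite /= inE /f'; case: eqVneq => //= _ si; exact: h1.
  split => [i /= si|].
    have := h1 i; rewrite /= inE si orbT /f' => /(_ isT).
    by case: eqVneq si js => // -> ->.
  by have := h1 j; rewrite /= inE eqxx /f' eqxx => /(_ isT).
have := @g_sigma_algebra_measure_unique _ R T G mG (fun=> setT) (fun=> GT) _ m1 m2 GI m12.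
move=> m12A; have := m12A _ _ _ (sub _ sA); rewrite m2E muleC => <- //.
- by rewrite bigcup_const.
- by move=> _; rewrite /m1/= /mrestr setTI (le_lt_trans (probability_le1 P mB))// ltry.
Qed.

End Past.
End Independence.

(** * Moments of stochastic subgradients *)

Section Moments.
Context (R : realType) (dX : measure_display) (X : measurableType dX).
Context (mu : probability X R) (d : nat).
Implicit Types (s : X -> 'rV[R]_d) (u : 'rV[R]_d).

(* The integral of a nonnegative function is a supremum over the simple functions
   below it. *)
Lemma ge0_le_integral_nomeas (f g : X -> \bar R) :
  (forall x, (0 <= f x)%E) -> (forall x, (f x <= g x)%E) ->
  (\int[mu]_x f x <= \int[mu]_x g x)%E.
Proof.
move=> f0 fg; rewrite !ge0_integralTE//; last by move=> x; rewrite (le_trans (f0 x)).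
apply: ge_ereal_sup => _ [h /= hf <-]; apply: ereal_sup_ubound.
by exists h => // x; rewrite (le_trans (hf x)).
Qed.

Lemma integrable_dotp s u :
  (forall i, mu.-integrable setT (fun w => (s w 0 i)%:E)) ->
  mu.-integrable setT (fun w => (dotp (s w) u)%:E) /\
  (\int[mu]_w (dotp (s w) u)%:E = (dotp (vmean mu s) u)%:E)%E.
Proof.
move=> si.
have E : (fun w => (dotp (s w) u)%:E) =
    (fun w => \sum_(i < d) ((u 0 i)%:E * (s w 0 i)%:E))%E.
  by apply/funext => w; rewrite /dotp -sumEFin; apply: eq_bigr => i _; rewrite mulrC EFinM.
have int i : mu.-integrable setT (fun w => ((u 0 i)%:E * (s w 0 i)%:E)%E).
  exact: integrableZl.
rewrite E; split; first exact: integrable_sum.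
rewrite integral_sum// /dotp -sumEFin; apply: eq_bigr => i _.
rewrite integralZl// !mxE mulrC EFinM; congr (_ * _)%E.
by rewrite fineK//; exact: integrable_fin_num.
Qed.

(** The shape of the one-step estimate once the past is frozen: only the sample is random, u and c
    are constants. *)
Lemma integral_quadratic_le s u (A Q c : R) :
  measurable_fun setT (s : X -> borelV R d) ->
  (forall i, mu.-integrable setT (fun w => (s w 0 i)%:E)) ->
  (\int[mu]_w (enorm (s w) ^+ 2)%:E <= Q%:E)%E -> 0 <= A ->
  (\int[mu]_w (A * enorm (s w) ^+ 2 + dotp (s w) u + c)%:E
    <= (A * Q + dotp (vmean mu s) u + c)%:E)%E.
Proof.
move=> ms si sQ A0; have [du Edu] := integrable_dotp u si.
have i2 : mu.-integrable setT (fun w => (enorm (s w) ^+ 2)%:E).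
  apply/integrableP; split; first by apply/measurable_EFinP; exact: measurable_enorm2.
  under eq_integral do rewrite gee0_abs ?lee_fin ?sqr_ge0//.
  by rewrite (le_lt_trans sQ)// ltry.
have iA : mu.-integrable setT (fun w => (A%:E * (enorm (s w) ^+ 2)%:E)%E).
  exact: integrableZl.
have ic : mu.-integrable setT (cst c%:E) by exact: finite_measure_integrable_cst.
under eq_integral do rewrite !EFinD EFinM.
rewrite integralD//; last exact: integrableD.
rewrite integralD// integralZl// Edu integral_cst//= probability_setT mule1.
rewrite !EFinD EFinM leeD2r// leeD2r// lee_wpmul2l//.
Qed.

(** Both bounds come from expanding |s - m|^2, which is the preceding integrand for u = -2 m and c =
    |m|^2; the first one is the nonnegativity of its integral. *)
Lemma variance_le s (Q : R) :
  measurable_fun setT (s : X -> borelV R d) ->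
  (forall i, mu.-integrable setT (fun w => (s w 0 i)%:E)) ->
  (\int[mu]_w (enorm (s w) ^+ 2)%:E <= Q%:E)%E ->
  enorm (vmean mu s) ^+ 2 <= Q /\
  (\int[mu]_w (enorm (s w - vmean mu s) ^+ 2)%:E <= Q%:E)%E.
Proof.
move=> ms si sQ; set m := vmean mu s.
have := @integral_quadratic_le s ((-2) *: m) 1 Q (enorm m ^+ 2) ms si sQ ler01.
under eq_integral => w _ do rewrite mul1r dotpZr mulNr -enormB2.
rewrite mul1r -/m dotpZr -enorm2E => h; split.
  have : (0%:E <= (Q + -2 * enorm m ^+ 2 + enorm m ^+ 2)%:E)%E.
    by apply: le_trans h; apply: integral_ge0 => w _; rewrite lee_fin sqr_ge0.
  by rewrite lee_fin; lra.
apply: (le_trans h); rewrite lee_fin; have := sqr_ge0 (enorm m); lra.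
Qed.

(** Jensen's inequality for the squared norm, by integrating the affine function [phi] tangent to it
    at the mean. The right-hand side may be infinite, hence the detour through the positive part of
    [phi]. *)
Lemma integral_sqr_shift s u :
  measurable_fun setT (s : X -> borelV R d) ->
  (forall i, mu.-integrable setT (fun w => (s w 0 i)%:E)) ->
  ((enorm (u - vmean mu s) ^+ 2)%:E <= \int[mu]_w (enorm (u - s w) ^+ 2)%:E)%E.
Proof.
move=> ms si; set m := vmean mu s.
pose v := u - m; pose psi w := (enorm (u - s w) ^+ 2)%:E.
pose phi w := ((dotp (s w) ((-2) *: v))%:E + (enorm v ^+ 2 + 2 * dotp m v)%:E)%E.
have [iv Ev] := integrable_dotp ((-2) *: v) si.
have ic : mu.-integrable setT (cst (enorm v ^+ 2 + 2 * dotp m v)%:E).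
  exact: finite_measure_integrable_cst.
have iphi : mu.-integrable setT phi by exact: integrableD.
have -> : ((enorm v ^+ 2)%:E = \int[mu]_w phi w)%E.
  rewrite integralD// Ev integral_cst//= probability_setT mule1 -EFinD -/m dotpZr.
  by congr EFin; lra.
have phi_le w : (phi w <= psi w)%E.
  rewrite /phi -EFinD lee_fin dotpZr (_ : u - s w = v - (s w - m)); last first.
    by rewrite opprB addrA subrK.
  rewrite (enormB2 v) (dotpC v) dotpDl dotpNl; have := sqr_ge0 (enorm (s w - m)); lra.
apply: (@le_trans _ _ (\int[mu]_w phi^\+ w)%E).
  apply: le_integral => //; first exact: integrable_funepos.
  by move=> w _; rewrite funeposE le_max lexx.
apply: ge0_le_integral_nomeas => w; first exact: funepos_ge0.
by rewrite funeposE ge_max phi_le lee_fin sqr_ge0.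
Qed.

End Moments.

(** * Splitting the variance of a difference of independent samples *)

Section ProductNoise.
Context (R : realType) (dX dZ : measure_display).
Context (X : measurableType dX) (Z : measurableType dZ).
Context (mu : probability X R) (nu : probability Z R) (d : nat).
Context (s1 : X -> 'rV[R]_d) (s2 : Z -> 'rV[R]_d).
Hypothesis ms1 : measurable_fun setT (s1 : X -> borelV R d).
Hypothesis ms2 : measurable_fun setT (s2 : Z -> borelV R d).
Hypothesis is1 : forall i, mu.-integrable setT (fun w => (s1 w 0 i)%:E).
Hypothesis is2 : forall i, nu.-integrable setT (fun w => (s2 w 0 i)%:E).

Let noise (p : X * Z) := s1 p.1 - s2 p.2.

Let m1fst : measurable_fun setT ((fun p => s1 p.1) : X * Z -> borelV R d).
Proof. exact: measurableT_comp. Qed.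

Let m2snd : measurable_fun setT ((fun p => s2 p.2) : X * Z -> borelV R d).
Proof. exact: measurableT_comp. Qed.

Lemma vmean_noise : vmean (mu \x nu)%E noise = vmean mu s1 - vmean nu s2.
Proof.
apply/rowP => i; rewrite !mxE.
have m1 : measurable_fun setT (fun p : X * Z => (s1 p.1 0 i)%:E).
  by apply/measurable_EFinP; exact: measurable_coord.
have m2 : measurable_fun setT (fun p : X * Z => (s2 p.2 0 i)%:E).
  by apply/measurable_EFinP; exact: measurable_coord.
have i1 : (mu \x nu)%E.-integrable setT (fun p : X * Z => (s1 p.1 0 i)%:E).
  apply: (@integrable12ltyP _ _ X Z R mu nu _ m1).2 => /=.
  under eq_integral do rewrite integral_cst//= probability_setT mule1.
  by case/integrableP : (is1 i).
have i2 : (mu \x nu)%E.-integrable setT (fun p : X * Z => (s2 p.2 0 i)%:E).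
  apply: (@integrable21ltyP _ _ X Z R mu nu _ m2).2 => /=.
  under eq_integral do rewrite integral_cst//= probability_setT mule1.
  by case/integrableP : (is2 i).
under [X in X = _]eq_Rintegral do rewrite !mxE.
rewrite RintegralB//; congr (_ - _); rewrite /Rintegral; congr fine.
- rewrite -integral12_prod_meas1//; apply: eq_integral => x _.
  by rewrite /fubini_F/= integral_cst//= probability_setT mule1.
- rewrite -integral21_prod_meas1//; apply: eq_integral => x _.
  by rewrite /fubini_G/= integral_cst//= probability_setT mule1.
Qed.

(** Condition (S) bounds only the variance of the difference. Averaging out one of the two samples
    by Jensen's inequality recovers a bound for each of them. *)
Lemma noise_variance :
  (\int[mu]_w (enorm (s1 w - vmean mu s1) ^+ 2)%:E <=
     \int[mu \x nu]_p (enorm (noise p - vmean (mu \x nu) noise) ^+ 2)%:E)%E /\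
  (\int[nu]_w (enorm (s2 w - vmean nu s2) ^+ 2)%:E <=
     \int[mu \x nu]_p (enorm (noise p - vmean (mu \x nu) noise) ^+ 2)%:E)%E.
Proof.
set m := vmean (mu \x nu)%E noise.
have mn : measurable_fun setT (fun p : X * Z => (enorm (noise p - m) ^+ 2)%:E).
  apply/measurable_EFinP; apply: measurable_enorm2; apply: measurable_rowB.
    exact: measurable_rowB.
  exact: measurable_cst.
have n0 (p : X * Z) : (0 <= (enorm (noise p - m) ^+ 2)%:E)%E by rewrite lee_fin sqr_ge0.
split.
- rewrite fubini_tonelli1//; apply: ge0_le_integral_nomeas => w.
    by rewrite lee_fin sqr_ge0.
  have := integral_sqr_shift (s1 w - m) ms2 is2.
  have -> : s1 w - m - vmean nu s2 = s1 w - vmean mu s1.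
    by rewrite /m vmean_noise opprB addrA addrAC addrK.
  move=> /le_trans; apply.
  rewrite /fubini_F/=; apply: ge0_le_integral_nomeas => z; first by rewrite lee_fin sqr_ge0.
  by rewrite /noise/= addrAC.
- rewrite fubini_tonelli2//; apply: ge0_le_integral_nomeas => w.
    by rewrite lee_fin sqr_ge0.
  have := integral_sqr_shift (s2 w + m) ms1 is1.
  have -> : s2 w + m - vmean mu s1 = s2 w - vmean nu s2.
    by rewrite /m vmean_noise addrA addrAC addrK.
  move=> /le_trans; apply.
  rewrite /fubini_G/=; apply: ge0_le_integral_nomeas => z; first by rewrite lee_fin sqr_ge0.
  by rewrite /noise/= enormBC opprD addrA.
Qed.

End ProductNoise.

(** * One step of SPG *)

Section ProxDescent.
Context (R : realType) (d : nat).
Implicit Types (x y z m p u v w : 'rV[R]_d) (E : set 'rV[R]_d).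

(** The part of [spg_objective] other than the regularizer, with k standing for the inverse step
    size. *)
Definition spg_quad (gamma k : R) y1 yt v x : R :=
  dotp x v + gamma / 2 * enorm (x - y1) ^+ 2 + k / 2 * enorm (x - yt) ^+ 2.

(** The quadratic expands exactly around m with curvature gamma + k, and the first-order condition
    disposes of the linear term. *)
Lemma spg_minimizer_first_order E (r : 'rV[R]_d -> R) (gamma k : R) y1 yt v m z :
  convex_on E r -> E m -> E z ->
  (forall x, E x -> r m + spg_quad gamma k y1 yt v m <= r x + spg_quad gamma k y1 yt v x) ->
  r m + spg_quad gamma k y1 yt v m + (gamma + k) / 2 * enorm (m - z) ^+ 2
    <= r z + spg_quad gamma k y1 yt v z.
Proof.
move=> cr Em Ez mmin.
have := @minimizer_first_order _ _ E r (spg_quad gamma k y1 yt v) m z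
  (dotp (z - m) v + gamma * dotp (m - y1) (z - m) + k * dotp (m - yt) (z - m))
  ((gamma + k) / 2 * enorm (z - m) ^+ 2) cr Em Ez.
have quadE t : spg_quad gamma k y1 yt v (m + t *: (z - m)) =
    spg_quad gamma k y1 yt v m +
    t * (dotp (z - m) v + gamma * dotp (m - y1) (z - m) + k * dotp (m - yt) (z - m)) +
    t ^+ 2 * ((gamma + k) / 2 * enorm (z - m) ^+ 2).
  rewrite /spg_quad dotpDl dotpZl ![_ + t *: _ - _]addrAC.
  rewrite (enormD2 (m - y1)) (enormD2 (m - yt)) !dotpZr enormZ exprMn.
  by rewrite real_normK ?num_real//; field.
move=> /(_ (fun t _ => quadE t) mmin) h.
have := quadE 1; rewrite scale1r subrKC (enormBC m z) => ->; lra.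
Qed.

(* Convexity on the two halves of the segment [x, y]. *)
Lemma smooth_descent (g : 'rV[R]_d -> R) (dg : 'rV[R]_d -> 'rV[R]_d) (L : R) x y :
  0 <= L -> (forall a b, g a + dotp (dg a) (b - a) <= g b) ->
  (forall a b, enorm (dg a - dg b) <= L * enorm (a - b)) ->
  g y <= g x + dotp (dg x) (y - x) + 3 / 4 * L * enorm (y - x) ^+ 2.
Proof.
move=> L0 sub lip; pose m := x + (1 / 2) *: (y - x).
have ymE : y - m = (1 / 2) *: (y - x).
  rewrite /m opprD addrA -{1}(scale1r (y - x)) -scalerBl.
  by congr (_ *: _); lra.
have mxE' : m - x = (1 / 2) *: (y - x) by rewrite /m addrAC subrr add0r.
have h1 := sub y m; have h2 := sub m x.
have n0 := enorm_ge0 (y - x).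
(* The half ending at y costs L / 2 and the half ending at m costs L / 4, whence the constant 3 /
   4. *)
have e1 : dotp (dg y - dg x) (y - x) <= L * enorm (y - x) ^+ 2.
  by rewrite (le_trans (dotp_le_enorm _ _))// expr2 mulrA ler_wpM2r.
have e2 : dotp (dg m - dg x) (y - x) <= L / 2 * enorm (y - x) ^+ 2.
  rewrite (le_trans (dotp_le_enorm _ _))// expr2 mulrA ler_wpM2r//.
  rewrite (le_trans (lip _ _))// mxE' enormZ ger0_norm; lra.
move: h1 h2 e1 e2; rewrite -(opprB y m) -(opprB m x) ymE mxE'.
rewrite !dotpDl !dotpNl !dotpNr !dotpZr; lra.
Qed.

(** The subproblem centred at y1, up to the constant h(y1), with q the subgradient of h at y1. *)
Definition prox_model (g r : 'rV[R]_d -> R) (gamma : R) y1 q x : R :=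
  g x + r x - dotp q (x - y1) + gamma / 2 * enorm (x - y1) ^+ 2.

(** Smoothness carries the linearization of g at [yt] to a bound at the new iterate [yn], which is
    why Option 1 averages from y_2 on. Of the available k / 2 |yn - yt|^2, the descent lemma takes
    at most 3 k / 8 and the remaining k / 8 pays for Young's inequality on the noise. *)
Lemma spg_step_smooth E (g r : 'rV[R]_d -> R) (dg : 'rV[R]_d -> 'rV[R]_d)
    (L gamma k : R) y1 yt q n v yn z :
  v = n + (dg yt - q) -> convex_on E r -> 0 <= L -> 2 * L <= k -> 0 < k ->
  (forall a b, g a + dotp (dg a) (b - a) <= g b) ->
  (forall a b, enorm (dg a - dg b) <= L * enorm (a - b)) ->
  E yn -> E z ->
  (forall x, E x -> r yn + spg_quad gamma k y1 yt v yn <= r x + spg_quad gamma k y1 yt v x) ->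
  prox_model g r gamma y1 q yn - prox_model g r gamma y1 q z
  <= 2 / k * enorm n ^+ 2 - dotp n (yt - z) + k / 2 * enorm (yt - z) ^+ 2
     - (gamma + k) / 2 * enorm (yn - z) ^+ 2.
Proof.
move=> vE cr L0 Lk k0 sub lip En Ez ymin.
have h1 := spg_minimizer_first_order cr En Ez ymin.
have h2 := smooth_descent yt yn L0 sub lip.
have h3 := sub yt z.
have k40 : 0 < 4 / k by rewrite divr_gt0.
have h4 := dotp_young (- n) (yn - yt) k40.
have h5 : 0 <= (k - 2 * L) * enorm (yn - yt) ^+ 2 by rewrite mulr_ge0 ?sqr_ge0// subr_ge0.
move: h1 h2 h3 h4 h5; rewrite /spg_quad /prox_model enormN.
have -> : 4 / k / 2 = 2 / k by field; rewrite gt_eqF.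
have -> : (2 * (4 / k))^-1 = k / 8 by field; rewrite gt_eqF.
rewrite (enormBC yt z) vE.
set N := 2 / k * _.
rewrite !dotpE (dotpC yn n) (dotpC yn q) (dotpC z n) (dotpC z q) (dotpC yn (dg yt))
  (dotpC z (dg yt)).
lra.
Qed.

(** Without smoothness the subgradient inequality bounds the gap at the old iterate [yt], so the
    change from [yt] to [yn] has to be paid for. It is Lipschitz: v contributes |v|, r contributes
    G, and the term gamma / 2 |x - y1|^2 contributes 3 G because the region has radius 3 G / gamma.
    This gives |v| + 4 G. *)
Lemma spg_step_nonsmooth E (g r : 'rV[R]_d -> R) (gamma k G : R) y1 yt q n v yn z w :
  v = n + (w - q) ->
  let S := [set x | E x /\ enorm (x - y1) <= 3 * G / gamma] in
  convex_on S r -> 0 < gamma -> 0 < k -> 0 <= G ->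
  (forall x y, E x -> E y -> r x - r y <= G * enorm (x - y)) ->
  (forall b, g yt + dotp w (b - yt) <= g b) ->
  S yt -> S yn -> S z ->
  (forall x, S x -> r yn + spg_quad gamma k y1 yt v yn <= r x + spg_quad gamma k y1 yt v x) ->
  prox_model g r gamma y1 q yt - prox_model g r gamma y1 q z
  <= (2 * k)^-1 * (enorm v + 4 * G) ^+ 2 - dotp n (yt - z) + k / 2 * enorm (yt - z) ^+ 2
     - (gamma + k) / 2 * enorm (yn - z) ^+ 2.
Proof.
move=> vE S cr gamma0 k0 G0 lip sub St Sn Sz ymin.
have h1 := spg_minimizer_first_order cr Sn Sz ymin.
have h2 := sub z.
have h3 := lip _ _ (proj1 St) (proj1 Sn).
have nd := enorm_ge0 (yt - yn).
have h4 : gamma / 2 * (enorm (yt - y1) ^+ 2 - enorm (yn - y1) ^+ 2) <= 3 * G * enorm (yt - yn).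
  have -> : enorm (yt - y1) ^+ 2 - enorm (yn - y1) ^+ 2 =
      dotp (yt - yn) ((yt - y1) + (yn - y1)).
    by rewrite !enorm2E !dotpE (dotpC yn yt) (dotpC yn y1) (dotpC yt y1); lra.
  have : dotp (yt - yn) ((yt - y1) + (yn - y1)) <= enorm (yt - yn) * (6 * G / gamma).
    rewrite (le_trans (dotp_le_enorm _ _))// ler_wpM2l// (le_trans (enormD _ _))//.
    by rewrite (le_trans (lerD (proj2 St) (proj2 Sn)))//; lra.
  rewrite -(ler_pM2l (_ : 0 < gamma / 2)) ?divr_gt0// => /le_trans; apply.
  rewrite le_eqVlt; apply/orP; left; apply/eqP; field; rewrite gt_eqF//.
have h5 : dotp v (yt - yn) <= enorm v * enorm (yt - yn) by exact: dotp_le_enorm.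
have h6 : (enorm v + 4 * G) * enorm (yt - yn) <=
    (2 * k)^-1 * (enorm v + 4 * G) ^+ 2 + k / 2 * enorm (yt - yn) ^+ 2.
  rewrite -subr_ge0 [leRHS](_ : _ =
    (2 * k)^-1 * (enorm v + 4 * G - k * enorm (yt - yn)) ^+ 2); last first.
    by field; rewrite gt_eqF.
  by rewrite mulr_ge0 ?sqr_ge0// invr_ge0 mulr_ge0// ltW.
move: h1 h2 h4 h5 h6; rewrite /spg_quad /prox_model.
rewrite (enormBC yn yt) (enormBC z yt).
have nE : n = v - w + q by apply/rowP => i; rewrite vE !mxE; ring.
rewrite nE !dotpE (dotpC yn v) (dotpC z v).
set K := _^-1 * _.
lra.
Qed.

Lemma weighted_mean_convex E (phi : 'rV[R]_d -> R) (a n : nat) (y : nat -> 'rV[R]_d) :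
  convex_on E phi -> (0 < a < n)%N -> (forall t, (a <= t < n)%N -> E (y t)) ->
  E (weighted_mean a n y) /\
  (\sum_(a <= t < n) t%:R) * phi (weighted_mean a n y)
    <= \sum_(a <= t < n) t%:R * phi (y t).
Proof.
move=> cphi /andP[a0 an]; rewrite -(subnKC an) addSn; move: (n - _)%N => j {n an}.
elim: j => [|j IH] Ey.
  rewrite /weighted_mean addn0 !big_nat1 scalerA mulVf ?scale1r ?pnatr_eq0 -?lt0n//.
  by split => //; apply: Ey; rewrite leqnn ltnS leq_addr.
have [] := IH; first by move=> t /andP[h1 h2]; apply: Ey; rewrite h1 addnS ltnW.
have En : E (y (a + j).+1) by apply: Ey; rewrite addnS ltnSn andbT ltnW// ltnS leq_addr.
have aj : (a <= (a + j).+1)%N by rewrite ltnW// ltnS leq_addr.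
rewrite /weighted_mean addnS; do 3! rewrite (big_nat_recr (a + j).+1)//=.
set s := \sum_(a <= i < _) i%:R; set v := \sum_(a <= i < _) (_ *: _).
set S := \sum_(a <= i < _) (_ * _); set b : R := (a + j).+1%:R.
have s0 : 0 < s.
  rewrite /s big_nat_recl ?leq_addr// ltr_wpDr ?ltr0n// sumr_ge0//.
have b0 : 0 < b by rewrite /b.
clearbody b.
have sb0 : 0 < s + b by rewrite addr_gt0.
move=> Em le1.
have l01 : 0 <= b / (s + b) <= 1.
  by rewrite divr_ge0 ?(ltW b0) ?(ltW sb0)//= ler_pdivrMr// mul1r lerDr ltW.
have mE : (s + b)^-1 *: (v + b *: y (a + j).+1) =
    (b / (s + b)) *: y (a + j).+1 + (1 - b / (s + b)) *: (s^-1 *: v).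
  by apply/rowP => i; rewrite !mxE; field; rewrite !gt_eqF.
have [E2 le2] := cphi _ _ _ l01 En Em.
rewrite mE; split => //.
apply: (le_trans (ler_wpM2l (ltW sb0) le2)).
rewrite [leLHS](_ : _ = s * phi (s^-1 *: v) + b * phi (y (a + j).+1)); last first.
  by field; rewrite gt_eqF.
by rewrite lerD2r.
Qed.

End ProxDescent.

(** * Stability and measurability of proximal minimizers *)

Section ProxMeasurability.
Context (R : realType) (d : nat).
Implicit Types (x y z m p : 'rV[R]_d) (E S : set 'rV[R]_d) (r : 'rV[R]_d -> R).

Definition prox_minimizer S r (s : R) p : set 'rV[R]_d :=
  [set m | S m /\ forall x, S x ->
    r m + s / 2 * enorm (m - p) ^+ 2 <= r x + s / 2 * enorm (x - p) ^+ 2].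

(** Monotonicity of the subdifferential when the two feasible sets differ: m' may be infeasible for
    the first problem and m for the second, so nearby feasible points x and x' are tested instead,
    at a cost of order del. *)
Lemma prox_minimizer_stability S S' r (s G del : R) p p' m m' x x' :
  convex_on S r -> convex_on S' r -> 0 < s ->
  prox_minimizer S r s p m -> prox_minimizer S' r s p' m' ->
  S x -> S' x' -> enorm (x - m') <= del -> enorm (x' - m) <= del ->
  r x - r m' <= G * del -> r x' - r m <= G * del ->
  s * enorm (m - m') ^+ 2 <=
    2 * G * del + s * (enorm (p - p') * enorm (m - m'))
    + s * (del * (enorm (p - m) + enorm (p' - m'))).
Proof.
move=> cS cS' s0 [Sm mmin] [Sm' mmin'] Sx Sx' xm' x'm rx rx'.
have h1 := prox_first_order cS Sm Sx mmin.
have h2 := prox_first_order cS' Sm' Sx' mmin'.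
have h3 := dotp_ge_enorm (p - m) (x - m').
have h4 := dotp_ge_enorm (p' - m') (x' - m).
have h5 := dotp_ge_enorm (p - p') (m' - m).
have h6 : enorm (p - m) * enorm (x - m') <= enorm (p - m) * del.
  by rewrite ler_wpM2l// enorm_ge0.
have h7 : enorm (p' - m') * enorm (x' - m) <= enorm (p' - m') * del.
  by rewrite ler_wpM2l// enorm_ge0.
have eq : dotp (p - m) (x - m) + dotp (p' - m') (x' - m') =
    dotp (p - m) (x - m') + dotp (p' - m') (x' - m) + dotp (p - p') (m' - m)
    + enorm (m - m') ^+ 2.
  by rewrite !enorm2E !dotpE (dotpC m' m); ring.
rewrite (enormBC m' m) in h5.
have : s * (dotp (p - m) (x - m) + dotp (p' - m') (x' - m')) <= 2 * G * del by lra.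
rewrite eq.
have : s * (- (enorm (p - m) * del) - enorm (p' - m') * del
   - enorm (p - p') * enorm (m - m') + enorm (m - m') ^+ 2) <=
   s * (dotp (p - m) (x - m') + dotp (p' - m') (x' - m) +
      dotp (p - p') (m' - m) + enorm (m - m') ^+ 2).
  by rewrite ler_pM2l//; lra.
lra.
Qed.

Lemma prox_minimizer_lipschitz S r (s : R) p p' m m' :
  convex_on S r -> 0 < s ->
  prox_minimizer S r s p m -> prox_minimizer S r s p' m' ->
  enorm (m - m') <= enorm (p - p').
Proof.
move=> cS s0 hm hm'.
have := @prox_minimizer_stability S S r s 0 0 p p' m m' m' m cS cS s0 hm hm'
  (proj1 hm') (proj1 hm).
rewrite !subrr enorm0 mulr0 lexx => /(_ isT isT isT isT).
rewrite mulr0 mul0r mulr0 addr0 add0r ler_pM2l// expr2.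
have := enorm_ge0 (m - m'); rewrite le_eqVlt => /predU1P[<- _|n0].
  exact: enorm_ge0.
by rewrite ler_pM2r.
Qed.

Lemma prox_minimizer_unique S r (s : R) p m m' :
  convex_on S r -> 0 < s ->
  prox_minimizer S r s p m -> prox_minimizer S r s p m' -> m = m'.
Proof.
move=> cS s0 hm hm'; have := prox_minimizer_lipschitz cS s0 hm hm'.
rewrite subrr enorm0 => h; apply/eqP; rewrite -subr_eq0; apply/eqP/enorm_eq0.
by apply/eqP; rewrite eq_le h enorm_ge0.
Qed.

(** By uniqueness m is a function of p alone, 1-Lipschitz on the set where a minimizer exists; off
    that set [xget] returns the default 0. *)
Lemma prox_minimizer_measurable (dT : measure_display) (T : measurableType dT)
    S r (s : R) (p m : T -> 'rV[R]_d) :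
  convex_on S r -> 0 < s -> measurable_fun setT (p : T -> borelV R d) ->
  (forall w, prox_minimizer S r s (p w) (m w)) ->
  measurable_fun setT (m : T -> borelV R d).
Proof.
move=> cS s0 mp hm; pose h p := xget 0 (prox_minimizer S r s p).
have hP p0 : (exists m0, prox_minimizer S r s p0 m0) -> prox_minimizer S r s p0 (h p0).
  by move=> ex; exact: xgetPex.
have -> : m = h \o p.
  apply/funext => w /=; apply: (prox_minimizer_unique cS s0 (hm w)).
  by apply: hP; exists (m w).
apply: (@measurable_comp_continuous _ _ _ _ _ [set p0 | exists m0, prox_minimizer S r s p0 m0]).
- by move=> w; exists (m w).
- move=> p0 /hP h0 e e0; exists e => // p1 /hP h1; apply: le_lt_trans.
  exact: prox_minimizer_lipschitz h1 h0.
- exact: mp.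
Qed.

(** Contract m' towards y by the factor rho / (rho + |y - y'|): the ball around y' is within radius
    rho + |y - y'| of y. *)
Lemma ball_shrink E r (G rho : R) y y' m' :
  0 < rho -> 0 <= G -> convex_on E r ->
  (forall a b, E a -> E b -> r a - r b <= G * enorm (a - b)) ->
  E y -> E m' -> enorm (m' - y') <= rho ->
  exists x, [/\ E x /\ enorm (x - y) <= rho, enorm (x - m') <= enorm (y - y') &
    r x - r m' <= G * enorm (y - y')].
Proof.
move=> rho0 G0 cE lip Ey Em' m'y'; set del := enorm (y - y').
have del0 : 0 <= del by exact: enorm_ge0.
have rd0 : 0 < rho + del by rewrite ltr_wpDr.
have m'y : enorm (m' - y) <= rho + del.
  by rewrite (le_trans (enorm_triangle y' _ _))// lerD// enormBC.
pose l := rho / (rho + del).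
have l01 : 0 <= l <= 1.
  by rewrite divr_ge0 ?(ltW rho0) ?(ltW rd0)//= ler_pdivrMr// mul1r lerDl.
have [Ex _] := cE m' y l l01 Em' Ey.
have xm' : enorm (l *: m' + (1 - l) *: y - m') <= del.
  have -> : l *: m' + (1 - l) *: y - m' = (1 - l) *: (y - m').
    by apply/rowP => i; rewrite !mxE; ring.
  rewrite enormZ ger0_norm ?subr_ge0; last by case/andP: l01.
  rewrite enormBC.
  have -> : del = (1 - l) * (rho + del) by rewrite /l; field; rewrite gt_eqF.
  by rewrite ler_wpM2l// subr_ge0; case/andP: l01.
exists (l *: m' + (1 - l) *: y); split => //; last first.
  by rewrite (le_trans (lip _ _ Ex Em'))// ler_wpM2l.
split => //; rewrite convex_comb addrAC subrr add0r enormZ ger0_norm; last by case/andP: l01.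
have -> : rho = l * (rho + del) by rewrite mulfVK// gt_eqF.
by rewrite ler_wpM2l//; case/andP: l01.
Qed.

Definition prox_region E y (rho : R) : set 'rV[R]_d := [set x | E x /\ enorm (x - y) <= rho].

Lemma convex_on_region E r y rho : convex_on E r -> convex_on (prox_region E y rho) r.
Proof.
move=> cE a b t t01 [Ea ay] [Eb yb]; have [Et rt] := cE _ _ _ t01 Ea Eb.
split => //; split => //.
have -> : t *: a + (1 - t) *: b - y = t *: (a - y) + (1 - t) *: (b - y).
  by apply/rowP => i; rewrite !mxE; ring.
rewrite (le_trans (enormD _ _))// !enormZ; case/andP: t01 => t0 t1.
rewrite !ger0_norm ?subr_ge0//.
have := ler_wpM2l t0 ay; have t1' : 0 <= 1 - t by rewrite subr_ge0.
have := ler_wpM2l t1' yb; lra.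
Qed.

(** The factor of del involves only the unprimed data, which makes this a continuity estimate at (y,
    p). *)
Lemma region_minimizer_stability E r (s G rho del : R) y y' p p' m m' :
  0 < rho -> 0 <= G -> 0 < s -> convex_on E r ->
  (forall a b, E a -> E b -> r a - r b <= G * enorm (a - b)) ->
  E y -> E y' -> del <= 1 -> enorm (y - y') <= del -> enorm (p - p') <= del ->
  prox_minimizer (prox_region E y rho) r s p m ->
  prox_minimizer (prox_region E y' rho) r s p' m' ->
  enorm (m - m') ^+ 2 <= del * (2 * G / s + 2 * (2 * rho + 1) + 1 + 2 * enorm (p - m)).
Proof.
move=> rho0 G0 s0 cE lip Ey Ey' del1 yy pp hm hm'.
have [x [Sx xm rx]] := ball_shrink rho0 G0 cE lip Ey (proj1 (proj1 hm')) (proj2 (proj1 hm')).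
have [x' [Sx' x'm rx']] := ball_shrink rho0 G0 cE lip Ey' (proj1 (proj1 hm)) (proj2 (proj1 hm)).
rewrite (enormBC y') in x'm rx'.
have st := prox_minimizer_stability (convex_on_region cE) (convex_on_region cE) s0
  hm hm' Sx Sx' xm x'm rx rx'.
have Dm_le : enorm (m - m') <= 2 * rho + 1.
  have := proj2 (proj1 hm); have := proj2 (proj1 hm').
  have := enorm_triangle y m m'; have := enorm_triangle y' y m'.
  by rewrite (enormBC y' m'); lra.
have p'h : enorm (p' - m') <= 1 + enorm (p - m) + (2 * rho + 1).
  have := enorm_triangle p p' m'; have := enorm_triangle m p m'.
  by rewrite (enormBC p' p); lra.
have M0 := enorm_ge0 (p - m); have M'0 := enorm_ge0 (p' - m').
have yy0 := enorm_ge0 (y - y'); have pp0 := enorm_ge0 (p - p').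
have Dm0 := enorm_ge0 (m - m').
have s1 : 2 * G * enorm (y - y') <= 2 * G * del by rewrite ler_wpM2l// mulr_ge0.
have s2 : enorm (p - p') * enorm (m - m') <= del * (2 * rho + 1) by rewrite ler_pM.
have s3 : enorm (y - y') * (enorm (p - m) + enorm (p' - m')) <=
    del * (enorm (p - m) + (1 + enorm (p - m) + (2 * rho + 1))).
  by rewrite ler_pM ?addr_ge0// lerD2l.
rewrite -(ler_pM2l s0); apply: (le_trans st).
rewrite [leRHS](_ : _ = 2 * G * del + s * (del * (2 * rho + 1)) +
    s * (del * (enorm (p - m) + (1 + enorm (p - m) + (2 * rho + 1))))).
  by rewrite lerD// ?lerD// ler_wpM2l// ltW.
by field; rewrite gt_eqF.
Qed.

Lemma enorm_submx (z : 'rV[R]_(d + d)) :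
  enorm (lsubmx z) <= enorm z /\ enorm (rsubmx z) <= enorm z.
Proof.
have E : dotp z z = dotp (lsubmx z) (lsubmx z) + dotp (rsubmx z) (rsubmx z).
  by rewrite {1}/dotp big_split_ord/=; congr (_ + _); apply: eq_bigr => i _; rewrite !mxE.
by split; apply: ler_wsqrtr; rewrite E ?lerDl ?lerDr dotp_ge0.
Qed.

(* The feasible region moves with the centre, so the minimizer is only
   continuous (not Lipschitz) in the pair (centre, prox point). *)
Lemma region_minimizer_measurable (dT : measure_display) (T : measurableType dT)
    E r (s G rho : R) (y p m : T -> 'rV[R]_d) :
  0 < rho -> 0 <= G -> 0 < s -> convex_on E r ->
  (forall a b, E a -> E b -> r a - r b <= G * enorm (a - b)) ->
  measurable_fun setT (y : T -> borelV R d) ->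
  measurable_fun setT (p : T -> borelV R d) ->
  (forall w, E (y w)) ->
  (forall w, prox_minimizer (prox_region E (y w) rho) r s (p w) (m w)) ->
  measurable_fun setT (m : T -> borelV R d).
Proof.
move=> rho0 G0 s0 cE lip my mp Ey hm.
pose mini (z : 'rV[R]_(d + d)) :=
  prox_minimizer (prox_region E (lsubmx z) rho) r s (rsubmx z).
have [h hP] : exists h : 'rV[R]_(d + d) -> 'rV[R]_d,
    forall z : 'rV[R]_(d + d), (exists m0, mini z m0) -> mini z (h z).
  by exists (fun z : 'rV[R]_(d + d) => xget 0 (mini z)) => z ex; exact: xgetPex.
(* The pair of centre and prox point is coded as one row, so that the criterion for functions of a
   single vector applies. *)
pose f w : 'rV[R]_(d + d) := row_mx (y w) (p w).
have fm w : mini (f w) (m w) by rewrite /mini row_mxKl row_mxKr; exact: hm.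
have -> : m = h \o f.
  apply/funext => w /=; apply: (prox_minimizer_unique (convex_on_region cE) s0 (fm w)).
  by apply: hP; exists (m w).
apply: (@measurable_comp_continuous _ _ _ _ _
  [set z : 'rV[R]_(d + d) | E (lsubmx z) /\ exists m0, mini z m0]).
- by move=> w; split; [rewrite row_mxKl; exact: Ey|exists (m w)].
- move=> z [Ez /hP hz] e e0.
  pose K := 2 * G / s + 2 * (2 * rho + 1) + 1 + 2 * enorm (rsubmx z - h z).
  have M0 := enorm_ge0 (rsubmx z - h z).
  have Gs0 : 0 <= 2 * G / s by rewrite divr_ge0 ?(ltW s0)// mulr_ge0.
  have K0 : 0 < K by rewrite /K; lra.
  pose del := Num.min 1 (e ^+ 2 / (K + 1)).
  have del0 : 0 < del by rewrite lt_min ltr01 divr_gt0 ?exprn_gt0// addr_gt0.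
  have del1 : del <= 1 by rewrite ge_min lexx.
  have delK : del * K < e ^+ 2.
    have : del <= e ^+ 2 / (K + 1) by rewrite ge_min lexx orbT.
    rewrite ler_pdivlMr; last lra.
    by rewrite mulrDr mulr1; lra.
  exists del => // z' [Ez' /hP hz'] /ltW zz'; have [l1 l2] := enorm_submx (z' - z).
  rewrite enormBC -ltr_sqr ?nnegrE ?enorm_ge0 ?(ltW e0)//.
  apply: le_lt_trans delK.
  by apply: (region_minimizer_stability rho0 G0 s0 cE lip Ez Ez' del1 _ _ hz hz');
    rewrite enormBC -linearB/= (le_trans _ zz').
- apply: measurable_row => i; rewrite /f.
  under eq_fun do rewrite mxE.
  by case: (fintype.split i) => j; exact: measurable_coord.
Qed.

(** Completing the square: an SPG step is a proximal step of r at p, so the measurability results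
    above cover it. *)
Lemma spg_quad_prox (gamma k : R) (y1 yt v x x' : 'rV[R]_d) : 0 < gamma + k ->
  let p := (gamma + k)^-1 *: (gamma *: y1 + k *: yt - v) in
  spg_quad gamma k y1 yt v x - spg_quad gamma k y1 yt v x' =
  (gamma + k) / 2 * enorm (x - p) ^+ 2 - (gamma + k) / 2 * enorm (x' - p) ^+ 2.
Proof.
move=> s0 p; rewrite /spg_quad !(enormB2 x) !(enormB2 x').
have pE u : (gamma + k) * dotp u p = gamma * dotp u y1 + k * dotp u yt - dotp u v.
  by rewrite /p !dotpE mulVKf// gt_eqF.
have := pE x; have := pE x'; lra.
Qed.

End ProxMeasurability.

(** * The proximal subproblem *)

Section DcFacts.
Context (R : realType) (d : nat) (dX dZ : measure_display).
Context (X : measurableType dX) (Z : measurableType dZ) (D : dc_data R d X Z).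
Hypothesis hD : is_dc_problem D.
Implicit Types (x y z m u v w : 'rV[R]_d).

(** [fine] sends +oo to 0, so this represents the regularizer only on its domain. *)
Definition rfun x : R := fine (reg D x).
Local Notation g := (gfun D).
Local Notation h := (hfun D).
Local Notation r := rfun.
Local Notation E := (edom (reg D)).

Lemma convex_function_on (f : 'rV[R]_d -> R) :
  convex_function setT (f : convex_lmodType 'rV[R]_d -> R^o) -> convex_on setT f.
Proof.
move=> cf x y t /andP[t0 t1] _ _; split => //.
by have := cf (Itv01 t0 t1) x y; rewrite !in_setT => /(_ isT isT).
Qed.

Lemma gfun_convex : convex_on setT g. Proof. exact/convex_function_on/(g_convex hD). Qed.

Lemma reg_gtNy x : (-oo < reg D x)%E. Proof. by case: (reg_proper hD). Qed.

Lemma reg_fin x : E x -> reg D x = (r x)%:E.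
Proof. by move=> Ex; rewrite fineK// fin_numE -ltNye -ltey reg_gtNy. Qed.

Lemma reg_infty x : ~ E x -> reg D x = +oo%E.
Proof. by move=> /negP; rewrite -leNgt leye_eq => /eqP. Qed.

Lemma rfun_convex : convex_on E r.
Proof. exact: (econvex_fine (reg_convex hD) reg_gtNy). Qed.

Lemma gr_convex : convex_on E (fun x => g x + r x).
Proof.
move=> x y t t01 Ex Ey; have [Et rt] := rfun_convex t01 Ex Ey; split => //.
have [_ gt] := @gfun_convex x y t t01 I I; lra.
Qed.

Lemma dg_subgradient x y : g x + dotp (dg D x) (y - x) <= g y.
Proof. by have := sg_unbiased hD x y; rewrite /= -EFinD lee_fin. Qed.

Lemma dh_subgradient x y : h x + dotp (dh D x) (y - x) <= h y.
Proof. by have := sh_unbiased hD x y; rewrite /= -EFinD lee_fin. Qed.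

Lemma argmin_finite S J (j : 'rV[R]_d -> R) m :
  (forall x, E x -> J x = (j x)%:E) -> (forall x, ~ E x -> J x = +oo%E) ->
  (exists x, S x /\ E x) -> argmin S J m <->
  [/\ S m, E m & forall x, S x -> E x -> j m <= j x].
Proof.
move=> JE JnE [x0 [Sx0 Ex0]]; split=> [[Sm mmin]|[Sm Em mmin]].
  have Em : E m.
    by apply: contrapT => /JnE Jm; have := mmin _ Sx0; rewrite Jm JE// leye_eq.
  by split => // x Sx Ex; have := mmin _ Sx; rewrite !JE// lee_fin.
split => // x Sx; have [Ex|nEx] := pselect (E x).
  by rewrite !JE// lee_fin mmin.
by rewrite [leRHS]JnE// leey.
Qed.

Definition Ffun x : R := g x + r x - h x.

Lemma objective_fin x : E x -> objective D x = (Ffun x)%:E.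
Proof. by move=> Ex; rewrite /objective reg_fin. Qed.

Definition prox_val (gamma : R) z x : R := prox_model g r gamma z (dh D z) x.

Lemma subproblem_argmin (gamma : R) z m :
  argmin setT (subproblem D gamma z) m <->
  E m /\ forall x, E x -> prox_val gamma z m <= prox_val gamma z x.
Proof.
have [[x0 Ex0] _] := reg_proper hD.
rewrite (@argmin_finite setT _ (fun x => prox_val gamma z x - h z)).
- split=> [[_ Em mmin]|[Em mmin]]; split => // x; first by move=> Ex; have := mmin x I Ex; lra.
  by move=> _ Ex; have := mmin x Ex; lra.
- by move=> x Ex; rewrite /subproblem reg_fin//= /prox_val /prox_model; congr EFin; lra.
- by move=> x Ex; rewrite /subproblem reg_infty.
- by exists x0.
Qed.

Lemma spg_argmin opt (G gamma eta : R) y1 yt v m : E y1 -> 0 <= 3 * G / gamma ->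
  argmin (spg_region D opt G gamma y1) (spg_objective D gamma eta y1 yt v) m ->
  [/\ spg_region D opt G gamma y1 m, E m & forall x, spg_region D opt G gamma y1 x -> E x ->
    r m + spg_quad gamma eta^-1 y1 yt v m <= r x + spg_quad gamma eta^-1 y1 yt v x].
Proof.
move=> Ey1 G0; apply: (@argmin_finite _ _
   (fun x => r x + spg_quad gamma eta^-1 y1 yt v x) m _ _ _).1.
- move=> x Ex; rewrite /spg_objective reg_fin// -!EFinD /spg_quad; congr EFin.
  by rewrite div1r invfM; lra.
- by move=> x Ex; rewrite /spg_objective reg_infty.
- by exists y1; case: (opt) => //=; rewrite subrr enorm0.
Qed.

(** Completing the square turns the linearized subproblem into the proximal problem of g + r at z +
    dh(z) / gamma. *)
Lemma prox_val_prox (gamma : R) z x y : 0 < gamma ->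
  prox_val gamma z x - prox_val gamma z y =
  g x + r x + gamma / 2 * enorm (x - (z + gamma^-1 *: dh D z)) ^+ 2 -
  (g y + r y + gamma / 2 * enorm (y - (z + gamma^-1 *: dh D z)) ^+ 2).
Proof.
move=> g0; have E1 u : gamma / 2 * enorm (u - (z + gamma^-1 *: dh D z)) ^+ 2 =
    gamma / 2 * enorm (u - z) ^+ 2 - dotp (dh D z) (u - z)
    + (2 * gamma)^-1 * enorm (dh D z) ^+ 2.
  rewrite opprD addrA (enormB2 (u - z)) dotpZr enormZ exprMn real_normK ?num_real// (dotpC (u - z)).
  by field; rewrite gt_eqF.
by rewrite !E1 /prox_val /prox_model; lra.
Qed.

(** Existence of a minimizer guarantees that [prox_pt] is a true minimizer and not merely the
    default value of [xget]. *)
Lemma prox_pt_minimizer (gamma : R) z : 0 < gamma ->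
  prox_minimizer E (fun x => g x + r x) gamma (z + gamma^-1 *: dh D z) (prox_pt D gamma z).
Proof.
move=> g0; pose f x := ((g x)%:E + reg D x)%E.
have domf : edom f = E.
  apply/seteqP; split => x; rewrite /edom/= /f; case: (reg D x) => //= *; exact: ltry.
have lf : lower_semicontinuous f.
  move=> x a; rewrite /f => ax.
  (* The level a is split between g and the regularizer, half of the slack going to each when the
     regularizer is finite. *)
  have [c [cg cr]] : exists c : R, (c%:E < (g x)%:E)%E /\ ((a - c)%:E < reg D x)%E.
    have [Ex|/reg_infty ->] := pselect (E x); last first.
      by exists (g x - 1); rewrite lte_fin ltrBlDr ltrDl ltr01 ltry.
    move: ax; rewrite reg_fin// -EFinD lte_fin => ax.
    exists (g x - (g x + r x - a) / 2); rewrite !lte_fin; lra.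
  have [V nV gV] := g_lsc hD cg; have [W nW rW] := reg_lsc hD cr.
  exists (V `&` W); first exact: filterI.
  move=> y [/gV /= gy /rW ry]; have [Ey|/reg_infty ->] := pselect (E y); last by rewrite ltry.
  move: gy ry; rewrite reg_fin// -EFinD !lte_fin; lra.
have cf : econvex f.
  move=> x y t t01; have [_ gt] := @gfun_convex x y t t01 I I.
  have rt := reg_convex hD x y t01.
  by rewrite /f !muleDr ?fin_num_adde_defr// addeACA leeD//.
have pf : eproper f.
  split; first by rewrite domf; case: (reg_proper hD).
  by move=> x; rewrite /f; case: (reg D x) (reg_gtNy x) => // a _; exact: ltNyr.
have [m fm mmin] := prox_exists (z + gamma^-1 *: dh D z) g0 lf cf pf.
have : argmin setT (subproblem D gamma z) (prox_pt D gamma z).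
  apply: xgetPex; exists m; apply/subproblem_argmin; rewrite -domf; split => // x fx.
  have := mmin x fx; have Em : E m by rewrite -domf. have Ex : E x by rewrite -domf.
  rewrite /f !reg_fin// -!EFinD /= => le1.
  by have := prox_val_prox z m x g0; lra.
move/subproblem_argmin => [Em pmin]; split => // x Ex.
by have := pmin x Ex; have := prox_val_prox z (prox_pt D gamma z) x g0; lra.
Qed.

Lemma prox_pt_dom (gamma : R) z : 0 < gamma -> E (prox_pt D gamma z).
Proof. by move=> /(prox_pt_minimizer z)[]. Qed.

Lemma prox_pt_strong (gamma : R) z x : 0 < gamma -> E x ->
  prox_val gamma z (prox_pt D gamma z) + gamma / 2 * enorm (x - prox_pt D gamma z) ^+ 2
  <= prox_val gamma z x.
Proof.
move=> g0 Ex; have [Em mmin] := prox_pt_minimizer z g0.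
have := prox_three_point gr_convex Em Ex mmin.
by have := prox_val_prox z (prox_pt D gamma z) x g0; lra.
Qed.

Lemma prox_pt_subgradient (gamma : R) z y : 0 < gamma -> E y ->
  g (prox_pt D gamma z) + r (prox_pt D gamma z)
    + dotp (gamma *: (z - prox_pt D gamma z) + dh D z) (y - prox_pt D gamma z)
  <= g y + r y.
Proof.
move=> g0 Ey; set m := prox_pt D gamma z; have [Em mmin] := prox_pt_minimizer z g0.
have := prox_first_order gr_convex Em Ey mmin.
rewrite -dotpZl -/m [gamma *: _](_ : _ = gamma *: (z - m) + dh D z)//.
by rewrite addrAC scalerDr scalerA mulfV ?scale1r// gt_eqF.
Qed.

Lemma Ffun_prox_val (gamma : R) z x :
  Ffun x + gamma / 2 * enorm (x - z) ^+ 2 <= prox_val gamma z x - h z.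
Proof. by have := dh_subgradient z x; rewrite /Ffun /prox_val /prox_model; lra. Qed.

Lemma Ffun_prox_val_center (gamma : R) z : prox_val gamma z z - h z = Ffun z.
Proof.
by rewrite /Ffun /prox_val /prox_model subrr dotp0r enorm0 expr0n/= mulr0; lra.
Qed.

(** The subproblem majorizes F and touches it at z; strong convexity around the proximal point
    supplies the squared distance. *)
Lemma stage_decrease (gamma : R) z x : 0 < gamma -> E z ->
  Ffun x - Ffun z + gamma / 2 * enorm (z - prox_pt D gamma z) ^+ 2
  <= prox_val gamma z x - prox_val gamma z (prox_pt D gamma z).
Proof.
move=> g0 Ez; have := prox_pt_strong z g0 Ez; have := Ffun_prox_val gamma z x.
have := Ffun_prox_val_center gamma z.
have : 0 <= gamma / 2 * enorm (x - z) ^+ 2 by rewrite mulr_ge0 ?sqr_ge0// divr_ge0// ltW.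
lra.
Qed.

(** Turns a finite expected gap into a finite second moment of the distance. *)
Lemma prox_dist_le_gap (gamma : R) z : 0 < gamma -> E z ->
  gamma / 2 * enorm (z - prox_pt D gamma z) ^+ 2 <= Ffun z - Ffun (prox_pt D gamma z).
Proof. by move=> g0 Ez; have := stage_decrease (prox_pt D gamma z) g0 Ez; lra. Qed.

Lemma prox_val_convex (gamma : R) z : 0 <= gamma -> convex_on E (prox_val gamma z).
Proof.
move=> g0 x y t t01 Ex Ey; have [Et grt] := gr_convex t01 Ex Ey; split => //.
rewrite /prox_val /prox_model.
have -> : t *: x + (1 - t) *: y - z = t *: (x - z) + (1 - t) *: (y - z).
  by apply/rowP => i; rewrite !mxE; ring.
rewrite enorm2_conv (dotpDr _ (t *: _)) !dotpZr.
have : 0 <= gamma / 2 * (t * (1 - t) * enorm (x - z - (y - z)) ^+ 2).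
  case/andP: t01 => t0 t1; apply: mulr_ge0; first by rewrite divr_ge0.
  by apply: mulr_ge0; [apply: mulr_ge0 => //; rewrite subr_ge0|exact: sqr_ge0].
lra.
Qed.

Section Nonsmooth.
Context (G : R).
Hypothesis G0 : 0 <= G.
Hypothesis hr : convex_indicator (reg D) \/
  forall x, E x -> exists2 v, subdiff (reg D) x v & enorm v <= G.

Lemma rfun_lipschitz x y : E x -> E y -> r x - r y <= G * enorm (x - y).
Proof.
move=> Ex Ey; case: hr => [[S [_ _ rS]]|/(_ _ Ex)[v vx vG]].
  have rE z : E z -> r z = 0 by rewrite /rfun /edom/= rS; case: ifP => //; rewrite ltxx.
  by rewrite !rE// subrr mulr_ge0// enorm_ge0.
have := vx y; rewrite !reg_fin// -EFinD lee_fin.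
have := dotp_le_enorm v (x - y); rewrite -(opprB x y) dotpNr.
have := ler_wpM2r (enorm_ge0 (x - y)) vG; lra.
Qed.

(** Shows that the proximal point belongs to the region of Option 2. Strong convexity gives gamma
    d^2 <= 3 G d for d = |m - z|, with one G for each of g, r and h. *)
Lemma prox_pt_near (gamma : R) z : 0 < gamma -> E z ->
  enorm (dg D z) <= G -> enorm (dh D z) <= G ->
  enorm (prox_pt D gamma z - z) <= 3 * G / gamma.
Proof.
move=> g0 Ez dgG dhG; have Em := prox_pt_dom z g0.
have h1 := prox_pt_strong z g0 Ez.
set m := prox_pt D gamma z in Em h1 *.
have h2 := dg_subgradient z m.
have h3 := rfun_lipschitz Ez Em.
have h4 := dotp_ge_enorm (dg D z) (m - z).
have h5 := dotp_le_enorm (dh D z) (m - z).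
have n0 := enorm_ge0 (m - z).
have h6 := ler_wpM2r n0 dgG; have h7 := ler_wpM2r n0 dhG.
have h8 : gamma * enorm (m - z) ^+ 2 <= 3 * G * enorm (m - z).
  move: h1; rewrite /prox_val /prox_model subrr dotp0r enorm0 expr0n/= (enormBC z m).
  by rewrite (enormBC z m) in h3; lra.
rewrite ler_pdivlMr//; move: n0; rewrite le_eqVlt => /predU1P[<-|n0].
  by rewrite mul0r mulr_ge0.
by rewrite -(ler_pM2r n0); lra.
Qed.

End Nonsmooth.

(** * Criticality measures in terms of the distance to the proximal point *)

Section Criticality.
Context (L nu gamma : R) (z : 'rV[R]_d).
Hypothesis g0 : 0 < gamma.
Local Notation m := (prox_pt D gamma z).
Local Open Scope ereal_scope.

Lemma critical_smooth_gr :
  (forall x, reg D x \is a fin_num) -> holder_gradient (fun x => g x + fine (reg D x))%R L nu ->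
  setdist (subdiff (EFin \o h) z) [set grad g z + grad (fine \o reg D) z]%R
  <= (L * enorm (z - m) `^ nu + gamma * enorm (z - m))%:E.
Proof.
move=> rfin [dgr hol].
have ET x : E x by move: (rfin x); rewrite fin_numElt => /andP[].
have cr : convex_on setT (fine \o reg D).
  by move=> x y t t01 _ _; have [_ ?] := rfun_convex t01 (ET x) (ET y).
have wm : (grad (fun x => g x + fine (reg D x)) m = gamma *: (z - m) + dh D z)%R.
  by apply: subgradient_grad; [exact: dgr|move=> y; exact: prox_pt_subgradient].
(* A subgradient of g + r at z, from which the gradient of the sum is split into those of g and
   r. *)
have [w hw] : exists w, forall y, (g z + r z + dotp w (y - z) <= g y + r y)%R.
  have [||w hw] := @convex_linear_minorant _ _ (fun x => g (z + x) + r (z + x) - (g z + r z))%R.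
  - move=> x y t t01 _ _; split => //.
    have [_] := @gr_convex (z + x)%R (z + y)%R t t01 (ET _) (ET _).
    have -> : (t *: (z + x) + (1 - t) *: (z + y) = z + (t *: x + (1 - t) *: y))%R.
      by apply/rowP => i; rewrite !mxE; ring.
    by lra.
  - by rewrite addr0 subrr.
  - by exists w => y; have := hw (y - z)%R; rewrite subrKC; lra.
apply: (@le_trans _ _ (enorm (dh D z - (grad g z + grad (fine \o reg D) z)%R))%:E).
  apply: ereal_inf_lbound; exists (dh D z, (grad g z + grad (fine \o reg D) z)%R) => //.
  by split => //=; exact: (sh_unbiased hD).
rewrite lee_fin -(grad_convex_sum gfun_convex cr (dgr z) (ex_intro _ w hw)).
have -> : (dh D z = grad (fun x => g x + fine (reg D x)) m - gamma *: (z - m))%R.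
  by rewrite wm addrC addKr.
rewrite addrAC (le_trans (enormB _ _))// enormZ gtr0_norm// lerD2r.
by rewrite (enormBC z m) hol.
Qed.

Lemma critical_smooth_h : holder_gradient h L nu ->
  setdist [set grad h m] (mink_sum (subdiff (EFin \o g) m) (subdiff (reg D) m))
  <= (L * enorm (z - m) `^ nu + gamma * enorm (z - m))%:E.
Proof.
move=> [dh' hol].
(* The sum rule splits the optimality condition at m into a subgradient of g and one of r. *)
have [u [v [wE hu hv]]] := subgradient_sum gfun_convex rfun_convex (prox_pt_dom z g0)
  (fun y => @prox_pt_subgradient gamma z y g0).
have gz : grad h z = dh D z by apply: subgradient_grad => // y; exact: dh_subgradient.
apply: (@le_trans _ _ (enorm (grad h m - (gamma *: (z - m) + dh D z))%R)%:E).
  apply: ereal_inf_lbound; exists (grad h m, (gamma *: (z - m) + dh D z)%R) => //.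
  split => //=; exists (u, v); last by rewrite /= wE.
  split => y /=; first by rewrite -EFinD lee_fin.
  have [Ey|/reg_infty ->] := pselect (E y); last by rewrite leey.
  by rewrite (reg_fin Ey) (reg_fin (prox_pt_dom z g0)) -EFinD lee_fin hv.
rewrite lee_fin -gz opprD addrCA addrC (le_trans (enormD _ _))//.
by rewrite enormN enormZ gtr0_norm// lerD2r (enormBC z m) hol.
Qed.

End Criticality.

End DcFacts.

(** * Runs of the algorithm *)

Section SampleStep.
Context (R : realType) (dT : measure_display) (T : measurableType dT).
Context (P : probability T R) (d : nat).

Lemma measurable_g_sigma_sub (G1 G2 : set (set T)) (dU : measure_display)
    (U : measurableType dU) (f : T -> U) :
  G1 `<=` <<s G2 >> -> measurable_fun [set: g_sigma_algebraType G1] f ->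
  measurable_fun [set: g_sigma_algebraType G2] f.
Proof.
move=> G12 mf _ B mB; have := mf measurableT B mB; rewrite setTI.
by apply: smallest_sub => //; exact: smallest_sigma_algebra.
Qed.

Lemma measurable_g_sigmaW (G : set (set T)) (dU : measure_display)
    (U : measurableType dU) (f : T -> U) :
  G `<=` measurable -> measurable_fun [set: g_sigma_algebraType G] f -> measurable_fun setT f.
Proof.
move=> mG mf _ B mB; have := mf measurableT B mB; rewrite setTI.
by apply: smallest_sub => //; exact: sigma_algebra_measurable.
Qed.

(** Averaging one fresh sample: the noise is centred, so the linear term disappears and the square
    becomes A Q. The lower bound on c makes the integrand nonnegative by Young's inequality, so
    Tonelli applies even if the integrals are infinite. *)
Lemma one_sample_step dX (X : measurableType dX) (nu : probability X R)
    (G : set (set T)) (S : T -> X) (c : T -> R) (y u : T -> 'rV[R]_d)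
    (n : 'rV[R]_d -> X -> 'rV[R]_d) (A Q : R) :
  G `<=` measurable -> measurable_fun setT S ->
  (forall B C, <<s G >> B -> measurable C -> P (B `&` S @^-1` C) = P B * nu C)%E ->
  measurable_fun [set: g_sigma_algebraType G] c ->
  measurable_fun [set: g_sigma_algebraType G] (y : _ -> borelV R d) ->
  measurable_fun [set: g_sigma_algebraType G] (u : _ -> borelV R d) ->
  measurable_fun setT ((fun p => n p.1 p.2) : borelV R d * X -> borelV R d) ->
  (forall w i, nu.-integrable setT (fun x => (n (y w) x 0 i)%:E)) ->
  (forall w, vmean nu (n (y w)) = 0) ->
  (forall w, (\int[nu]_x (enorm (n (y w) x) ^+ 2)%:E <= Q%:E)%E) ->
  0 < A -> (forall w, (4 * A)^-1 * enorm (u w) ^+ 2 <= c w) ->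
  (\int[P]_w (A * enorm (n (y w) (S w)) ^+ 2 + dotp (n (y w) (S w)) (u w) + c w)%:E
    <= \int[P]_w (A * Q + c w)%:E)%E.
Proof.
move=> mG mS indep mc my mu mn ni n0 nQ A0 cu.
have pos v w : 0 <= A * enorm v ^+ 2 + dotp v (u w) + c w.
  have A20 : 0 < 2 * A by rewrite mulr_gt0.
  have := dotp_young (- v) (u w) A20; rewrite dotpNl enormN.
  have -> : 2 * A / 2 = A by field.
  have -> : (2 * (2 * A))^-1 = (4 * A)^-1 by congr (_^-1); ring.
  by have := cu w; lra.
pose H (p : g_sigma_algebraType G * X) : \bar R :=
  (A * enorm (n (y p.1) p.2) ^+ 2 + dotp (n (y p.1) p.2) (u p.1) + c p.1)%:E.
have mny : measurable_fun setT
    ((fun p => n (y p.1) p.2) : g_sigma_algebraType G * X -> borelV R d).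
  have mp : measurable_fun setT
      ((fun p => (y p.1, p.2)) : g_sigma_algebraType G * X -> borelV R d * X).
    apply/measurable_fun_pairP; split; last exact: measurable_snd.
    exact: (measurableT_comp my measurable_fst).
  exact: (measurableT_comp mn mp).
have mH : measurable_fun setT H.
  apply/measurable_EFinP; apply: measurable_funD; last exact: (measurableT_comp mc measurable_fst).
  apply: measurable_funD.
    by apply: measurable_funM; [exact: measurable_cst|exact: measurable_enorm2].
  by apply: measurable_dotp => //; exact: (measurableT_comp mu measurable_fst).
have := integral_independent mG mS indep mH _.
rewrite /H /= => ->; last by move=> p; rewrite lee_fin pos.
apply: ge0_le_integral_nomeas => w.
  by apply: integral_ge0 => x _; rewrite lee_fin pos.
have mnw : measurable_fun setT (n (y w) : X -> borelV R d).
  exact: (@measurable_fun_pair2 _ _ _ (borelV R d) X (borelV R d) _ (y w) mn).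
have := integral_quadratic_le (u w) (c w) mnw (ni w) (nQ w) (ltW A0).
by rewrite n0 dotp0l addr0.
Qed.

End SampleStep.

Lemma centered_vmean (R : realType) (dX : measure_display) (X : measurableType dX)
    (mu : probability X R) (d : nat) (s : X -> 'rV[R]_d) :
  (forall i, mu.-integrable setT (fun w => (s w 0 i)%:E)) ->
  (forall i, mu.-integrable setT (fun w => ((s w - vmean mu s) 0 i)%:E)) /\
  vmean mu (fun w => s w - vmean mu s) = 0.
Proof.
move=> si; split=> [i|].
  rewrite (_ : (fun w => _) = (fun w => (s w 0 i)%:E - (vmean mu s 0 i)%:E)%E).
    by apply: integrableB => //; exact: finite_measure_integrable_cst.
  by apply/funext => w; rewrite !mxE.
apply/rowP => i; rewrite !mxE; under eq_Rintegral do rewrite !mxE.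
have sii := si i; rewrite RintegralB//; last exact: finite_measure_integrable_cst.
by rewrite Rintegral_cst//= probability_setT mulr1 subrr.
Qed.

(** * Measurability and independence along a run *)

Section RunMeasurability.
Context (R : realType) (d : nat) (dX dZ : measure_display).
Context (X : measurableType dX) (Z : measurableType dZ) (D : dc_data R d X Z).
Context (opt : spg_option) (sch : schedule R) (G alpha : R) (x1 : 'rV[R]_d) (K : nat).
Context (W : stagewise_run D opt sch G alpha x1 K).
Hypothesis hD : is_dc_problem D.
Local Notation P := (run_prob W).
Local Notation T := (run_space W).
Local Notation E := (edom (reg D)).
Local Notation iters k := (iters sch k).
Local Notation xW := (x_ (s := W)).
Local Notation yW := (y_ (s := W)).

Definition run_events : sample_index -> set (set T) :=
  sample_events (fun k t => xi_ W k t) (fun k t => zeta_ W k t) (tau_ W).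

(** Samples drawn before step t of stage k, in lexicographic order. The index of tau never occurs,
    so every history is independent of tau. *)
Definition before (k t : nat) : set sample_index :=
  [set i | match i with
           | inl (inl (k', s)) | inl (inr (k', s)) =>
             drawn sch K k' s /\ (k' < k \/ k' = k /\ s < t)%N
           | inr _ => False
           end].

Definition history (k t : nat) : set (set T) := past run_events (before k t).

Lemma run_events_measurable i : run_events i `<=` measurable.
Proof.
case: i => [[[k t]|[k t]]|[]] _ [B mB <-]; rewrite setTI -[X in measurable X]setTI;
  exact: measurable_funPT.
Qed.

Lemma run_events_setT i : run_events i setT.
Proof. by case: i => [[[k t]|[k t]]|[]]; exists setT => //; rewrite setTI. Qed.

Lemma run_events_setI i : setI_closed (run_events i).
Proof.
by case: i => [[[k t]|[k t]]|[]] _ _ [A mA <-] [B mB <-];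
  (exists (A `&` B); first exact: measurableI); rewrite !setTI preimage_setI.
Qed.

Lemma history_measurable (J : set sample_index) : past run_events J `<=` measurable.
Proof. by apply: past_measurable; exact: run_events_measurable. Qed.

Lemma past_sub (J J' : set sample_index) : J `<=` J' ->
  past run_events J `<=` <<s past run_events J' >>.
Proof. by move=> JJ' A [i Ji EA]; apply: sub_sigma_algebra; exists i => //; exact: JJ'. Qed.

Lemma before_sub k t k' t' : (k < k' \/ k = k' /\ t <= t')%N -> before k t `<=` before k' t'.
Proof. by move=> kt [[[a s]|[a s]]|//] [ds h]; split => //; lia. Qed.

Lemma before_used k t : before k t `<=` used_samples sch K.
Proof. by move=> [[[a s]|[a s]]|//] []. Qed.

Lemma xi_measurable (J : set sample_index) k t : J (inl (inl (k, t))) ->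
  measurable_fun [set: g_sigma_algebraType (past run_events J)] (xi_ W k t).
Proof.
move=> Jkt _ B mB; apply: sub_sigma_algebra; exists (inl (inl (k, t))) => //.
by exists B.
Qed.

Lemma zeta_measurable (J : set sample_index) k t : J (inl (inr (k, t))) ->
  measurable_fun [set: g_sigma_algebraType (past run_events J)] (zeta_ W k t).
Proof.
move=> Jkt _ B mB; apply: sub_sigma_algebra; exists (inl (inr (k, t))) => //.
by exists B.
Qed.

Lemma run_independent : mutually_independent P (used_samples sch K) run_events.
Proof. by move=> s A us h; apply: samples_independent. Qed.

Lemma xi_independent (J : set sample_index) k t A B :
  J `<=` used_samples sch K -> ~ J (inl (inl (k, t))) -> drawn sch K k t ->
  <<s past run_events J >> A -> measurable B ->
  (P (A `&` xi_ W k t @^-1` B) = P A * mu_g D B)%E.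
Proof.
move=> JD nJ dkt sA mB; rewrite -(xi_law W dkt)//.
apply: (past_independent run_events_measurable run_events_setT run_events_setI
  run_independent JD (j := inl (inl (k, t)))) => //.
by exists B => //; rewrite setTI.
Qed.

Lemma zeta_independent (J : set sample_index) k t A B :
  J `<=` used_samples sch K -> ~ J (inl (inr (k, t))) -> drawn sch K k t ->
  <<s past run_events J >> A -> measurable B ->
  (P (A `&` zeta_ W k t @^-1` B) = P A * mu_h D B)%E.
Proof.
move=> JD nJ dkt sA mB; rewrite -(zeta_law W dkt)//.
apply: (past_independent run_events_measurable run_events_setT run_events_setI
  run_independent JD (j := inl (inr (k, t)))) => //.
by exists B => //; rewrite setTI.
Qed.

Lemma tau_independent (J : set sample_index) A (B : set nat) :
  J `<=` used_samples sch K -> ~ J (inr tt) ->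
  <<s past run_events J >> A ->
  (P (A `&` tau_ W @^-1` B) = P A * P (tau_ W @^-1` B))%E.
Proof.
move=> JD nJ sA.
apply: (past_independent run_events_measurable run_events_setT run_events_setI
  run_independent JD (j := inr tt)) => //.
by exists B => //; rewrite setTI.
Qed.

Hypothesis hx1 : E x1.
Hypothesis G0 : 0 < G.
Hypothesis gam0 : forall k, (1 <= k)%N -> 0 < gam sch k.
Hypothesis eta0 : forall k t, (1 <= k)%N -> (1 <= t)%N -> 0 < Defs.eta sch k t.
Hypothesis iters0 : forall k, (1 <= k)%N -> (1 <= iters k)%N.
Hypothesis hr : opt = Option2 -> convex_indicator (reg D) \/
  forall x, E x -> exists2 v, subdiff (reg D) x v & enorm v <= G.

Definition sample_dir k t w : 'rV[R]_d :=
  sg D (yW k t w) (xi_ W k t w) - sh D (yW k 1 w) (zeta_ W k t w).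

Lemma run_step k t w : E (yW k 1 w) -> drawn sch K k t ->
  [/\ spg_region D opt G (gam sch k) (yW k 1 w) (yW k t.+1 w), E (yW k t.+1 w) &
    forall x, spg_region D opt G (gam sch k) (yW k 1 w) x -> E x ->
      rfun D (yW k t.+1 w) +
        spg_quad (gam sch k) (Defs.eta sch k t)^-1 (yW k 1 w) (yW k t w)
          (sample_dir k t w) (yW k t.+1 w)
      <= rfun D x +
        spg_quad (gam sch k) (Defs.eta sch k t)^-1 (yW k 1 w) (yW k t w)
          (sample_dir k t w) x].
Proof.
move=> Ey dkt; apply: spg_argmin (y_step (s:=W) w dkt) => //.
by case/andP: dkt => /andP[k1 _] _; rewrite divr_ge0 ?mulr_ge0// ltW// gam0.
Qed.

Lemma spg_region_center o k y : (1 <= k)%N -> E y -> spg_region D o G (gam sch k) y y.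
Proof.
move=> k1 Ey; case: o => //=; split => //.
by rewrite subrr enorm0 divr_ge0 ?mulr_ge0 ?(ltW G0)// ltW// gam0.
Qed.

Lemma y_dom k t w : (1 <= k <= K)%N -> E (xW k w) -> (1 <= t <= (iters k).+1)%N ->
  E (yW k t w) /\ spg_region D opt G (gam sch k) (yW k 1 w) (yW k t w).
Proof.
move=> kK Ex; case: t => // t /andP[_ tT].
have Ey1 : E (yW k 1 w) by rewrite y_init.
case: t tT => [_|t tT]; last first.
  by have [] := @run_step k t.+1 w Ey1 _; rewrite /drawn ?kK.
by split => //; apply: spg_region_center => //; case/andP: kK.
Qed.

Lemma x_dom k w : (1 <= k <= K.+1)%N -> E (xW k w).
Proof.
case: k => // k /andP[_]; elim: k => [_|k IH kK]; first by rewrite x_init.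
have k1K : (1 <= k.+1 <= K)%N by [].
have Ek := IH (ltnW kK); rewrite x_step//.
have Ey t : (1 <= t <= (iters k.+1).+1)%N -> E (yW k.+1 t w) by move=> /(y_dom k1K Ek)[].
have i0 := iters0 (ltn0Sn k).
(* The type of the run depends on [opt]; the case analysis is made on a free option o instead. *)
suff h o : E (spg_output o (iters k.+1) (fun t => yW k.+1 t w)) by exact: h.
case: o; rewrite /spg_output.
- have [] // := @weighted_mean_convex _ _ E (rfun D) 2 (iters k.+1).+2
    (fun t => yW k.+1 t w) (rfun_convex hD).
  by move=> t /andP[t1 t2]; apply: Ey; rewrite ltnW.
- have [] // := @weighted_mean_convex _ _ E (rfun D) 1 (iters k.+1).+1
    (fun t => yW k.+1 t w) (rfun_convex hD).
  by move=> t /andP[t1 t2]; apply: Ey; rewrite t1 ltnW.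
Qed.

Lemma sample_dir_measurable (J : set sample_index) k t :
  J (inl (inl (k, t))) -> J (inl (inr (k, t))) ->
  measurable_fun [set: g_sigma_algebraType (past run_events J)] (yW k t : _ -> borelV R d) ->
  measurable_fun [set: g_sigma_algebraType (past run_events J)] (yW k 1 : _ -> borelV R d) ->
  measurable_fun [set: g_sigma_algebraType (past run_events J)]
    (sample_dir k t : _ -> borelV R d).
Proof.
move=> Jxi Jzeta my my1; apply: measurable_rowB.
- have mp : measurable_fun [set: g_sigma_algebraType (past run_events J)]
      ((fun w => (yW k t w, xi_ W k t w)) : _ -> borelV R d * X).
    by apply/measurable_fun_pairP; split => //; exact: xi_measurable.
  exact: (measurableT_comp (sg_measurable hD) mp).
- have mp : measurable_fun [set: g_sigma_algebraType (past run_events J)]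
      ((fun w => (yW k 1 w, zeta_ W k t w)) : _ -> borelV R d * Z).
    by apply/measurable_fun_pairP; split => //; exact: zeta_measurable.
  exact: (measurableT_comp (sh_measurable hD) mp).
Qed.

(** Each step is a proximal step at a point built from earlier iterates and the samples of the step,
    all measurable for the next history. *)
Lemma y_measurable k t : (1 <= k <= K)%N ->
  measurable_fun [set: g_sigma_algebraType (history k 1)] (xW k : _ -> borelV R d) ->
  (1 <= t <= (iters k).+1)%N ->
  measurable_fun [set: g_sigma_algebraType (history k t)] (yW k t : _ -> borelV R d).
Proof.
move=> kK mx; case: t => // t /andP[_].
have k1 : (1 <= k)%N by case/andP: kK.
have y1E : yW k 1 = xW k by apply/funext => w; rewrite y_init.
elim: t => [_|t IH tT]; first by rewrite y1E.
have dkt : drawn sch K k t.+1 by rewrite /drawn kK.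
have sub : past run_events (before k t.+1) `<=` <<s history k t.+2 >>.
  by apply: past_sub; apply: before_sub; right.
have my := measurable_g_sigma_sub sub (IH (ltnW tT)).
have my1 : measurable_fun [set: g_sigma_algebraType (history k t.+2)]
    (yW k 1 : _ -> borelV R d).
  rewrite y1E; apply: measurable_g_sigma_sub mx.
  by apply: past_sub; apply: before_sub; right.
have mv : measurable_fun [set: g_sigma_algebraType (history k t.+2)]
    (sample_dir k t.+1 : _ -> borelV R d).
  by apply: sample_dir_measurable => //; split => //; right.
have Ey1 w : E (yW k 1 w).
  by rewrite y1E; apply: x_dom; lia.
pose s := gam sch k + (Defs.eta sch k t.+1)^-1.
have g0 := gam0 k1; have e0 : 0 < (Defs.eta sch k t.+1)^-1 by rewrite invr_gt0 eta0.
have s0 : 0 < s by rewrite addr_gt0.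
pose p w := s^-1 *: (gam sch k *: yW k 1 w + (Defs.eta sch k t.+1)^-1 *: yW k t.+1 w
  - sample_dir k t.+1 w).
have mp : measurable_fun [set: g_sigma_algebraType (history k t.+2)] (p : _ -> borelV R d).
  apply: measurable_rowZ; first exact: measurable_cst.
  apply: measurable_rowB => //; apply: measurable_rowD;
    by apply: measurable_rowZ => //; exact: measurable_cst.
have step w := @run_step k t.+1 w (Ey1 w) dkt.
have sq w := @spg_quad_prox _ _ (gam sch k) (Defs.eta sch k t.+1)^-1 (yW k 1 w)
  (yW k t.+1 w) (sample_dir k t.+1 w) _ _ s0.
(* The option is again freed from the type of the run; the equation with [opt] gives access to the
   hypothesis on the regularizer in Option 2. *)
suff h o : o = opt -> (forall w, [/\ spg_region D o G (gam sch k) (yW k 1 w) (yW k t.+2 w),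
    E (yW k t.+2 w) & forall x, spg_region D o G (gam sch k) (yW k 1 w) x -> E x ->
      rfun D (yW k t.+2 w) + spg_quad (gam sch k) (Defs.eta sch k t.+1)^-1 (yW k 1 w)
        (yW k t.+1 w) (sample_dir k t.+1 w) (yW k t.+2 w)
      <= rfun D x + spg_quad (gam sch k) (Defs.eta sch k t.+1)^-1 (yW k 1 w)
        (yW k t.+1 w) (sample_dir k t.+1 w) x]) ->
    measurable_fun [set: g_sigma_algebraType (history k t.+2)] (yW k t.+2 : _ -> borelV R d).
  exact: (h opt).
case: o => oE {}step.
- apply: (@prox_minimizer_measurable _ _ _ (g_sigma_algebraType (history k t.+2)) E (rfun D) s p) => //.
    exact: rfun_convex.
  move=> w; have [_ Em mmin] := step w; split => // x Ex.
  by have := mmin x I Ex; have /= := sq (yW k t.+2 w) x w; rewrite -/s -/(p w); lra.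
- apply: (@region_minimizer_measurable _ _ _ (g_sigma_algebraType (history k t.+2)) E (rfun D) s G (3 * G / gam sch k)
    (yW k 1) p) => //.
  + by rewrite divr_gt0// mulr_gt0.
  + exact: ltW.
  + exact: rfun_convex.
  + by move=> a b; apply: rfun_lipschitz => //; [exact: ltW|exact: hr].
  + move=> w; have [[_ Rm] Em mmin] := step w; split => // x [Ex Rx].
    have := mmin x (conj Ex Rx) Ex; have /= := sq (yW k t.+2 w) x w.
    by rewrite -/s -/(p w); lra.
Qed.

Lemma x_measurable k : (1 <= k <= K.+1)%N ->
  measurable_fun [set: g_sigma_algebraType (history k 1)] (xW k : _ -> borelV R d).
Proof.
case: k => // k /andP[_]; elim: k => [_|k IH kK].
  rewrite (_ : xW 1 = cst x1); first exact: measurable_cst.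
  by apply/funext => w; rewrite x_init.
have k1K : (1 <= k.+1 <= K)%N by [].
have mx := IH (ltnW kK).
have my t : (1 <= t <= (iters k.+1).+1)%N ->
    measurable_fun [set: g_sigma_algebraType (history k.+2 1)] (yW k.+1 t : _ -> borelV R d).
  move=> tT; apply: measurable_g_sigma_sub (y_measurable k1K mx tT).
  by apply: past_sub; apply: before_sub; left.
have mwm a n : (0 < a)%N -> (n <= (iters k.+1).+2)%N ->
    measurable_fun [set: g_sigma_algebraType (history k.+2 1)]
      ((fun w => weighted_mean a n (fun t => yW k.+1 t w)) : _ -> borelV R d).
  move=> a0 nT; apply: measurable_rowZ; first exact: measurable_cst.
  (* Measurability of a sum is stated for families measurable at every index, so terms out of range
     are set to 0. *)
  pose f t w : 'rV[R]_d := if (1 <= t <= (iters k.+1).+1)%N then t%:R *: yW k.+1 t w else 0.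
  have -> : (fun w => \sum_(a <= t < n) t%:R *: yW k.+1 t w) =
      (fun w => \sum_(a <= t < n) f t w) :> (T -> 'rV[R]_d).
    apply/funext => w; apply: eq_big_seq => t; rewrite mem_index_iota => tn.
    by rewrite /f ifT//; lia.
  apply: measurable_row_sum => t; rewrite /f.
  case: (boolP (1 <= t <= (iters k.+1).+1)%N) => [tT|_]; last exact: measurable_cst.
  by apply: measurable_rowZ; [exact: measurable_cst|exact: my].
rewrite (_ : xW k.+2 = fun w => spg_output opt (iters k.+1) (fun t => yW k.+1 t w)).
  suff h o : measurable_fun [set: g_sigma_algebraType (history k.+2 1)]
    ((fun w => spg_output o (iters k.+1) (fun t => yW k.+1 t w)) : _ -> borelV R d) by exact: h.
  by rewrite /spg_output; case: o; exact: mwm.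
by apply/funext => w; rewrite x_step.
Qed.

End RunMeasurability.

(** * The algebra of the potential *)

Section PotentialAlgebra.
Context (R : realType).

(** Where the step size of Option 1 comes from: with weight t + 1 the old distance has coefficient g
    / 6 (t + 1)^2 and the new one g / 6 (t + 1) (t + 4) = g / 6 ((t + 2)^2 + t), so the distance
    terms telescope. *)
Lemma potential_smooth (g t a N J U U' k : R) : 0 < g -> 0 <= t -> 0 <= U' ->
  k = g * (t + 1) / 3 ->
  a <= 2 / k * N - J + k / 2 * U - (g + k) / 2 * U' ->
  (t + 1) * a + g / 6 * (t + 2) ^+ 2 * U' <=
    g / 6 * (t + 1) ^+ 2 * U + 6 / g * N - (t + 1) * J.
Proof.
move=> g0 t0 U0 kE; have t10 : 0 < t + 1 by rewrite ltr_wpDl.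
move=> /(ler_wpM2l (ltW t10)); rewrite kE => h.
have e : (t + 1) * (2 / (g * (t + 1) / 3) * N - J + g * (t + 1) / 3 / 2 * U
    - (g + g * (t + 1) / 3) / 2 * U') =
    6 / g * N - (t + 1) * J + g / 6 * (t + 1) ^+ 2 * U - g / 6 * ((t + 2) ^+ 2 + t) * U'.
  by field; rewrite !gt_eqF.
have : 0 <= g / 6 * t * U' by rewrite !mulr_ge0 ?invr_ge0// ltW.
rewrite e in h; lra.
Qed.

(** The same for Option 2 with weight t: g / 8 t^2 against g / 8 t (t + 4) = g / 8 ((t + 1)^2 + 2 t
    - 1). *)
Lemma potential_nonsmooth (g t a M J U U' k : R) : 0 < g -> 1 <= t -> 0 <= U' ->
  k = g * t / 4 ->
  a <= (2 * k)^-1 * M - J + k / 2 * U - (g + k) / 2 * U' ->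
  t * a + g / 8 * (t + 1) ^+ 2 * U' <= g / 8 * t ^+ 2 * U + 2 / g * M - t * J.
Proof.
move=> g0 t1 U0 kE; have t0 : 0 < t by rewrite (lt_le_trans ltr01).
move=> /(ler_wpM2l (ltW t0)); rewrite kE => h.
have e : t * ((2 * (g * t / 4))^-1 * M - J + g * t / 4 / 2 * U
    - (g + g * t / 4) / 2 * U') =
    2 / g * M - t * J + g / 8 * t ^+ 2 * U - g / 8 * ((t + 1) ^+ 2 + (2 * t - 1)) * U'.
  by field; rewrite !gt_eqF.
have : 0 <= g / 8 * (2 * t - 1) * U'.
  apply: mulr_ge0 => //; apply: mulr_ge0; last lra.
  by rewrite divr_ge0// ltW.
rewrite e in h; lra.
Qed.

(** Total averaging weight of n iterates; o = 1 for the weights 2, ..., n + 1 of Option 1 and o = 0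
    for 1, ..., n. *)
Lemma sum_weights (o n : nat) : (o <= 1)%N ->
  n%:R ^+ 2 + (1 + 2 * o%:R) * n%:R <= 2 * \sum_(1 + o <= s < n.+1 + o) s%:R :> R.
Proof.
move=> o1; elim: n => [|n IH].
  by rewrite big_geq ?leqnn// expr0n/= !mulr0 addr0.
rewrite (_ : (n.+2 + o = (n.+1 + o).+1)%N)// big_nat_recr/=; last first.
  by rewrite leq_add2r.
rewrite mulrDr natrD -![n.+1%:R]natr1.
have : (0 <= o%:R :> R) && (o%:R <= 1 :> R) by rewrite ler0n lern1.
move=> /andP[].
move: IH; move: (\sum_(_ <= _ < _) _) => s; move: (n%:R : R) (o%:R : R) => a b *; lra.
Qed.

End PotentialAlgebra.

(** * One stage of the algorithm *)

Section Stage.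
Context (R : realType) (d : nat) (dX dZ : measure_display).
Context (X : measurableType dX) (Z : measurableType dZ) (D : dc_data R d X Z).
Context (opt : spg_option) (sch : schedule R) (G alpha : R) (x1 : 'rV[R]_d) (K : nat).
Context (W : stagewise_run D opt sch G alpha x1 K).
Hypothesis hD : is_dc_problem D.
Local Notation P := (run_prob W).
Local Notation T := (run_space W).
Local Notation E := (edom (reg D)).
Local Notation iters k := (iters sch k).
Local Notation xW := (x_ (s := W)).
Local Notation yW := (y_ (s := W)).
Hypothesis hx1 : E x1.
Hypothesis G0 : 0 < G.
Hypothesis gam0 : forall k, (1 <= k)%N -> 0 < gam sch k.
Hypothesis eta0 : forall k t, (1 <= k)%N -> (1 <= t)%N -> 0 < Defs.eta sch k t.
Hypothesis iters0 : forall k, (1 <= k)%N -> (1 <= iters k)%N.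
Hypothesis var_g : forall x, E x ->
  (\int[mu_g D]_s (enorm (sg D x s - dg D x) ^+ 2)%:E <= (G ^+ 2)%:E)%E.
Hypothesis var_h : forall x, E x ->
  (\int[mu_h D]_s (enorm (sh D x s - dh D x) ^+ 2)%:E <= (G ^+ 2)%:E)%E.

Definition smooth_case : Prop := exists2 L : R, 0 <= L &
  [/\ opt = Option1, forall a b, enorm (dg D a - dg D b) <= L * enorm (a - b),
    forall k, (1 <= k)%N -> 3 * L <= gam sch k,
    forall k t, (1 <= k)%N -> (1 <= t)%N -> (Defs.eta sch k t)^-1 = gam sch k * (t%:R + 1) / 3 &
    forall k, (1 <= k)%N -> (3 <= iters k)%N].

Definition nonsmooth_case : Prop :=
  [/\ opt = Option2, convex_indicator (reg D) \/
      forall x, E x -> exists2 v, subdiff (reg D) x v & enorm v <= G,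
    forall x, E x -> enorm (dg D x) <= G /\ enorm (dh D x) <= G &
    forall k t, (1 <= k)%N -> (1 <= t)%N -> (Defs.eta sch k t)^-1 = gam sch k * t%:R / 4].

Hypothesis hcase : smooth_case \/ nonsmooth_case.

Lemma nonsmooth_reg : opt = Option2 -> convex_indicator (reg D) \/
  forall x, E x -> exists2 v, subdiff (reg D) x v & enorm v <= G.
Proof. by case: hcase => [[L _ [-> //]]|[]]. Qed.

Context (k : nat).
Hypothesis kK : (1 <= k <= K)%N.
Let k1 : (1 <= k)%N. Proof. by case/andP: kK. Qed.
Local Notation gamma := (gam sch k).

Definition prox_center w : 'rV[R]_d := prox_pt D gamma (xW k w).
Local Notation zW := prox_center.
Local Notation pv w := (prox_val D gamma (xW k w)).

(* The two options weight the iterates y_2, y_3, ... resp. y_1, y_2, ... *)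
Definition shift : nat := if opt is Option1 then 1 else 0.
(** The denominators of [potential_smooth] and [potential_nonsmooth]. *)
Definition kappa : R := if opt is Option1 then 6 else 8.
Definition partial_gap t w : R :=
  \sum_(1 + shift <= s < t + shift) s%:R * (pv w (yW k s w) - pv w (zW w)).
(** The gap sum is empty at t = 1 and carries exactly the weights of the SPG output at t = T + 1. *)
Definition potential t w : R :=
  partial_gap t w + gamma / kappa * (t + shift)%:R ^+ 2 * enorm (yW k t w - zW w) ^+ 2.
Definition noise_g t w : 'rV[R]_d := sg D (yW k t w) (xi_ W k t w) - dg D (yW k t w).
Definition noise_h t w : 'rV[R]_d := sh D (yW k 1 w) (zeta_ W k t w) - dh D (yW k 1 w).

Let Ex w : E (xW k w). Proof. by apply: x_dom => //; lia. Qed.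
Let y1E w : yW k 1 w = xW k w. Proof. by rewrite y_init. Qed.
Let Ey t w : (1 <= t <= (iters k).+1)%N -> E (yW k t w).
Proof. by move=> tT; have [] := y_dom hD G0 gam0 kK (Ex w) tT. Qed.
Let Ez w : E (zW w). Proof. by apply: prox_pt_dom => //; exact: gam0. Qed.
Let g0 : 0 < gamma. Proof. exact: gam0. Qed.

Lemma prox_val_ge w x : E x -> 0 <= pv w x - pv w (zW w).
Proof.
move=> Exx; have := prox_pt_strong hD (xW k w) g0 Exx.
have : 0 <= gamma / 2 * enorm (x - prox_pt D gamma (xW k w)) ^+ 2.
  by apply: mulr_ge0; [rewrite divr_ge0// ltW|exact: sqr_ge0].
by rewrite /prox_center; lra.
Qed.

Lemma partial_gap_ge0 t w : (1 <= t <= (iters k).+1)%N -> 0 <= partial_gap t w.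
Proof.
move=> tT; rewrite /partial_gap big_nat; apply: sumr_ge0 => s sT.
apply: mulr_ge0 => //; apply: prox_val_ge; apply: Ey.
by move: sT; rewrite /shift; case: (opt) tT => /=; lia.
Qed.

Lemma option_cases :
  [/\ opt = Option1, shift = 1%N & kappa = 6] \/ [/\ opt = Option2, shift = 0%N & kappa = 8].
Proof. by rewrite /shift /kappa; case: (opt); [left|right]. Qed.

Lemma potential_ge t w : (1 <= t <= (iters k).+1)%N ->
  gamma / 8 * ((t + shift)%:R ^+ 2 * enorm (yW k t w - zW w) ^+ 2) <= potential t w.
Proof.
move=> tT; rewrite /potential; apply: ler_wpDl; first exact: partial_gap_ge0.
rewrite -[leRHS]mulrA; apply: ler_wpM2r; first by rewrite mulr_ge0 ?sqr_ge0.
by case: option_cases => -[_ _ ->]; rewrite ler_pM2l// lef_pV2 ?posrE// ler_nat.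
Qed.

Lemma potential_ge0 t w : (1 <= t <= (iters k).+1)%N -> 0 <= potential t w.
Proof.
move=> tT; apply: le_trans (potential_ge w tT).
by apply: mulr_ge0; [rewrite divr_ge0// ltW|rewrite mulr_ge0 ?sqr_ge0].
Qed.

Lemma partial_gapS t w : (1 <= t)%N ->
  partial_gap t.+1 w = partial_gap t w +
    (t + shift)%:R * (pv w (yW k (t + shift)%N w) - pv w (zW w)).
Proof.
move=> t1; have le1 : (1 + shift <= t + shift)%N by lia.
by rewrite /partial_gap addSn (big_nat_recr _ _ _ le1).
Qed.

Lemma sample_dir_noise t w : sample_dir k t w =
  (noise_g t w - noise_h t w) + (dg D (yW k t w) - dh D (xW k w)).
Proof.
apply/rowP => i; rewrite /sample_dir /noise_g /noise_h y1E !mxE; ring.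
Qed.

Lemma spg_region1 o y x : o = Option1 -> spg_region D o G gamma y x.
Proof. by move->. Qed.

Lemma spg_region2 o y : o = Option2 ->
  spg_region D o G gamma y = prox_region E y (3 * G / gamma).
Proof. by move->. Qed.

(** The constants serve both options. Option 1 gives 6 / gamma |n_g - n_h|^2, hence 12. In Option 2
    the direction is at most |n_g| + |n_h| + 2 G, and 2 / gamma (|n_g| + |n_h| + 6 G)^2 contributes
    6 / gamma per squared noise and 2 * 108 = 216. *)
Lemma potential_step t w : (1 <= t <= iters k)%N ->
  potential t.+1 w <= potential t w
    + 12 / gamma * (enorm (noise_g t w) ^+ 2 + enorm (noise_h t w) ^+ 2)
    + 216 * G ^+ 2 / gamma
    - (t + shift)%:R * dotp (noise_g t w - noise_h t w) (yW k t w - zW w).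
Proof.
move=> tT; have t1 : (1 <= t)%N by case/andP: tT.
have dkt : drawn sch K k t by rewrite /drawn kK.
have Ey1 : E (yW k 1 w) by rewrite y1E; exact: Ex.
have [Rm Em mmin] := run_step hD G0 gam0 Ey1 dkt.
set ng := noise_g t w; set nh := noise_h t w.
have vE := sample_dir_noise t w; rewrite -/ng -/nh in vE.
have e0 : 0 < (Defs.eta sch k t)^-1 by rewrite invr_gt0 eta0.
rewrite /potential partial_gapS//; case: option_cases => -[oE -> kapE]; rewrite kapE.
- case: hcase => [[L L0 [_ lip gL etaE _]]|[oE' _ _ _]]; last first.
    by exfalso; move: oE'; rewrite oE.
  have n2 : enorm (ng - nh) ^+ 2 <= 2 * enorm ng ^+ 2 + 2 * enorm nh ^+ 2.
    by have := sqr_ge0 (enorm (ng + nh)); rewrite enormB2 enormD2; lra.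
  have kL : 2 * L <= (Defs.eta sch k t)^-1.
    have t1R : 1 <= t%:R :> R by rewrite ler1n.
    have := gL k k1; rewrite etaE// => gL'.
    have : 3 * L * 2 <= gamma * (t%:R + 1) by apply: ler_pM => //; lra.
    lra.
  have minE x : E x -> rfun D (yW k t.+1 w) +
      spg_quad gamma (Defs.eta sch k t)^-1 (xW k w) (yW k t w) (sample_dir k t w) (yW k t.+1 w)
    <= rfun D x + spg_quad gamma (Defs.eta sch k t)^-1 (xW k w) (yW k t w) (sample_dir k t w) x.
    by move=> Exx; have := mmin x; rewrite y1E; apply => //; exact: spg_region1.
  have := spg_step_smooth (q := dh D (xW k w)) vE (rfun_convex hD) L0 kL e0
    (dg_subgradient hD) lip Em (Ez w) minE.
  move/(potential_smooth g0 (ler0n R t) (sqr_ge0 _) (etaE k t k1 t1)).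
  have t2 : (t.+1 + 1)%:R = t%:R + 2 :> R by rewrite -natrD addn1 addn2.
  rewrite t2 natrD addn1 /prox_val.
  have g6 : 6 / gamma * enorm (ng - nh) ^+ 2 <=
      6 / gamma * (2 * enorm ng ^+ 2 + 2 * enorm nh ^+ 2).
    by rewrite ler_pM2l// divr_gt0.
  have : 0 <= 216 * G ^+ 2 / gamma.
    by apply: divr_ge0; [apply: mulr_ge0; [exact: ler0n|exact: sqr_ge0]|exact: ltW].
  set c := 216 * G ^+ 2 / gamma; lra.
- case: hcase => [[L _ [oE' _ _ _ _]]|[_ hr' dG etaE]]; first by exfalso; move: oE'; rewrite oE.
  have St : prox_region E (xW k w) (3 * G / gamma) (yW k t w).
    have tT1 : (1 <= t <= (iters k).+1)%N by lia.
    by have [] := y_dom hD G0 gam0 kK (Ex w) tT1; rewrite (spg_region2 _ oE) y1E.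
  have Sn : prox_region E (xW k w) (3 * G / gamma) (yW k t.+1 w).
    by move: Rm; rewrite (spg_region2 _ oE) y1E.
  have [dg1 dh1] := dG _ (Ex w).
  have Sz : prox_region E (xW k w) (3 * G / gamma) (zW w).
    by split; [exact: Ez|exact: (prox_pt_near hD (ltW G0) hr' g0 (Ex w) dg1 dh1)].
  have lip a b : E a -> E b -> rfun D a - rfun D b <= G * enorm (a - b).
    by apply: rfun_lipschitz => //; exact: ltW.
  have minS x : prox_region E (xW k w) (3 * G / gamma) x -> rfun D (yW k t.+1 w) +
      spg_quad gamma (Defs.eta sch k t)^-1 (xW k w) (yW k t w) (sample_dir k t w) (yW k t.+1 w)
    <= rfun D x + spg_quad gamma (Defs.eta sch k t)^-1 (xW k w) (yW k t w) (sample_dir k t w) x.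
    move=> [Exx Rx]; have := mmin x; rewrite y1E; apply => //.
    by rewrite (spg_region2 _ oE).
  have := spg_step_nonsmooth (q := dh D (xW k w)) vE (convex_on_region (rfun_convex hD)) g0 e0
    (ltW G0) lip (dg_subgradient hD (yW k t w)) St Sn Sz minS.
  have t1R : 1 <= t%:R :> R by rewrite ler1n.
  move/(potential_nonsmooth g0 t1R (sqr_ge0 _) (etaE k t k1 t1)).
  rewrite !addn0 -[t.+1%:R]natr1 -/(prox_val D gamma (xW k w) _).
  have yE : E (yW k t w) by case: St.
  have [dg2 _] := dG _ yE.
  have vle : enorm (sample_dir k t w) <= enorm ng + enorm nh + 2 * G.
    have := enormD (ng - nh) (dg D (yW k t w) - dh D (xW k w)); rewrite -vE.
    have := enormB ng nh; have := enormB (dg D (yW k t w)) (dh D (xW k w)); lra.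
  have v2 : (enorm (sample_dir k t w) + 4 * G) ^+ 2 <=
      3 * enorm ng ^+ 2 + 3 * enorm nh ^+ 2 + 108 * G ^+ 2.
    have ng0 := enorm_ge0 ng; have nh0 := enorm_ge0 nh.
    have v0 := enorm_ge0 (sample_dir k t w).
    apply: (@le_trans _ _ ((enorm ng + enorm nh + 6 * G) ^+ 2)).
      rewrite ler_sqr ?nnegrE ?addr_ge0 ?mulr_ge0 ?(ltW G0)//; lra.
    have := sqr_ge0 (enorm ng - enorm nh); have := sqr_ge0 (enorm ng - 6 * G).
    have := sqr_ge0 (enorm nh - 6 * G); lra.
  have g2 : 2 / gamma * (enorm (sample_dir k t w) + 4 * G) ^+ 2 <=
      2 / gamma * (3 * enorm ng ^+ 2 + 3 * enorm nh ^+ 2 + 108 * G ^+ 2).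
    by rewrite ler_pM2l// divr_gt0.
  have : 0 <= 6 / gamma * (enorm ng ^+ 2 + enorm nh ^+ 2).
    by rewrite mulr_ge0 ?addr_ge0 ?sqr_ge0// divr_ge0// ltW.
  rewrite /prox_val; lra.
Qed.

Let J0 t := before sch K k t.
(** Both samples of step t are fresh: zeta_t is averaged first, given [J1], and then xi_t, given
    [J0]. *)
Let J1 t := J0 t `|` [set inl (inl (k, t))].

Let J01 t : past (run_events (W := W)) (J0 t) `<=` <<s past (run_events (W := W)) (J1 t) >>.
Proof. by apply: past_sub => i; left. Qed.

Lemma x_history t : (1 <= t)%N ->
  measurable_fun [set: g_sigma_algebraType (history (W := W) k t)] (xW k : _ -> borelV R d).
Proof.
move=> t1; apply: measurable_g_sigma_sub (x_measurable hD hx1 G0 gam0 eta0 iters0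
  nonsmooth_reg _ (k := k)); last by lia.
by apply: past_sub; apply: before_sub; right.
Qed.

Lemma dh_measurable : measurable_fun [set: borelV R d] (dh D : borelV R d -> borelV R d).
Proof. exact: (measurable_vmean (mu_h D) (sh_measurable hD)). Qed.

Lemma dg_measurable : measurable_fun [set: borelV R d] (dg D : borelV R d -> borelV R d).
Proof. exact: (measurable_vmean (mu_g D) (sg_measurable hD)). Qed.

Lemma center_history t : (1 <= t)%N ->
  measurable_fun [set: g_sigma_algebraType (history (W := W) k t)] (zW : _ -> borelV R d).
Proof.
move=> t1; have mx := x_history t1.
apply: (@prox_minimizer_measurable _ _ _ (g_sigma_algebraType (history (W := W) k t)) E
  (fun x => gfun D x + rfun D x) gamma (fun w => xW k w + gamma^-1 *: dh D (xW k w))) => //.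
- exact: gr_convex.
- apply: measurable_rowD => //; apply: measurable_rowZ; first exact: measurable_cst.
  exact: (measurableT_comp dh_measurable mx).
- by move=> w; exact: prox_pt_minimizer.
Qed.

Lemma rfun_measurable : measurable_fun [set: borelV R d] (rfun D).
Proof. by apply: measurableT_comp => //; exact: lsc_measurable (reg_lsc hD). Qed.

Lemma gfun_measurable : measurable_fun [set: borelV R d] (gfun D).
Proof. by apply/measurable_EFinP; exact: lsc_measurable (g_lsc hD). Qed.

Lemma hfun_measurable : measurable_fun [set: borelV R d] (hfun D).
Proof. by apply/measurable_EFinP; exact: lsc_measurable (h_lsc hD). Qed.

Lemma prox_val_history t (y : T -> 'rV[R]_d) : (1 <= t)%N ->
  measurable_fun [set: g_sigma_algebraType (history (W := W) k t)] (y : _ -> borelV R d) ->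
  measurable_fun [set: g_sigma_algebraType (history (W := W) k t)] (fun w => pv w (y w)).
Proof.
move=> t1 my; have mx := x_history t1; rewrite /prox_val /prox_model.
have myx : measurable_fun [set: g_sigma_algebraType (history (W := W) k t)]
   ((fun w => y w - xW k w) : _ -> borelV R d) by exact: measurable_rowB.
apply: measurable_funD; last first.
  by apply: measurable_funM; [exact: measurable_cst|exact: measurable_enorm2].
apply: measurable_funB; last first.
  by apply: measurable_dotp => //; exact: (measurableT_comp dh_measurable mx).
apply: measurable_funD; first exact: (measurableT_comp gfun_measurable my).
exact: (measurableT_comp rfun_measurable my).
Qed.

Lemma y_history s t : (1 <= s <= t)%N -> (s <= (iters k).+1)%N ->
  measurable_fun [set: g_sigma_algebraType (history (W := W) k t)] (yW k s : _ -> borelV R d).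
Proof.
move=> st sT; have s1 : (1 <= s <= (iters k).+1)%N by lia.
have mx : measurable_fun [set: g_sigma_algebraType (history (W := W) k 1)] (xW k : _ -> borelV R d).
  exact: x_history.
apply: measurable_g_sigma_sub (y_measurable hD hx1 G0 gam0 eta0 iters0
  nonsmooth_reg kK mx s1).
by apply: past_sub; apply: before_sub; right; lia.
Qed.

Lemma potential_history t : (1 <= t <= (iters k).+1)%N ->
  measurable_fun [set: g_sigma_algebraType (history (W := W) k t)] (potential t).
Proof.
move=> tT; have t1 : (1 <= t)%N by lia.
have mz := center_history t1.
apply: measurable_funD; last first.
  apply: measurable_funM; first exact: measurable_cst.
  by apply: measurable_enorm2; apply: measurable_rowB => //; apply: y_history; lia.
pose f s w : R := if (1 <= s <= t)%N then s%:R * (pv w (yW k s w) - pv w (zW w)) else 0.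
have -> : partial_gap t = fun w => \sum_(1 + shift <= s < t + shift) f s w.
  apply/funext => w; apply: eq_big_seq => s; rewrite mem_index_iota => sT.
  by rewrite /f ifT//; case: option_cases sT => -[_ -> _]; lia.
apply: measurable_sum => s; rewrite /f.
case: (boolP (1 <= s <= t)%N) => [sT|_]; last exact: measurable_cst.
apply: measurable_funM; first exact: measurable_cst.
by apply: measurable_funB; apply: prox_val_history => //; apply: y_history; lia.
Qed.

(** 240 = 216 + 12 + 12: the deterministic error and one variance for each of the two samples. *)
Lemma expect_potential_step t : (1 <= t <= iters k)%N ->
  (\int[P]_w (potential t.+1 w)%:E
    <= \int[P]_w (potential t w + 240 * G ^+ 2 / gamma)%:E)%E.
Proof.
move=> tT; have t1 : (1 <= t)%N by lia.
have tT1 : (1 <= t <= (iters k).+1)%N by lia.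
have dkt : drawn sch K k t by rewrite /drawn kK.
pose A := 12 / gamma; have A0 : 0 < A by rewrite divr_gt0.
pose u w : 'rV[R]_d := (t + shift)%:R *: (yW k t w - zW w).
pose B := 216 * G ^+ 2 / gamma.
have B0 : 0 <= B by apply: divr_ge0; [apply: mulr_ge0; [exact: ler0n|exact: sqr_ge0]|exact: ltW].
(* The potential controls the factor of the noise, which makes the noise term
   integrable conditionally on the past. *)
have uV w : 6 * ((4 * A)^-1 * enorm (u w) ^+ 2) <= potential t w.
  apply: le_trans (potential_ge w tT1).
  rewrite /u enormZ exprMn real_normK ?num_real// mulrA.
  apply: ler_wpM2r; first by rewrite mulr_ge0 ?sqr_ge0.
  rewrite le_eqVlt; apply/orP; left; apply/eqP; rewrite /A; field; rewrite gt_eqF//.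
have mu0 : measurable_fun [set: g_sigma_algebraType (history (W := W) k t)]
    (u : _ -> borelV R d).
  apply: measurable_rowZ; first exact: measurable_cst.
  by apply: measurable_rowB; [apply: y_history; lia|exact: center_history].
have mV := potential_history tT1.
have my := @y_history t t _ _; have my1 := @y_history 1 t _ _.
have {my} my : measurable_fun [set: g_sigma_algebraType (history (W := W) k t)]
  (yW k t : _ -> borelV R d) by apply: my; lia.
have {my1} my1 : measurable_fun [set: g_sigma_algebraType (history (W := W) k t)]
  (yW k 1 : _ -> borelV R d) by apply: my1; lia.
have mxi : measurable_fun [set: g_sigma_algebraType (past (run_events (W := W)) (J1 t))]
  (xi_ W k t) by apply: xi_measurable; right.
have mnoise (dY : measure_display) (Y : measurableType dY)
    (s : 'rV[R]_d -> Y -> 'rV[R]_d) (ds : 'rV[R]_d -> 'rV[R]_d) :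
    measurable_fun setT ((fun p => s p.1 p.2) : borelV R d * Y -> borelV R d) ->
    measurable_fun [set: borelV R d] (ds : _ -> borelV R d) ->
    measurable_fun setT ((fun p => s p.1 p.2 - ds p.1) : borelV R d * Y -> borelV R d).
  move=> ms mds; apply: measurable_rowB => //.
  exact: (measurableT_comp mds measurable_fst).
have mng : measurable_fun [set: g_sigma_algebraType (past (run_events (W := W)) (J1 t))]
    (noise_g t : _ -> borelV R d).
  have mp : measurable_fun [set: g_sigma_algebraType (past (run_events (W := W)) (J1 t))]
      ((fun w => (yW k t w, xi_ W k t w)) : _ -> borelV R d * X).
    by apply/measurable_fun_pairP; split => //; exact: measurable_g_sigma_sub (@J01 t) my.
  exact: (measurableT_comp (mnoise _ _ _ _ (sg_measurable hD) dg_measurable) mp).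
(* All that is known before zeta_t is drawn, the noise of xi_t included. *)
pose c1 w := potential t w + B + A * enorm (noise_g t w) ^+ 2 - dotp (noise_g t w) (u w).
have mc1 : measurable_fun [set: g_sigma_algebraType (past (run_events (W := W)) (J1 t))] c1.
  apply: measurable_funB; last first.
    by apply: measurable_dotp => //; exact: measurable_g_sigma_sub (@J01 t) mu0.
  apply: measurable_funD; last first.
    by apply: measurable_funM; [exact: measurable_cst|exact: measurable_enorm2].
  apply: measurable_funD; last exact: measurable_cst.
  exact: measurable_g_sigma_sub (@J01 t) mV.
have c1_ge w : (4 * A)^-1 * enorm (u w) ^+ 2 <= c1 w.
  have A20 : 0 < 2 * A by rewrite mulr_gt0.
  have := dotp_young (noise_g t w) (u w) A20.
  have -> : 2 * A / 2 = A by field.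
  have -> : (2 * (2 * A))^-1 = (4 * A)^-1 by congr (_^-1); ring.
  have : 0 <= (4 * A)^-1 * enorm (u w) ^+ 2 by rewrite mulr_ge0 ?sqr_ge0// invr_ge0; lra.
  by have := uV w; rewrite /c1; lra.
have J1used : J1 t `<=` used_samples sch K.
  by move=> i [/before_used//|->].
have J0used : J0 t `<=` used_samples sch K by exact: before_used.
have nJ1 : ~ J1 t (inl (inr (k, t))).
  by move=> [[_ h]|//]; lia.
have nJ0 : ~ J0 t (inl (inl (k, t))) by move=> [_ h]; lia.
apply: (@le_trans _ _ (\int[P]_w (A * enorm (noise_h t w) ^+ 2
    + dotp (noise_h t w) (u w) + c1 w)%:E)%E).
  apply: ge0_le_integral_nomeas => w.
    by rewrite lee_fin potential_ge0//; lia.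
  rewrite lee_fin; have := potential_step w tT.
  by rewrite /c1 /u !dotpZr dotpDl dotpNl -/A -/B; lra.
have [ch1 ch2] : (forall v i, (mu_h D).-integrable setT (fun x => ((sh D v x - dh D v) 0 i)%:E)) /\
    (forall v, vmean (mu_h D) (fun x => sh D v x - dh D v) = 0).
  by split => v; have [] := centered_vmean (sh_integrable hD v).
have [cg1 cg2] : (forall v i, (mu_g D).-integrable setT (fun x => ((sg D v x - dg D v) 0 i)%:E)) /\
    (forall v, vmean (mu_g D) (fun x => sg D v x - dg D v) = 0).
  by split => v; have [] := centered_vmean (sg_integrable hD v).
apply: (@le_trans _ _ (\int[P]_w (A * G ^+ 2 + c1 w)%:E)%E).
  apply: (@one_sample_step _ _ _ P d _ Z (mu_h D) _ (zeta_ W k t) c1 (yW k 1) u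
    (fun v x => sh D v x - dh D v) A (G ^+ 2) (@history_measurable _ _ _ _ _ _ _ _ _ _ _ _ _ _ (J1 t))) => //.
  - by move=> Q C sQ mC; exact: zeta_independent J1used nJ1 dkt sQ mC.
  - exact: measurable_g_sigma_sub (@J01 t) my1.
  - exact: measurable_g_sigma_sub (@J01 t) mu0.
  - exact: (mnoise _ _ _ _ (sh_measurable hD) dh_measurable).
  - by move=> w; apply: var_h; rewrite y1E.
pose c0 w := potential t w + B + A * G ^+ 2.
apply: (@le_trans _ _ (\int[P]_w (A * enorm (noise_g t w) ^+ 2
    + dotp (noise_g t w) (- u w) + c0 w)%:E)%E).
  apply: ge0_le_integral_nomeas => w.
    rewrite lee_fin addr_ge0//; first by rewrite mulr_ge0 ?sqr_ge0// ltW.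
    by apply: le_trans (c1_ge w); rewrite mulr_ge0 ?sqr_ge0// invr_ge0; lra.
  by rewrite lee_fin /c1 /c0 dotpNr; lra.
have -> : (fun w => (potential t w + 240 * G ^+ 2 / gamma)%:E) =
    (fun w => (A * G ^+ 2 + c0 w)%:E).
  by apply/funext => w; congr EFin; rewrite /c0 /A /B; field; rewrite gt_eqF.
apply: (@one_sample_step _ _ _ P d _ X (mu_g D) _ (xi_ W k t) c0 (yW k t) (fun w => - u w)
    (fun v x => sg D v x - dg D v) A (G ^+ 2) (@history_measurable _ _ _ _ _ _ _ _ _ _ _ _ _ _ (J0 t))) => //.
- by move=> Q C sQ mC; exact: xi_independent J0used nJ0 dkt sQ mC.
- by apply: measurable_funD; [apply: measurable_funD => //; exact: measurable_cst|
    exact: measurable_cst].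
- rewrite (_ : (fun w => - u w) = (fun w => (-1) *: u w)); last first.
    by apply/funext => w; rewrite scaleN1r.
  by apply: measurable_rowZ => //; exact: measurable_cst.
- exact: (mnoise _ _ _ _ (sg_measurable hD) dg_measurable).
- by move=> w; apply: var_g; exact: Ey.
- move=> w; rewrite enormN /c0; have := uV w.
  have : 0 <= (4 * A)^-1 * enorm (u w) ^+ 2 by rewrite mulr_ge0 ?sqr_ge0// invr_ge0; lra.
  have : 0 <= A * G ^+ 2 by rewrite mulr_ge0 ?sqr_ge0// ltW.
  lra.
Qed.

Lemma expect_potential t : (t <= iters k)%N ->
  (\int[P]_w (potential t.+1 w)%:E
    <= \int[P]_w (potential 1 w)%:E + (t%:R * (240 * G ^+ 2 / gamma))%:E)%E.
Proof.
pose C := 240 * G ^+ 2 / gamma.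
have C0 : 0 <= C by apply: divr_ge0; [apply: mulr_ge0; [exact: ler0n|exact: sqr_ge0]|exact: ltW].
elim: t => [_|t IH tT]; first by rewrite mul0r adde0.
have tT1 : (1 <= t.+1 <= (iters k).+1)%N by lia.
apply: (le_trans (@expect_potential_step t.+1 _)); first by lia.
have mV : measurable_fun setT (potential t.+1).
  by apply: (measurable_g_sigmaW _ (potential_history tT1)); exact: history_measurable.
under eq_integral do rewrite EFinD.
rewrite ge0_integralD//; last 2 first.
- by move=> w _; rewrite lee_fin potential_ge0.
- exact/measurable_EFinP.
rewrite integral_cst//= probability_setT mule1.
apply: le_trans (leeD2r _ (IH (ltnW tT))) _.
rewrite -addeA leeD2l// -EFinD lee_fin -/C -[t.+1%:R]natr1; clearbody C; lra.
Qed.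

Definition prox_dist w : R := enorm (xW k w - zW w).

Lemma prox_dist_measurable : measurable_fun setT prox_dist.
Proof.
have mx := x_history (leqnn 1); have mz := center_history (leqnn 1).
apply: (measurable_g_sigmaW (@history_measurable _ _ _ _ _ _ _ _ _ _ _ _ _ _ (J0 1))).
by apply: measurable_enorm; exact: measurable_rowB.
Qed.

Definition total_weight : R := \sum_(1 + shift <= s < (iters k).+1 + shift) s%:R.

(** The last bound reduces the initial potential, once divided by the total weight, to gamma / 8
    d_k^2. In Option 1 it asks for a weight of at least 16 / 3, which is ensured by the three
    iterations guaranteed by T_k. *)
Lemma total_weight_ge : [/\ 0 < total_weight, (iters k)%:R ^+ 2 <= 2 * total_weight &
  8 / kappa * (1 + shift)%:R ^+ 2 <= total_weight].
Proof.
have i1 := iters0 k1; have i1R : 1 <= (iters k)%:R :> R by rewrite ler1n.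
rewrite /total_weight; case: option_cases => -[oE -> ->].
- case: hcase => [[L _ [_ _ _ _ /(_ _ k1) i3]]|[oE' _ _ _]]; last first.
    by exfalso; move: oE'; rewrite oE.
  have i3R : 3 <= (iters k)%:R :> R by rewrite ler_nat.
  have := @sum_weights R 1 (iters k) (leqnn 1).
  set s := \sum_(_ <= _ < _) _; move=> h.
  have h2 : (iters k)%:R ^+ 2 >= 3 * (iters k)%:R :> R by rewrite expr2 ler_wpM2r.
  by split; lra.
- have := @sum_weights R 0 (iters k) isT.
  set s := \sum_(_ <= _ < _) _; move=> h.
  have h2 : (iters k)%:R ^+ 2 >= 1 * (iters k)%:R :> R by rewrite expr2 ler_wpM2r.
  by split; lra.
Qed.

Lemma stage_pointwise w :
  Ffun D (xW k.+1 w) - Ffun D (xW k w) + gamma / 2 * prox_dist w ^+ 2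
  <= total_weight^-1 * potential (iters k).+1 w.
Proof.
have [W0 _ _] := total_weight_ge.
have h1 := stage_decrease hD (xW k.+1 w) g0 (Ex w).
apply: (le_trans h1); rewrite -(ler_pM2l W0) mulVKf ?gt_eqF//.
apply: (@le_trans _ _ (partial_gap (iters k).+1 w)); last first.
  rewrite lerDl mulr_ge0 ?sqr_ge0// mulr_ge0 ?sqr_ge0// divr_ge0 ?(ltW g0)//.
  by case: option_cases => -[_ _ ->].
have xE : xW k.+1 w = weighted_mean (1 + shift) ((iters k).+1 + shift) (fun t => yW k t w).
  have [oE|oE] : opt = Option1 \/ opt = Option2 by case: (opt); [left|right].
    rewrite x_step//; case: option_cases => -[oE' -> _]; last by exfalso; move: oE'; rewrite oE.
    have e : @spg_output R d opt = spg_output Option1 by rewrite oE.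
    by rewrite e /= (addn1 (iters k).+1).
  rewrite x_step//; case: option_cases => -[oE' -> _]; first by exfalso; move: oE'; rewrite oE.
  have e : @spg_output R d opt = spg_output Option2 by rewrite oE.
  by rewrite e /= (addn0 (iters k).+1).
have c1 : (0 < 1 + shift < (iters k).+1 + shift)%N by have := iters0 k1; lia.
have c2 t : (1 + shift <= t < (iters k).+1 + shift)%N -> E (yW k t w).
  by move=> tT; apply: Ey; case: option_cases tT => -[_ -> _]; lia.
have [_] := weighted_mean_convex (prox_val_convex hD (xW k w) (ltW g0)) c1 c2.
rewrite -xE -/total_weight => h2.
have -> : partial_gap (iters k).+1 w =
    \sum_(1 + shift <= s < (iters k).+1 + shift) s%:R * pv w (yW k s w)
    - total_weight * pv w (zW w).
  rewrite /partial_gap /total_weight mulr_suml -sumrB; apply: eq_bigr => s _.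
  by rewrite mulrBr.
by rewrite mulrBr lerB.
Qed.

Context (fm : R).
Hypothesis hfm : forall x, E x -> fm <= Ffun D x.
Definition gap j w : R := Ffun D (xW j w) - fm.

Lemma gap_ge0 j w : (1 <= j <= K.+1)%N -> 0 <= gap j w.
Proof. by move=> jK; rewrite subr_ge0; apply: hfm; apply: x_dom. Qed.

Lemma gap_history j : (1 <= j <= K.+1)%N ->
  measurable_fun [set: g_sigma_algebraType (history (W := W) j 1)] (gap j).
Proof.
move=> jK; have mx : measurable_fun [set: g_sigma_algebraType (history (W := W) j 1)]
    (xW j : _ -> borelV R d).
  exact: (x_measurable hD hx1 G0 gam0 eta0 iters0 nonsmooth_reg).
apply: measurable_funB; last exact: measurable_cst.
apply: measurable_funB; last exact: (measurableT_comp hfun_measurable mx).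
apply: measurable_funD; first exact: (measurableT_comp gfun_measurable mx).
exact: (measurableT_comp rfun_measurable mx).
Qed.

Lemma gap_measurable j : (1 <= j <= K.+1)%N -> measurable_fun setT (gap j).
Proof.
move=> jK; apply: (measurable_g_sigmaW (@history_measurable _ _ _ _ _ _ _ _ _ _ _ _ _ _
  (before sch K j 1))); exact: gap_history.
Qed.

(** Of gamma / 2 E d_k^2 on the left, the initial potential consumes at most gamma / 8, and gamma /
    4 is kept. This subtraction requires E d_k^2 to be finite, which follows from the finite
    expected gap. The noise gives 240 T / total weight <= 480 / T. *)
Lemma stage_inequality : (\int[P]_w (gap k w)%:E < +oo)%E ->
  (\int[P]_w (gap k.+1 w)%:E + (gamma / 4)%:E * \int[P]_w (prox_dist w ^+ 2)%:E
   <= \int[P]_w (gap k w)%:E + (480 * G ^+ 2 / (gamma * (iters k)%:R))%:E)%E.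
Proof.
move=> gapfin; have [W0 W1 W2] := total_weight_ge.
have kK1 : (1 <= k <= K.+1)%N by lia.
have kK2 : (1 <= k.+1 <= K.+1)%N by lia.
have iR : 0 < (iters k)%:R :> R by rewrite ltr0n; exact: iters0.
have md2 : measurable_fun setT (fun w => prox_dist w ^+ 2).
  by apply: measurable_funX; exact: prox_dist_measurable.
have d20 w : 0 <= prox_dist w ^+ 2 by exact: sqr_ge0.
have mV : measurable_fun setT (potential (iters k).+1).
  apply: (measurable_g_sigmaW _ (potential_history _)); first exact: history_measurable.
  by lia.
have V0 w : 0 <= potential (iters k).+1 w by apply: potential_ge0; lia.
pose q := (\int[P]_w (prox_dist w ^+ 2)%:E)%E.
have q0 : (0 <= q)%E by apply: integral_ge0 => w _; rewrite lee_fin.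
have g20 : 0 < gamma / 2 by rewrite divr_gt0.
have intZ (c : R) (f : T -> R) : 0 <= c -> measurable_fun setT f -> (forall w, 0 <= f w) ->
    (\int[P]_w (c * f w)%:E = c%:E * \int[P]_w (f w)%:E)%E.
  move=> c0 mf f0; under eq_integral do rewrite EFinM.
  by rewrite ge0_integralZl_EFin//; [move=> w _; rewrite lee_fin|exact/measurable_EFinP].
have qfin : (q < +oo)%E.
  have : ((gamma / 2)%:E * q <= \int[P]_w (gap k w)%:E)%E.
    rewrite -intZ//; last exact: ltW.
    apply: ge0_le_integral_nomeas => w.
      by rewrite lee_fin mulr_ge0// ltW.
    rewrite lee_fin; have := prox_dist_le_gap hD g0 (Ex w); have := hfm (Ez w).
    by rewrite /gap /prox_dist /prox_center; lra.
  move=> /le_lt_trans/(_ gapfin); move: q0; clearbody q; case: q => [r| |] // _.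
    by move=> _; exact: ltry.
  by rewrite gt0_muley ?lte_fin.
have V1 : (\int[P]_w (potential 1 w)%:E = (gamma / kappa * (1 + shift)%:R ^+ 2)%:E * q)%E.
  rewrite /q -intZ//; last first.
    apply: mulr_ge0; last exact: sqr_ge0.
    by rewrite divr_ge0 ?(ltW g0)//; case: option_cases => -[_ _ ->].
  by apply: eq_integral => w _; rewrite /potential /partial_gap big_geq// add0r y1E.
have h1 : (\int[P]_w (gap k.+1 w)%:E + (gamma / 2)%:E * q <=
    \int[P]_w (gap k w)%:E + (total_weight^-1)%:E * \int[P]_w (potential (iters k).+1 w)%:E)%E.
  rewrite /q -!intZ ?invr_ge0 ?(ltW W0) ?(ltW g20)//.
  have mg j : (1 <= j <= K.+1)%N -> measurable_fun setT (EFin \o gap j).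
    by move=> jK; exact/measurable_EFinP/gap_measurable.
  have mZ (c : R) (f : T -> R) : measurable_fun setT f ->
      measurable_fun setT (fun w => (c * f w)%:E).
    by move=> mf; apply/measurable_EFinP; apply: measurable_funM => //; exact: measurable_cst.
  rewrite -ge0_integralD//; [|by move=> w _; rewrite lee_fin gap_ge0|exact: mg
    |by move=> w _; rewrite lee_fin mulr_ge0// ltW|exact: mZ].
  rewrite -ge0_integralD//; [|by move=> w _; rewrite lee_fin gap_ge0|exact: mg
    |by move=> w _; rewrite lee_fin mulr_ge0// invr_ge0 ltW|exact: mZ].
  apply: ge0_le_integral_nomeas => w.
    by rewrite -EFinD lee_fin addr_ge0 ?gap_ge0// mulr_ge0// ltW.
  by rewrite -!EFinD lee_fin; have := stage_pointwise w; rewrite /gap; lra.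
have h2 := expect_potential (leqnn (iters k)).
rewrite V1 in h2.
have h3 : (\int[P]_w (gap k.+1 w)%:E + (gamma / 2)%:E * q <= \int[P]_w (gap k w)%:E +
    (total_weight^-1)%:E * ((gamma / kappa * (1 + shift)%:R ^+ 2)%:E * q
      + ((iters k)%:R * (240 * G ^+ 2 / gamma))%:E))%E.
  apply: (le_trans h1); rewrite leeD2l// lee_pmul2l ?lte_fin ?invr_gt0//.
have a0 : (0 <= \int[P]_w (gap k w)%:E)%E.
  by apply: integral_ge0 => w _; rewrite lee_fin gap_ge0.
rewrite -/q; clear V1 h1 h2; clearbody q; move: h3 gapfin qfin q0 a0.
case: (\int[P]_w (gap k w)%:E)%E => [a| |]//; case: q => [q'| |]// h3 _ _ q0 a0.
move: h3; rewrite -?(EFinM, EFinD).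
case: (\int[P]_w (gap k.+1 w)%:E)%E => [b| |]; rewrite ?leNye//.
rewrite -?(EFinM, EFinD) !lee_fin => h3.
rewrite lee_fin in q0.
have k0 : kappa != 0 by case: option_cases => -[_ _ ->]; rewrite pnatr_eq0.
have e1 : total_weight^-1 * (gamma / kappa * (1 + shift)%:R ^+ 2 * q') <= gamma / 8 * q'.
  have -> : gamma / kappa * (1 + shift)%:R ^+ 2 * q' =
      gamma / 8 * q' * (8 / kappa * (1 + shift)%:R ^+ 2) by field.
  rewrite mulrC ler_pdivrMr//; apply: ler_wpM2l => //.
  by apply: mulr_ge0 => //; rewrite divr_ge0// ltW.
have e2 : total_weight^-1 * ((iters k)%:R * (240 * G ^+ 2 / gamma)) <=
    480 * G ^+ 2 / (gamma * (iters k)%:R).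
  rewrite mulrC ler_pdivrMr//.
  have c0 : 0 <= 240 * G ^+ 2 / (gamma * (iters k)%:R).
    by apply: divr_ge0; apply: mulr_ge0; rewrite ?sqr_ge0 ?ler0n// ltW.
  have -> : (iters k)%:R * (240 * G ^+ 2 / gamma) =
      240 * G ^+ 2 / (gamma * (iters k)%:R) * (iters k)%:R ^+ 2.
    by field; rewrite !gt_eqF.
  have := ler_wpM2l c0 W1; lra.
move: h3; rewrite mulrDr; have : 0 <= gamma * q' by rewrite mulr_ge0// ltW.
lra.
Qed.
End Stage.

(** * Rates *)

Section PowerSums.
Context (R : realType).
Implicit Types (a q : nat -> R).

(* Summation by parts with the weights k^alpha. *)
Lemma abel_bound (alpha N Delta : R) (K : nat) a q :
  1 <= alpha -> 0 <= N -> (forall k, (1 <= k <= K)%N -> a k.+1 + q k <= a k + N / k%:R) ->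
  (forall k, (1 <= k <= K)%N -> a k <= Delta) -> (1 <= K)%N -> 0 <= a K.+1 ->
  \sum_(1 <= k < K.+1) k%:R `^ alpha * q k <= (Delta + N) * K%:R `^ alpha.
Proof.
move=> al N0 aq aD K1 aK.
have al0 : 0 < alpha by lra.
suff /(_ K (leqnn K)) h : forall n, (n <= K)%N ->
    \sum_(1 <= k < n.+1) k%:R `^ alpha * q k + n%:R `^ alpha * a n.+1
      <= (Delta + N) * n%:R `^ alpha.
  have : 0 <= K%:R `^ alpha * a K.+1 by rewrite mulr_ge0// powR_ge0.
  lra.
elim=> [_|n IH nK].
  by rewrite big_geq// powR0 ?gt_eqF// mul0r mulr0 addr0.
rewrite big_nat_recr//=.
have := IH (ltnW nK); have n1K : (1 <= n.+1 <= K)%N by lia.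
have := aq _ n1K; have := aD _ n1K.
set s := \sum_(1 <= k < n.+1) _.
have m0 : 0 < n.+1%:R `^ alpha :> R by rewrite powR_gt0.
have nm : n%:R `^ alpha <= n.+1%:R `^ alpha :> R.
  by apply: ge0_ler_powR; rewrite ?nnegrE ?ler_nat// ltW.
(* Equivalent to n^alpha <= n (n + 1)^(alpha - 1) up to the factor N; this is where alpha >= 1
   enters. *)
have key : n.+1%:R `^ alpha * (N / n.+1%:R) + N * n%:R `^ alpha <= N * n.+1%:R `^ alpha.
  have powS (k : nat) : (1 <= k)%N -> k%:R `^ alpha = k%:R * k%:R `^ (alpha - 1) :> R.
    move=> k1; have := @powRD R k%:R 1 (alpha - 1).
    by rewrite subrKC powRr1 ?ler0n// => ->//; rewrite pnatr_eq0 -lt0n k1 implybT.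
  have h1 : n%:R `^ alpha <= n%:R * n.+1%:R `^ (alpha - 1) :> R.
    case: (n) => [|j]; first by rewrite powR0 ?gt_eqF// mul0r.
    rewrite powS// ler_wpM2l//; apply: ge0_ler_powR; rewrite ?nnegrE ?ler_nat//; lra.
  rewrite powS// in m0 *.
  have n0 : n.+1%:R != 0 :> R by rewrite pnatr_eq0.
  have -> : n.+1%:R * n.+1%:R `^ (alpha - 1) * (N / n.+1%:R) = N * n.+1%:R `^ (alpha - 1).
    by field.
  rewrite -mulrDr ler_wpM2l//; move: h1; move: (n.+1%:R `^ (alpha - 1)) => c h1.
  by rewrite -natr1; lra.
move: key nm m0; move: (n.+1%:R `^ alpha) (n%:R `^ alpha) => P Q key nm m0 h1 h2 h3.
have h4 : P * (a n.+2 + q n.+1) <= P * (a n.+1 + N / n.+1%:R) by rewrite ler_pM2l.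
have h5 : (P - Q) * a n.+1 <= (P - Q) * Delta by rewrite ler_wpM2l// subr_ge0.
by clear h2; move: h3 h4 h5 key; move: (N / n.+1%:R) (a n.+1) (a n.+2) (q n.+1) => *; lra.
Qed.

(** Pair k with K + 1 - k: one of the two is at least K / 2. *)
Lemma power_sum_ge (alpha : R) (K : nat) : 0 <= alpha -> (1 <= K)%N ->
  K%:R * K%:R `^ alpha <= 2 `^ (alpha + 1) * \sum_(1 <= k < K.+1) k%:R `^ alpha.
Proof.
move=> al K1; set S := \sum_(_ <= _ < _) _.
have S2 : 2 * S = \sum_(1 <= k < K.+1) (k%:R `^ alpha + (K.+1 - k)%:R `^ alpha).
  rewrite big_split/= mulrDl mul1r -/S; congr (_ + _).
  rewrite /S big_nat_rev/=; apply: eq_big_seq => k; rewrite mem_index_iota => kK.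
  by congr (_%:R `^ _); lia.
have K0 : 0 < K%:R :> R by rewrite ltr0n.
have : K%:R * (K%:R / 2) `^ alpha <= 2 * S.
  rewrite S2; have -> : K%:R * (K%:R / 2) `^ alpha = \sum_(1 <= k < K.+1) (K%:R / 2) `^ alpha.
    by rewrite sumr_const_nat subn1 mulr_natl.
  apply: ler_sum_nat => k kK.
  have [h|h] := leP (K%:R / 2) (k%:R : R).
    apply: le_trans (_ : k%:R `^ alpha <= _); last by rewrite lerDl powR_ge0.
    by apply: ge0_ler_powR; rewrite // nnegrE ?divr_ge0.
  apply: le_trans (_ : (K.+1 - k)%:R `^ alpha <= _); last by rewrite lerDr powR_ge0.
  apply: ge0_ler_powR; rewrite // ?nnegrE ?divr_ge0//.
  rewrite natrB; last by lia.
  by rewrite -[K.+1%:R]natr1; clear -h; move: h; move: (k%:R : R) (K%:R : R) => *; lra.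
move=> h; have p2 : 0 <= 2 `^ alpha :> R by exact: powR_ge0.
have KE : K%:R `^ alpha = 2 `^ alpha * (K%:R / 2) `^ alpha :> R.
  by rewrite -powRM ?divr_ge0//; congr (_ `^ _); field.
have -> : 2 `^ (alpha + 1) = 2 `^ alpha * 2 :> R.
  by rewrite powRD ?powRr1// pnatr_eq0 implybT.
by rewrite KE mulrCA -mulrA ler_wpM2l.
Qed.

Lemma power_sum_le (e : R) (K : nat) : 0 <= e ->
  \sum_(1 <= k < K.+1) k%:R `^ e <= K%:R * K%:R `^ e.
Proof.
move=> e0; have -> : K%:R * K%:R `^ e = \sum_(1 <= k < K.+1) K%:R `^ e.
  by rewrite sumr_const_nat subn1 mulr_natl.
apply: ler_sum_nat => k /andP[_ kK]; apply: ge0_ler_powR => //; rewrite ?nnegrE//.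
by rewrite ler_nat.
Qed.

End PowerSums.

(** * Expectations at the sampled stage *)

Section TauExpectation.
Context (R : realType) (d : nat) (dX dZ : measure_display).
Context (X : measurableType dX) (Z : measurableType dZ) (D : dc_data R d X Z).
Context (opt : spg_option) (sch : schedule R) (G alpha : R) (x1 : 'rV[R]_d) (K : nat).
Context (W : stagewise_run D opt sch G alpha x1 K).
Local Notation P := (run_prob W).
Local Notation T := (run_space W).
Local Notation hist := (history (W := W) K.+1 1).

Definition tau_weight (k : nat) : R :=
  k%:R `^ alpha / \sum_(1 <= j < K.+1) j%:R `^ alpha.

(** The history of stage K + 1 contains every sample except tau, which is independent of it. *)
Lemma tau_integral (k : nat) (f : T -> R) : (1 <= k <= K)%N ->
  measurable_fun [set: g_sigma_algebraType hist] f -> (forall w, 0 <= f w) ->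
  (\int[P]_w (if tau_ W w == k then f w else 0)%:E
    = (tau_weight k)%:E * \int[P]_w (f w)%:E)%E.
Proof.
move=> kK mf f0.
have mG : hist `<=` measurable by exact: history_measurable.
have used : before sch K K.+1 1 `<=` used_samples sch K by exact: before_used.
pose H (p : g_sigma_algebraType hist * nat) : \bar R := (if p.2 == k then f p.1 else 0)%:E.
have mH : measurable_fun setT H.
  apply/measurable_EFinP.
  have -> : (fun p : g_sigma_algebraType hist * nat => if p.2 == k then f p.1 else 0) =
      (fun p => f p.1 * (p.2 == k)%:R).
    by apply/funext => p; case: eqP => _; rewrite ?mulr1 ?mulr0.
  apply: measurable_funM; first exact: (measurableT_comp mf measurable_fst).
  exact: (@measurableT_comp _ _ _ _ _ _ (fun n : nat => (n == k)%:R : R) _ snd).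
have := @integral_independent R _ T P _ nat (distribution P (tau_ W)) hist (tau_ W) H mG
  (measurable_funPT (tau_ W)) _ mH _.
rewrite /H/= => ->; last 2 first.
- by move=> A B sA _; exact: (tau_independent _ used _ sA).
- by move=> p; rewrite lee_fin; case: ifP.
have mfT : measurable_fun setT (EFin \o f).
  by apply/measurable_EFinP; exact: (measurable_g_sigmaW mG mf).
rewrite -ge0_integralZl//=; last 2 first.
- by move=> w _; rewrite lee_fin.
- by rewrite lee_fin divr_ge0 ?powR_ge0// sumr_ge0// => j _; exact: powR_ge0.
apply: eq_integral => w _.
have -> : (fun n => (if n == k then f w else 0)%:E) =
    (fun n => (f w)%:E * (\1_[set k] n)%:E)%E.
  apply/funext => n; rewrite indicE; have [->|nk] := eqVneq n k.
    by rewrite mem_set// mule1.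
  by rewrite memNset ?mule0// => /eqP; exact/negP.
rewrite ge0_integralZl//=; last by rewrite lee_fin.
rewrite integral_indic// setIT.
rewrite [RHS]muleC; congr (_ * _)%E; exact: tau_law.
Qed.

Lemma tau_expect (B : nat -> T -> R) :
  (forall k, (1 <= k <= K)%N -> measurable_fun [set: g_sigma_algebraType hist] (B k)) ->
  (forall k w, (1 <= k <= K)%N -> 0 <= B k w) ->
  (\int[P]_w (B (tau_ W w) w)%:E
    = \sum_(1 <= k < K.+1) (tau_weight k)%:E * \int[P]_w (B k w)%:E)%E.
Proof.
move=> mB B0; have mG : hist `<=` measurable by exact: history_measurable.
pose f k w := if (1 <= k <= K)%N then B k w else 0.
pose F k w := (if tau_ W w == k then f k w else 0)%:E.
have f0 k w : 0 <= f k w by rewrite /f; case: ifP => // /B0.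
have mf k : measurable_fun [set: g_sigma_algebraType hist] (f k).
  by rewrite /f; case: (boolP (1 <= k <= K)%N) => [/mB//|_]; exact: measurable_cst.
transitivity (\int[P]_w (\sum_(1 <= k < K.+1) F k w))%E.
  apply: eq_integral => w _; have tK := tau_range w.
  rewrite (big_rem (tau_ W w : nat))/=; last by rewrite mem_index_iota; lia.
  rewrite big_seq big1 ?adde0; last first.
    move=> k; rewrite mem_rem_uniq ?iota_uniq// inE => /andP[kt _].
    by rewrite /F eq_sym (negbTE kt).
  by rewrite /F eqxx /f tK.
have mF k : measurable_fun setT (F k).
  apply/measurable_EFinP.
  have -> : (fun w => if tau_ W w == k then f k w else 0) =
      (fun w => f k w * ((fun n => (n == k)%:R : R) \o tau_ W) w).
    by apply/funext => w /=; case: eqP => _; rewrite ?mulr1 ?mulr0.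
  apply: measurable_funM; first exact: (measurable_g_sigmaW mG (mf k)).
  by apply: measurableT_comp.
rewrite ge0_integral_sum//; last by move=> k w _; rewrite /F lee_fin; case: ifP.
apply: eq_big_seq => k; rewrite mem_index_iota => kK.
rewrite /F tau_integral//.
by congr (_ * _)%E; apply: eq_integral => w _; rewrite /f ifT.
Qed.

End TauExpectation.

(** * Bounds over a whole run *)

Section RunBound.
Context (R : realType) (d : nat) (dX dZ : measure_display).
Context (X : measurableType dX) (Z : measurableType dZ) (D : dc_data R d X Z).
Context (opt : spg_option) (sch : schedule R) (G alpha : R) (x1 : 'rV[R]_d) (K : nat).
Context (W : stagewise_run D opt sch G alpha x1 K).
Hypothesis hD : is_dc_problem D.
Local Notation P := (run_prob W).
Local Notation T := (run_space W).
Local Notation E := (edom (reg D)).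
Local Notation iters k := (iters sch k).
Local Notation xW := (x_ (s := W)).
Local Notation gamma k := (gam sch k).
Local Notation dist k w := (prox_dist (W := W) k w).
Hypothesis hx1 : E x1.
Hypothesis G0 : 0 < G.
Hypothesis gam0 : forall k, (1 <= k)%N -> 0 < gam sch k.
Hypothesis eta0 : forall k t, (1 <= k)%N -> (1 <= t)%N -> 0 < Defs.eta sch k t.
Hypothesis iters0 : forall k, (1 <= k)%N -> (1 <= iters k)%N.
Hypothesis var_g : forall x, E x ->
  (\int[mu_g D]_s (enorm (sg D x s - dg D x) ^+ 2)%:E <= (G ^+ 2)%:E)%E.
Hypothesis var_h : forall x, E x ->
  (\int[mu_h D]_s (enorm (sh D x s - dh D x) ^+ 2)%:E <= (G ^+ 2)%:E)%E.
Hypothesis hcase : smooth_case D opt sch \/ nonsmooth_case D opt sch G.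
Context (Delta ell : R).
Hypothesis ell0 : 0 < ell.
Hypothesis gam_iters : forall k, (1 <= k)%N -> ell * k%:R <= gamma k * (iters k)%:R.
Hypothesis al : 1 <= alpha.
Hypothesis K1 : (1 <= K)%N.
Hypothesis gapW : gap_bounded W Delta.

(** With infimum -oo the gap at x_1 would be constantly +oo, against the bound by Delta. *)
Lemma min_objective_finite : exists fm : R, min_objective D = fm%:E.
Proof.
have o1 : (min_objective D <= (Ffun D x1)%:E)%E.
  by apply: ereal_inf_lbound; exists x1 => //; exact: objective_fin.
case mE : (min_objective D) => [r| |]; first by exists r.
  by move: o1; rewrite mE leye_eq.
have K11 : (1 <= 1 <= K)%N by rewrite K1.
have := gapW K11; rewrite mE.
rewrite (eq_integral (fun=> +oo%E)); last first.
  by move=> w _; rewrite x_init (objective_fin hD hx1).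
by rewrite integral_cst//= probability_setT mule1 leye_eq.
Qed.

Lemma proximal_second_moments : exists q : nat -> R,
  [/\ forall k, (1 <= k <= K)%N -> (\int[P]_w (dist k w ^+ 2)%:E = (q k)%:E)%E,
    forall k, 0 <= q k &
    \sum_(1 <= k < K.+1) k%:R `^ alpha * (gamma k / 4 * q k)
      <= (Delta + 480 * G ^+ 2 / ell) * K%:R `^ alpha].
Proof.
have [fm mE] := min_objective_finite.
have hfm x : E x -> fm <= Ffun D x.
  move=> Exx; rewrite -lee_fin -mE; apply: ereal_inf_lbound; exists x => //.
  exact: objective_fin.
pose A k := (\int[P]_w (gap (W := W) fm k w)%:E)%E.
pose Q k := (\int[P]_w (dist k w ^+ 2)%:E)%E.
have Q0 k : (0 <= Q k)%E.
  by apply: integral_ge0 => w _; rewrite lee_fin sqr_ge0.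
have A0 k : (1 <= k <= K.+1)%N -> (0 <= A k)%E.
  by move=> kK; apply: integral_ge0 => w _; rewrite lee_fin gap_ge0.
have AD k : (1 <= k <= K)%N -> (A k <= Delta%:E)%E.
  move=> kK; apply: le_trans (gapW kK); rewrite le_eqVlt; apply/orP; left; apply/eqP.
  apply: eq_integral => w _; have kK1 : (1 <= k <= K.+1)%N by lia.
  have Ew := x_dom hD hx1 G0 gam0 iters0 w kK1.
  by rewrite (objective_fin hD Ew) mE.
have st k : (1 <= k <= K)%N ->
    (A k.+1 + (gamma k / 4)%:E * Q k <= A k + (480 * G ^+ 2 / (gamma k * (iters k)%:R))%:E)%E.
  move=> kK; apply: stage_inequality => //.
  by apply: le_lt_trans (AD _ kK) _; exact: ltry.
(* The gap bound makes A k finite, and the stage inequality passes finiteness on to Q k and A k.+1;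
   this reaches A K.+1, which the hypothesis does not cover. *)
have fin k : (1 <= k <= K)%N -> [/\ Q k = (fine (Q k))%:E, A k = (fine (A k))%:E &
    A k.+1 = (fine (A k.+1))%:E].
  move=> kK; have := st k kK; have := AD k kK; have := Q0 k.
  have g4 : 0 < gamma k / 4 by rewrite divr_gt0// gam0//; case/andP: kK.
  have kK1 : (1 <= k <= K.+1)%N by lia.
  have kK2 : (1 <= k.+1 <= K.+1)%N by lia.
  have := A0 k kK1; have := A0 k.+1 kK2.
  case: (A k) => [a| |] //; case: (A k.+1) => [b| |] //; case: (Q k) => [q| |]//;
    by rewrite ?gt0_muley ?lte_fin.
exists (fun k => fine (Q k)); split.
- by move=> k /fin[].
- by move=> k; apply: fine_ge0.
have N0 : 0 <= 480 * G ^+ 2 by apply: mulr_ge0; [exact: ler0n|exact: sqr_ge0].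
move: (480 * G ^+ 2) N0 st => N N0 st.
apply: (@abel_bound R _ _ _ _ (fun k => fine (A k))) => //.
- by rewrite divr_ge0 ?(ltW ell0).
- move=> k kK; have k1 : (1 <= k)%N by case/andP: kK.
  have := st k kK; have [-> -> ->] := fin k kK.
  rewrite -!(EFinM, EFinD) lee_fin => h; apply: (le_trans h); rewrite lerD2l.
  rewrite -[leRHS]mulrA -invfM; apply: ler_wpM2l => //.
  by rewrite lef_pV2 ?posrE ?mulr_gt0 ?ltr0n ?gam0 ?iters0// gam_iters.
- by move=> k kK; have := AD k kK; have [_ -> _] := fin k kK; rewrite lee_fin.
- by apply: fine_ge0; apply: A0; lia.
Qed.

Lemma tau_weight_ge0 k : 0 <= tau_weight alpha K k.
Proof. by rewrite divr_ge0 ?powR_ge0// sumr_ge0// => j _; exact: powR_ge0. Qed.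

Lemma weight_sum_gt0 : 0 < \sum_(1 <= j < K.+1) j%:R `^ alpha :> R.
Proof.
have h := power_sum_ge (le_trans ler01 al) K1.
have : 0 < K%:R * K%:R `^ alpha :> R by rewrite mulr_gt0 ?powR_gt0 ?ltr0n.
by move=> /lt_le_trans/(_ h); rewrite pmulr_rgt0// powR_gt0.
Qed.

Lemma tau_weight_sum : \sum_(1 <= k < K.+1) tau_weight alpha K k = 1.
Proof. by rewrite -mulr_suml divff// gt_eqF// weight_sum_gt0. Qed.

Lemma tau_weight_sum_le (f : nat -> R) (M : R) : 0 <= M ->
  \sum_(1 <= k < K.+1) k%:R `^ alpha * f k <= M * K%:R `^ alpha ->
  \sum_(1 <= k < K.+1) tau_weight alpha K k * f k <= M * 2 `^ (alpha + 1) / K%:R.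
Proof.
move=> M0 h; have S0 := weight_sum_gt0.
have KR : 0 < K%:R :> R by rewrite ltr0n.
have -> : \sum_(1 <= k < K.+1) tau_weight alpha K k * f k =
    (\sum_(1 <= k < K.+1) k%:R `^ alpha * f k) / \sum_(1 <= j < K.+1) j%:R `^ alpha.
  by rewrite mulr_suml; apply: eq_bigr => k _; rewrite /tau_weight mulrAC.
rewrite ler_pdivrMr// mulrAC ler_pdivlMr//.
have := power_sum_ge (le_trans ler01 al) K1 => /(ler_wpM2l M0).
have := ler_wpM2r (ltW KR) h.
move: (\sum_(_ <= _ < _) _) (\sum_(_ <= _ < _) _) (_ `^ _) (_ `^ _) => a b p q *; lra.
Qed.

(** Young's inequality in the forms d <= th gamma d^2 / 2 + 1 / (2 th gamma) and gamma d <= th'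
    gamma d^2 / 2 + gamma / (2 th'). M bounds the mean of gamma d^2, Gi that of 1 / gamma, and Gs
    bounds gamma. The factor 4 in front of Delta + N undoes the gamma / 4 of the stage
    inequality. *)
Lemma tau_proximal_bound (N M Gi Gs c u v th th' : R) :
  480 * G ^+ 2 / ell <= N -> 4 * (Delta + N) * 2 `^ (alpha + 1) / K%:R <= M ->
  \sum_(1 <= k < K.+1) tau_weight alpha K k * (gamma k)^-1 <= Gi ->
  (forall k, (1 <= k <= K)%N -> gamma k <= Gs) ->
  0 <= c -> 0 <= u -> 0 <= v -> 0 < th -> 0 < th' ->
  (\int[P]_w (c + u * dist (tau_ W w) w + v * (gamma (tau_ W w) * dist (tau_ W w) w))%:E
   <= (c + u * (th * M / 2 + Gi / (2 * th)) + v * (th' * M / 2 + Gs / (2 * th')))%:E)%E.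
Proof.
move=> hN hM' hGi hGs c0 u0 v0 th0 th'0.
have [q [qE q0 hq]] := proximal_second_moments.
have {}hq : \sum_(1 <= k < K.+1) k%:R `^ alpha * (gamma k / 4 * q k)
    <= (Delta + N) * K%:R `^ alpha.
  by apply: (le_trans hq); apply: ler_wpM2r; [exact: powR_ge0|rewrite lerD2l].
clear hN.
pose s k := c + u / (2 * th) * (gamma k)^-1 + v / (2 * th') * gamma k.
pose r k := (u * th + v * th') / 2 * gamma k.
have r0 k : (1 <= k)%N -> 0 <= r k.
  move=> /gam0 g; apply: mulr_ge0; last exact: ltW.
  by rewrite divr_ge0// addr_ge0// mulr_ge0// ltW.
have s0 k : (1 <= k)%N -> 0 <= s k.
  move=> /gam0 g; rewrite /s !addr_ge0// mulr_ge0 ?invr_ge0 ?(ltW g)//.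
    by rewrite divr_ge0// mulr_ge0// ltW.
  by rewrite divr_ge0// mulr_ge0// ltW.
pose B k w := s k + r k * dist k w ^+ 2.
have d0 k w : 0 <= dist k w by exact: enorm_ge0.
apply: (@le_trans _ _ (\int[P]_w (B (tau_ W w) w)%:E)%E).
  apply: ge0_le_integral_nomeas => w; have /andP[t1 _] := tau_range w.
    by rewrite lee_fin !addr_ge0// mulr_ge0// mulr_ge0// ltW// gam0.
  rewrite lee_fin /B /s /r; move: (gam0 t1) (d0 (tau_ W w) w).
  move: (gamma _) (dist _ _) => g x g0 x0.
  have young (a b : R) : 0 < b -> a <= b * a ^+ 2 / 2 + (2 * b)^-1.
    move=> b0; rewrite -subr_ge0.
    have -> : b * a ^+ 2 / 2 + (2 * b)^-1 - a = (b * a - 1) ^+ 2 / (2 * b).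
      by field; rewrite gt_eqF.
    by rewrite divr_ge0 ?sqr_ge0// mulr_ge0// ltW.
  have h1 : x <= th * g * x ^+ 2 / 2 + (2 * (th * g))^-1 by apply: young; rewrite mulr_gt0.
  have h2 : g * x <= th' / g * (g * x) ^+ 2 / 2 + (2 * (th' / g))^-1.
    by apply: young; rewrite divr_gt0.
  have := ler_wpM2l u0 h1; have := ler_wpM2l v0 h2.
  have -> : v * (th' / g * (g * x) ^+ 2 / 2 + (2 * (th' / g))^-1) =
      v * th' / 2 * g * x ^+ 2 + v / (2 * th') * g by field; rewrite !gt_eqF.
  have -> : u * (th * g * x ^+ 2 / 2 + (2 * (th * g))^-1) =
      u * th / 2 * g * x ^+ 2 + u / (2 * th) * g^-1 by field; rewrite !gt_eqF.
  lra.
have md k : (1 <= k <= K)%N ->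
    measurable_fun [set: g_sigma_algebraType (history (W := W) K.+1 1)] (prox_dist (W := W) k).
  move=> kK; have /andP[k1 _] := kK.
  have mx := x_history (W := W) hD hx1 G0 gam0 eta0 iters0 hcase kK (leqnn 1).
  have mz := center_history (W := W) hD hx1 G0 gam0 eta0 iters0 hcase kK (leqnn 1).
  have sub : history (W := W) k 1 `<=` <<s history (W := W) K.+1 1 >>.
    by apply: past_sub; apply: before_sub; left; case/andP: kK.
  by apply: (measurable_g_sigma_sub sub); apply: measurable_enorm; exact: measurable_rowB.
rewrite tau_expect; last 2 first.
- move=> k kK; apply: measurable_funD; first exact: measurable_cst.
  by apply: measurable_funM; [exact: measurable_cst|apply: measurable_funX; exact: md].
- by move=> k w /andP[k1 _]; rewrite addr_ge0 ?s0// mulr_ge0 ?r0 ?sqr_ge0.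
have IB k : (1 <= k <= K)%N -> (\int[P]_w (B k w)%:E = (s k + r k * q k)%:E)%E.
  move=> kK; have /andP[k1 _] := kK.
  have mk : measurable_fun setT (fun w => dist k w ^+ 2).
    by apply: measurable_funX; exact: prox_dist_measurable.
  rewrite /B; under eq_integral do rewrite EFinD EFinM.
  rewrite ge0_integralD//; last 3 first.
  - by move=> w _; rewrite lee_fin s0.
  - by move=> w _; rewrite -EFinM lee_fin mulr_ge0 ?r0 ?sqr_ge0.
  - by apply: emeasurable_funM => //; exact/measurable_EFinP.
  rewrite ge0_integralZl_EFin//; last 3 first.
  - by move=> w _; rewrite lee_fin sqr_ge0.
  - exact/measurable_EFinP.
  - exact: r0.
  by rewrite integral_cst//= probability_setT mule1 qE// EFinD EFinM.
rewrite (eq_big_seq (fun k => (tau_weight alpha K k * (s k + r k * q k))%:E)); last first.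
  by move=> k; rewrite mem_index_iota => kK; rewrite IB.
rewrite sumEFin lee_fin.
have DN : 0 <= Delta + N.
  have : 0 <= (Delta + N) * K%:R `^ alpha.
    apply: le_trans hq; rewrite big_nat; apply: sumr_ge0 => k /andP[k1 _].
    by rewrite mulr_ge0 ?powR_ge0// mulr_ge0// divr_ge0// ltW// gam0.
  have : 0 < K%:R `^ alpha :> R by rewrite powR_gt0// ltr0n.
  by move=> k0; rewrite pmulr_lge0.
have hM : \sum_(1 <= k < K.+1) tau_weight alpha K k * (gamma k * q k) <= M.
  apply: le_trans hM'; apply: tau_weight_sum_le; first by rewrite mulr_ge0.
  rewrite -[leRHS]mulrA; apply: le_trans (ler_wpM2l (ler0n R 4) hq).
  rewrite mulr_sumr le_eqVlt; apply/orP; left; apply/eqP; by apply: eq_bigr => k _; field.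
have hG : \sum_(1 <= k < K.+1) tau_weight alpha K k * gamma k <= Gs.
  rewrite -[leRHS]mul1r -tau_weight_sum mulr_suml; apply: ler_sum_nat => k kK.
  by apply: ler_wpM2l; [exact: tau_weight_ge0|exact: hGs].
have e : \sum_(1 <= k < K.+1) tau_weight alpha K k * (s k + r k * q k) =
   c * 1 + u / (2 * th) * (\sum_(1 <= k < K.+1) tau_weight alpha K k * (gamma k)^-1)
   + v / (2 * th') * (\sum_(1 <= k < K.+1) tau_weight alpha K k * gamma k)
   + (u * th + v * th') / 2 * (\sum_(1 <= k < K.+1) tau_weight alpha K k * (gamma k * q k)).
  rewrite -[X in c * X]tau_weight_sum !mulr_sumr -!big_split/=; apply: eq_bigr => j _.
  rewrite /s /r; move: ((gamma j)^-1) (tau_weight alpha K j) => gi p.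
  by field; rewrite !gt_eqF.
have a1 : 0 <= u / (2 * th) by rewrite divr_ge0// mulr_ge0// ltW.
have a2 : 0 <= v / (2 * th') by rewrite divr_ge0// mulr_ge0// ltW.
have a3 : 0 <= (u * th + v * th') / 2 by rewrite divr_ge0// addr_ge0// mulr_ge0// ltW.
rewrite e.
have -> : c + u * (th * M / 2 + Gi / (2 * th)) + v * (th' * M / 2 + Gs / (2 * th')) =
  c * 1 + u / (2 * th) * Gi + v / (2 * th') * Gs + (u * th + v * th') / 2 * M.
  by field; rewrite !gt_eqF.
by rewrite !lerD// ler_wpM2l.
Qed.

End RunBound.

(** * Powers of epsilon *)

Section Rate.
Context (R : realType) (nu : R).
Hypothesis hnu : 0 < nu <= 1.
Local Notation beta := ((1 - nu) / (1 + nu)).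
Local Notation e := ((1 + nu) / nu).

Lemma ceiln_bounds (a : R) : 0 < a -> [/\ a <= (ceiln a)%:R, (ceiln a)%:R <= a + 1
  & (1 <= ceiln a)%N].
Proof.
move=> a0; have c0 : 0 < Num.ceil a by rewrite ceil_gt0.
have cE : (ceiln a)%:R = (Num.ceil a)%:~R :> R.
  by rewrite /ceiln natr_absz gtr0_norm.
rewrite cE; split; first exact: ceil_ge.
  by have := ltW (ceilB1_lt a); rewrite intrB; lra.
by rewrite /ceiln absz_gt0 gt_eqF.
Qed.

Lemma beta_bounds : (0 <= beta :> R) && (beta < 1 :> R).
Proof.
have /andP[n0 n1] := hnu; have n10 : 0 < 1 + nu by lra.
by rewrite divr_ge0 ?subr_ge0 ?(ltW n10)//= ltr_pdivrMr// mul1r; lra.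
Qed.

Let nu0 : 0 < nu. Proof. by case/andP: hnu. Qed.

Section Epsilon.
Context (C eps : R).
Hypothesis C0 : 0 < C.
Hypothesis heps : 0 < eps <= 1.
Local Notation s := (eps `^ (1 / nu)).
Local Notation K := (ceiln (C / eps `^ e)).

Let eps0 : 0 < eps. Proof. by case/andP: heps. Qed.
Let epsD p q : eps `^ (p + q) = eps `^ p * eps `^ q.
Proof. by rewrite powRD//; apply/implyP => _; rewrite gt_eqF. Qed.

Lemma eps_root_gt0 : 0 < s. Proof. exact: powR_gt0. Qed.

Lemma eps_root_pow : s `^ nu = eps.
Proof. by rewrite -powRrM mul1r mulVf ?gt_eqF// powRr1// ltW. Qed.

Lemma eps_stage : eps `^ e = eps * s.
Proof.
have -> : e = 1 + 1 / nu by field; rewrite gt_eqF.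
by rewrite epsD powRr1// ltW.
Qed.

(** The exponents multiply to 1 / nu - 1; hence K^beta, and with it gamma_K, is of order eps / s. *)
Lemma eps_stage_beta : (eps `^ e) `^ beta = s / eps.
Proof.
have n10 : 0 < 1 + nu by rewrite addr_gt0.
apply: (mulIf (lt0r_neq0 eps0)); rewrite divfK ?gt_eqF// -powRrM.
rewrite -{2}(powRr1 (ltW eps0)) -epsD; congr (_ `^ _).
by field; rewrite !gt_eqF.
Qed.

(** Rounding up adds at most 1, which is at most 1 / eps^e since eps <= 1. *)
Lemma stage_count : [/\ (1 <= K)%N, C / eps `^ e <= K%:R & K%:R <= (C + 1) / eps `^ e].
Proof.
have p0 : 0 < eps `^ e by exact: powR_gt0.
have [h1 h2 h3] := ceiln_bounds (divr_gt0 C0 p0).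
split => //; apply: (le_trans h2); rewrite [leRHS]mulrDl lerD2l div1r.
rewrite invf_ge1// eps_stage; have /andP[_ e1] := heps.
rewrite mulr_ile1 ?(ltW eps0) ?(ltW eps_root_gt0)//.
by rewrite -[leRHS](powRr0 eps) ger_powR// divr_ge0// ltW.
Qed.

(** In the last bound 2 - beta = (1 + 3 nu) / (1 + nu), so the exponent e (2 - beta) is that of the
    total complexity. *)
Lemma stage_count_beta : [/\ K%:R `^ beta <= (C + 1) `^ beta * (eps / s),
  K%:R `^ beta * (s / eps) >= C `^ beta &
  K%:R * K%:R `^ (1 - beta) <= (C + 1) `^ (2 - beta) / eps `^ ((1 + 3 * nu) / nu)].
Proof.
have [K1 Kge Kle] := stage_count; have /andP[b0 b1] := beta_bounds.
have n10 : 0 < 1 + nu by rewrite addr_gt0.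
have p0 : 0 < eps `^ e by exact: powR_gt0.
have C10 : 0 < C + 1 by rewrite addr_gt0.
have se0 : 0 < s / eps by rewrite divr_gt0// eps_root_gt0.
have mono (x y q : R) : 0 <= q -> 0 <= x -> x <= y -> x `^ q <= y `^ q.
  by move=> q0 x0 xy; apply: ge0_ler_powR => //; rewrite nnegrE// (le_trans x0).
have divp (x q : R) : 0 <= x -> (x / eps `^ e) `^ q = x `^ q / (eps `^ e) `^ q.
  have inv (y : R) : 0 <= y -> y^-1 `^ q = (y `^ q)^-1.
    by move=> y0; rewrite -powR_inv1// -powRrM mulN1r powRN.
  by move=> x0; rewrite powRM ?invr_ge0 ?(ltW p0)// inv// ltW.
split.
- apply: (le_trans (mono _ _ beta b0 _ Kle)); first exact: ler0n.
  by rewrite divp ?(ltW C10)// eps_stage_beta invf_div.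
- have := mono _ _ beta b0 (divr_ge0 (ltW C0) (ltW p0)) Kge.
  by rewrite divp ?(ltW C0)// eps_stage_beta ler_pdivrMr.
- have KK (x : R) : 0 <= x -> x * x `^ (1 - beta) = x `^ (2 - beta).
    move=> x0; rewrite -{1}(powRr1 x0) -powRD; last first.
      by apply/implyP => /eqP h; exfalso; lra.
    by congr (_ `^ _); ring.
  rewrite KK; last exact: ler0n.
  have b2 : 0 <= 2 - beta by lra.
  apply: (le_trans (mono _ _ _ b2 _ Kle)); first exact: ler0n.
  rewrite divp ?(ltW C10)// le_eqVlt; apply/orP; left; apply/eqP; congr (_ / _).
  by rewrite -powRrM; congr (_ `^ _); field; rewrite !gt_eqF.
Qed.

(* The tangent bound of the concave function x^nu at s, up to the factor nu. *)
Lemma holder_split (x : R) : 0 <= x -> x `^ nu <= eps + eps / s * x.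
Proof.
move=> x0; have s0 := eps_root_gt0; have /andP[_ n1] := hnu.
have es : 0 <= eps / s by rewrite divr_ge0// ltW.
have [xs|sx] := leP x s.
  apply: le_trans (_ : eps <= _); last by rewrite lerDl mulr_ge0.
  by rewrite -[leRHS]eps_root_pow; apply: ge0_ler_powR; rewrite // ?nnegrE// ltW.
apply: le_trans (_ : eps / s * x <= _); last by rewrite lerDr ltW.
have -> : x = s * (x / s) by field; rewrite gt_eqF.
rewrite powRM ?divr_ge0 ?(ltW s0)// eps_root_pow.
have -> : eps / s * (s * (x / s)) = eps * (x / s) by field; rewrite gt_eqF.
apply: ler_wpM2l; first exact: ltW.
rewrite -{2}(powRr1 (divr_ge0 x0 (ltW s0))); apply: ler_powR => //.
by move: (eps `^ _) sx s0 => t xt t0; rewrite ler_pdivlMr// mul1r ltW.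
Qed.

End Epsilon.

End Rate.

(** * The two schedules *)

Section Schedules.
Context (R : realType).

(** A common interface for cases (a) and (b): [gam_iters] controls the noise of a stage and
    [iters_pow] the total complexity. *)
Record power_schedule (sch : schedule R) (g0 ell b beta : R) : Prop := {
  gam_pow : forall k, gam sch k = g0 * k%:R `^ beta;
  eta_gt0 : forall k t, (1 <= k)%N -> (1 <= t)%N -> 0 < Defs.eta sch k t;
  iters_gt0 : forall k, (1 <= k)%N -> (1 <= iters sch k)%N;
  gam_iters : forall k, (1 <= k)%N -> ell * k%:R <= gam sch k * (iters sch k)%:R;
  iters_pow : forall k, (1 <= k)%N -> (iters sch k)%:R <= b * k%:R `^ (1 - beta) }.

(** m is the additive constant of T_k, 3 or 1, and the final 1 is the rounding; both are absorbed
    because k^(1 - beta) >= 1. *)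
Lemma stage_length (g0 ell m beta : R) (k : nat)
    (n := ceiln (ell * k%:R / (g0 * k%:R `^ beta) + m)) :
  0 < g0 -> 0 < ell -> 0 <= m -> beta <= 1 -> (1 <= k)%N ->
  [/\ m <= n%:R, ell * k%:R <= g0 * k%:R `^ beta * n%:R &
    n%:R <= (ell / g0 + m + 1) * k%:R `^ (1 - beta)].
Proof.
move=> g00 ell0 m0 b1 k1; have kR : 0 < k%:R :> R by rewrite ltr0n.
have p0 : 0 < k%:R `^ beta :> R by exact: powR_gt0.
have a0 : 0 < ell * k%:R / (g0 * k%:R `^ beta) by rewrite divr_gt0// mulr_gt0.
have am0 : 0 < ell * k%:R / (g0 * k%:R `^ beta) + m by rewrite ltr_wpDr.
have [h1 h2 _] := ceiln_bounds am0; rewrite -/n in h1 h2.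
have q1 : 1 <= k%:R `^ (1 - beta) :> R.
  by rewrite -[leLHS](powRr0 k%:R) ler_powR ?ler1n// subr_ge0.
have aE : ell * k%:R / (g0 * k%:R `^ beta) = ell / g0 * k%:R `^ (1 - beta).
  rewrite powRB; last by apply/implyP => _; rewrite gt_eqF.
  by rewrite powRr1 ?ltW//; field; rewrite !gt_eqF.
split; first lra.
  by rewrite [leRHS]mulrC -ler_pdivrMr ?mulr_gt0//; lra.
rewrite aE in h2; apply: (le_trans h2).
have : (m + 1) * 1 <= (m + 1) * k%:R `^ (1 - beta) by rewrite ler_wpM2l// addr_ge0.
lra.
Qed.

Lemma schedule_S_power (L nu : R) : 0 < nu <= 1 -> 0 < L ->
  power_schedule (schedule_S L nu) (3 * L) (3 * L) 5 ((1 - nu) / (1 + nu)).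
Proof.
move=> hnu L0; have /andP[b0 b1] := beta_bounds hnu.
have L30 : 0 < 3 * L by rewrite mulr_gt0.
have sl k := @stage_length (3 * L) (3 * L) 3 _ k L30 L30 (ler0n _ _) (ltW b1).
split => //=.
- move=> k t k1 t1; rewrite divr_gt0// mulr_gt0 ?ltr_wpDl//.
  by rewrite mulr_gt0// powR_gt0 ?ltr0n.
- by move=> k /sl[h _ _]; move: h; rewrite ler_nat => /(leq_trans _); apply.
- by move=> k /sl[].
- by move=> k /sl[_ _]; rewrite divff ?gt_eqF// (_ : 1 + 3 + 1 = 5 :> R)//; ring.
Qed.

Lemma schedule_N_power (c nu : R) : 0 < nu <= 1 -> 0 < c ->
  power_schedule (schedule_N c nu) c 1 (1 / c + 1 + 1) ((1 - nu) / (1 + nu)).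
Proof.
move=> hnu c0; have /andP[b0 b1] := beta_bounds hnu.
have sl k := @stage_length c 1 1 _ k c0 ltr01 ler01 (ltW b1).
have kE k : (k%:R : R) = 1 * k%:R by rewrite mul1r.
split => //=.
- move=> k t k1 t1; rewrite divr_gt0// mulr_gt0 ?ltr0n//.
  by rewrite mulr_gt0// powR_gt0 ?ltr0n.
- by move=> k /sl[h _ _]; move: h; rewrite -kE ler1n.
- by move=> k /sl[_ h _]; rewrite -kE in h *.
- by move=> k /sl[_ _]; rewrite -kE.
Qed.

Lemma total_iterations_le sch g0 ell b beta K : power_schedule sch g0 ell b beta ->
  0 <= b -> beta <= 1 ->
  (total_iterations sch K)%:R <= b * (K%:R * K%:R `^ (1 - beta)).
Proof.
move=> hs b0 b1; rewrite /total_iterations natr_sum.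
apply: (@le_trans _ _ (\sum_(1 <= k < K.+1) b * k%:R `^ (1 - beta))).
  by apply: ler_sum_nat => k /andP[k1 _]; exact: (iters_pow hs).
by rewrite -mulr_sumr ler_wpM2l// power_sum_le// subr_ge0.
Qed.

End Schedules.

(** * Consequences of conditions (S) and (N) *)

Section Conditions.
Context (R : realType) (d : nat) (dX dZ : measure_display).
Context (X : measurableType dX) (Z : measurableType dZ) (D : dc_data R d X Z).
Hypothesis hD : is_dc_problem D.
Local Notation E := (edom (reg D)).

Lemma oracle_measurable (dY : measure_display) (Y : measurableType dY)
    (s : 'rV[R]_d -> Y -> 'rV[R]_d) (x : 'rV[R]_d) :
  measurable_fun setT ((fun p => s p.1 p.2) : borelV R d * Y -> borelV R d) ->
  measurable_fun setT (s x : Y -> borelV R d).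
Proof.
move=> ms; have mp : measurable_fun setT ((fun y => (x, y)) : Y -> borelV R d * Y).
  by apply/measurable_fun_pairP; split; [exact: measurable_cst|exact: measurable_id].
exact: (measurableT_comp ms mp).
Qed.

Lemma variances_smooth (L G : R) : condition_S D L G -> forall x,
  (\int[mu_g D]_s (enorm (sg D x s - dg D x) ^+ 2)%:E <= (G ^+ 2)%:E)%E /\
  (\int[mu_h D]_s (enorm (sh D x s - dh D x) ^+ 2)%:E <= (G ^+ 2)%:E)%E.
Proof.
move=> [_ hv] x; have [h1 h2] := noise_variance
  (oracle_measurable x (sg_measurable hD)) (oracle_measurable x (sh_measurable hD))
  (sg_integrable hD x) (sh_integrable hD x).
by split; [exact: le_trans h1 (hv x)|exact: le_trans h2 (hv x)].
Qed.

Lemma variances_nonsmooth (G : R) : 0 < G -> condition_N D G -> forall x, E x ->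
  [/\ enorm (dg D x) <= G, enorm (dh D x) <= G,
    (\int[mu_g D]_s (enorm (sg D x s - dg D x) ^+ 2)%:E <= (G ^+ 2)%:E)%E &
    (\int[mu_h D]_s (enorm (sh D x s - dh D x) ^+ 2)%:E <= (G ^+ 2)%:E)%E].
Proof.
move=> G0 [hN _] x Ex; have [bg bh] := hN x Ex.
have [g1 g2] := variance_le (oracle_measurable x (sg_measurable hD)) (sg_integrable hD x) bg.
have [h1 h2] := variance_le (oracle_measurable x (sh_measurable hD)) (sh_integrable hD x) bh.
have sqG (u : 'rV[R]_d) : enorm u ^+ 2 <= G ^+ 2 -> enorm u <= G.
  by rewrite ler_sqr// nnegrE ?enorm_ge0// ltW.
by split => //; exact: sqG.
Qed.

Lemma dg_lipschitz (L : R) : smooth (gfun D) L ->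
  forall a b, enorm (dg D a - dg D b) <= L * enorm (a - b).
Proof.
move=> [dif lip] a b.
have dgE x : dg D x = grad (gfun D) x.
  by apply/esym/subgradient_grad => // y; exact: dg_subgradient.
by rewrite !dgE.
Qed.

Lemma solver_facts (nu L G c : R) opt sch : 0 < nu <= 1 -> 0 < L -> 0 < G -> 0 < c ->
  [/\ condition_S D L G, opt = Option1 & sch = schedule_S L nu] \/
  [/\ condition_N D G, opt = Option2 & sch = schedule_N c nu] ->
  exists g0 ell b : R, [/\ [/\ 0 < g0, 0 < ell & 0 < b],
    power_schedule sch g0 ell b ((1 - nu) / (1 + nu)),
    smooth_case D opt sch \/ nonsmooth_case D opt sch G &
    forall x, E x ->
    (\int[mu_g D]_s (enorm (sg D x s - dg D x) ^+ 2)%:E <= (G ^+ 2)%:E)%E /\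
    (\int[mu_h D]_s (enorm (sh D x s - dh D x) ^+ 2)%:E <= (G ^+ 2)%:E)%E].
Proof.
move=> hnu L0 G0 c0; have /andP[b0 b1] := beta_bounds hnu.
move=> [[cS oE ->]|[cN oE ->]].
  have hs := schedule_S_power hnu L0; have L30 : 0 < 3 * L by rewrite mulr_gt0.
  exists (3 * L), (3 * L), 5; split => //; last by move=> x _; exact: (variances_smooth cS).
  left; exists L; [exact: ltW|split => //=].
  - by have [] := cS => /dg_lipschitz.
  - move=> k k1; rewrite ler_peMr ?(ltW L30)//.
    by rewrite -[leLHS](powRr0 k%:R) ler_powR ?ler1n.
  - by move=> k t _ _; rewrite invf_div.
  - by move=> k /(stage_length L30 L30 (ler0n _ 3) (ltW b1))[h _ _]; move: h; rewrite ler_nat.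
have hs := schedule_N_power hnu c0.
exists c, 1, (1 / c + 1 + 1); split => //; last first.
- by move=> x Ex; have [] := variances_nonsmooth G0 cN Ex.
- right; split => //.
  + by case: cN.
  + by move=> x Ex; have [] := variances_nonsmooth G0 cN Ex.
  + by move=> k t _ _; rewrite invf_div.
- by split => //; rewrite !addr_gt0// divr_gt0.
Qed.

End Conditions.

(** * Rates at the sampled stage *)

Section TauRate.
Context (R : realType) (d : nat) (dX dZ : measure_display).
Context (X : measurableType dX) (Z : measurableType dZ) (D : dc_data R d X Z).
Context (nu alpha G Delta C g0 ell b : R) (x1 : 'rV[R]_d).
Context (opt : spg_option) (sch : schedule R).
Hypothesis hD : is_dc_problem D.
Hypothesis hnu : 0 < nu <= 1.
Hypothesis al : 1 <= alpha.
Hypothesis G0 : 0 < G.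
Hypothesis Delta0 : 0 < Delta.
Hypothesis C0 : 0 < C.
Hypothesis hx1 : edom (reg D) x1.
Hypothesis g00 : 0 < g0.
Hypothesis ell0 : 0 < ell.
Hypothesis hsch : power_schedule sch g0 ell b ((1 - nu) / (1 + nu)).
Hypothesis hcase : smooth_case D opt sch \/ nonsmooth_case D opt sch G.
Hypothesis hvar : forall x, edom (reg D) x ->
  (\int[mu_g D]_s (enorm (sg D x s - dg D x) ^+ 2)%:E <= (G ^+ 2)%:E)%E /\
  (\int[mu_h D]_s (enorm (sh D x s - dh D x) ^+ 2)%:E <= (G ^+ 2)%:E)%E.
Local Notation K eps := (ceiln (C / eps `^ ((1 + nu) / nu))).
Local Notation beta := ((1 - nu) / (1 + nu)).
Local Notation tau W w := (tau_ W w).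

Lemma power_gam_gt0 k : (1 <= k)%N -> 0 < gam sch k.
Proof. by move=> k1; rewrite (gam_pow hsch) mulr_gt0// powR_gt0 ?ltr0n. Qed.

(** As alpha >= 1 > beta, the exponent alpha - beta is nonnegative and each k^(alpha - beta) is at
    most n^(alpha - beta). *)
Lemma tau_weight_inv_gam (n : nat) : (1 <= n)%N ->
  \sum_(1 <= k < n.+1) tau_weight alpha n k / gam sch k <=
  g0^-1 * 2 `^ (alpha + 1) / n%:R `^ beta.
Proof.
move=> n1; have /andP[b0 b1] := beta_bounds hnu.
have nR : 0 < n%:R :> R by rewrite ltr0n.
have p0 : 0 < n%:R `^ beta :> R by exact: powR_gt0.
have -> : g0^-1 * 2 `^ (alpha + 1) / n%:R `^ beta =
    g0^-1 * n%:R / n%:R `^ beta * 2 `^ (alpha + 1) / n%:R by field; rewrite !gt_eqF.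
apply: (@tau_weight_sum_le _ _ _ al n1 (fun k => (gam sch k)^-1)).
  by rewrite divr_ge0 ?(ltW p0)// mulr_ge0 ?invr_ge0// ltW.
have nE (k : nat) : (1 <= k)%N -> k%:R `^ (alpha - beta) = k%:R `^ alpha / k%:R `^ beta :> R.
  by move=> k1; rewrite powRB//; apply/implyP => _; rewrite gt_eqF ?ltr0n.
have := @power_sum_le R (alpha - beta) n; rewrite subr_ge0 => /(_ _).
have ba : beta <= alpha by exact: le_trans (ltW b1) al.
move=> /(_ ba) h.
have -> : \sum_(1 <= k < n.+1) k%:R `^ alpha / gam sch k =
    g0^-1 * \sum_(1 <= k < n.+1) k%:R `^ (alpha - beta).
  rewrite mulr_sumr; apply: eq_big_seq => k; rewrite mem_index_iota => /andP[k1 _].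
  by rewrite nE// (gam_pow hsch) invfM mulrCA.
have -> : g0^-1 * n%:R / n%:R `^ beta * n%:R `^ alpha =
    g0^-1 * (n%:R * (n%:R `^ alpha / n%:R `^ beta)) by ring.
by rewrite -nE// ler_wpM2l// invr_ge0 ltW.
Qed.

Lemma tau_rate : exists2 B : R, 0 < B & forall eps, 0 < eps <= 1 ->
  forall W : stagewise_run D opt sch G alpha x1 (K eps), gap_bounded W Delta ->
  forall c u v, 0 <= c -> 0 <= u -> 0 <= v ->
  (\int[run_prob W]_w (c + u * prox_dist (W := W) (tau W w) w +
       v * (gam sch (tau W w) * prox_dist (W := W) (tau W w) w))%:E
   <= (c + u * (B * eps `^ (1 / nu)) + v * (B * eps))%:E)%E.
Proof.
have [N N0 hN] : exists2 N : R, 0 <= N & 480 * G ^+ 2 / ell <= N.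
  exists (480 * G ^+ 2 / ell); last exact: lexx.
  by apply: divr_ge0; [apply: mulr_ge0; [exact: ler0n|exact: sqr_ge0]|exact: ltW].
pose M0 := 4 * (Delta + N) * 2 `^ (alpha + 1).
have M00 : 0 < M0.
  by rewrite mulr_gt0 ?powR_gt0// mulr_gt0// ltr_wpDr.
pose I0 := g0^-1 * 2 `^ (alpha + 1) / C `^ beta.
have I00 : 0 < I0 by rewrite divr_gt0 ?powR_gt0// mulr_gt0 ?invr_gt0// powR_gt0.
pose S0 := g0 * (C + 1) `^ beta.
have C10 : 0 < C + 1 by rewrite addr_gt0.
have S00 : 0 < S0 by rewrite mulr_gt0// powR_gt0.
exists (M0 / C + I0 + S0); first by rewrite !addr_gt0// divr_gt0.
move=> eps heps W gapW c u v c0 u0 v0.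
have /andP[e0 e1] := heps; have s0 : 0 < eps `^ (1 / nu) by exact: powR_gt0.
have [K1 Kge Kle] := stage_count hnu C0 heps.
have [bS bI _] := stage_count_beta hnu C0 heps.
have /andP[b0 b1] := beta_bounds hnu.
have KR : 0 < (K eps)%:R :> R by rewrite ltr0n.
have Kb0 : 0 < (K eps)%:R `^ beta :> R by exact: powR_gt0.
have C0b : 0 < C `^ beta by exact: powR_gt0.
have {}Kge : C / (eps * eps `^ (1 / nu)) <= (K eps)%:R by rewrite -eps_stage.
set s := eps `^ (1 / nu) in s0 bS bI Kge *.
have hM : M0 / (K eps)%:R <= M0 / C * (eps * s).
  rewrite ler_pdivrMr ?mulr_gt0// in Kge.
  rewrite ler_pdivrMr//; have := ler_wpM2l (ltW (divr_gt0 M00 C0)) Kge.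
  by rewrite divfK ?gt_eqF// [(K eps)%:R * _]mulrC mulrA.
have hI : g0^-1 * 2 `^ (alpha + 1) / (K eps)%:R `^ beta <= I0 * (s / eps).
  rewrite /I0 -!mulrA; apply: ler_wpM2l; first by rewrite invr_ge0 ltW.
  apply: ler_wpM2l; first exact: powR_ge0.
  by rewrite ler_pdivlMl// ler_pdivrMr// [leRHS]mulrC.
have hS k : (1 <= k <= K eps)%N -> gam sch k <= S0 * (eps / s).
  move=> /andP[k1 kK]; rewrite (gam_pow hsch) /S0 -mulrA; apply: ler_wpM2l; first exact: ltW.
  apply: le_trans bS; apply: ge0_ler_powR; rewrite ?nnegrE//.
  by rewrite ler_nat.
have var_g x (Ex : edom (reg D) x) := (hvar Ex).1.
have var_h x (Ex : edom (reg D) x) := (hvar Ex).2.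
(* Here M is O(eps s), Gi is O(s / eps) and Gs is O(eps / s); the Young weights 1 / eps and 1 / s
   give both terms of each bound the same order, s and eps respectively. *)
have := tau_proximal_bound hD hx1 G0 power_gam_gt0 (eta_gt0 hsch) (iters_gt0 hsch)
  var_g var_h hcase ell0 (@gam_iters _ _ _ _ _ _ hsch) al K1 gapW hN hM
  (le_trans (tau_weight_inv_gam K1) hI) hS c0 u0 v0 (th := eps^-1) (th' := s^-1).
rewrite !invr_gt0 => /(_ e0 s0) /le_trans; apply; rewrite lee_fin.
have M0C : 0 < M0 / C by exact: divr_gt0.
have -> : eps^-1 * (M0 / C * (eps * s)) / 2 + I0 * (s / eps) / (2 * eps^-1) =
    (M0 / C + I0) / 2 * s by move: (M0 / C) => m; field; rewrite !gt_eqF.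
have -> : s^-1 * (M0 / C * (eps * s)) / 2 + S0 * (eps / s) / (2 * s^-1) =
    (M0 / C + S0) / 2 * eps by move: (M0 / C) => m; field; rewrite !gt_eqF.
move: (M0 / C) M0C => m m0.
apply: lerD; first apply: lerD => //; apply: ler_wpM2l => //; apply: ler_wpM2r; lra.
Qed.

End TauRate.

(** * Assembly of the rates *)

Lemma setdist_ge0 (R : realType) (d : nat) (A B : set 'rV[R]_d) : (0 <= setdist A B)%E.
Proof. by apply: le_ereal_inf_tmp => _ [p _ <-]; rewrite lee_fin enorm_ge0. Qed.

Theorem corollary7 (R : realType) (d : nat) (dX dZ : measure_display)
    (X : measurableType dX) (Z : measurableType dZ) (D : dc_data R d X Z)
    (nu alpha L G c Delta C : R) (x1 : 'rV[R]_d)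
    (opt : spg_option) (sch : schedule R)
    (hD : is_dc_problem D)
    (hnu : 0 < nu <= 1) (halpha : 1 <= alpha)
    (hL : 0 < L) (hG : 0 < G) (hc : 0 < c) (hDelta : 0 < Delta) (hC : 0 < C)
    (hx1 : edom (reg D) x1)
    (hcase : [/\ condition_S D L G, opt = Option1 & sch = schedule_S L nu] \/
             [/\ condition_N D G, opt = Option2 & sch = schedule_N c nu]) :
  let K eps := ceiln (C / eps `^ ((1 + nu) / nu)) in
  ((forall x, reg D x \is a fin_num) ->
   holder_gradient (fun x => gfun D x + fine (reg D x)) L nu ->
   exists2 B : R, 0 < B & forall eps : R, 0 < eps <= 1 ->
     (forall W : stagewise_run D opt sch G alpha x1 (K eps),
        gap_bounded W Delta ->
        (\int[run_prob W]_w
            setdist (subdiff (EFin \o hfun D) (x_tau w))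
              [set grad (gfun D) (x_tau w) + grad (fine \o reg D) (x_tau w)]%R
          <= (B * eps)%:E)%E) /\
     (total_iterations sch (K eps))%:R <= B / eps `^ ((1 + 3 * nu) / nu)) /\
  (holder_gradient (hfun D) L nu ->
   exists2 B : R, 0 < B & forall eps : R, 0 < eps <= 1 ->
     (forall W : stagewise_run D opt sch G alpha x1 (K eps),
        gap_bounded W Delta ->
        (\int[run_prob W]_w (enorm (x_tau w - z_tau w))%:E
          <= (B * eps `^ (1 / nu))%:E)%E /\
        (\int[run_prob W]_w
            setdist [set grad (hfun D) (z_tau w)]
              (mink_sum (subdiff (EFin \o gfun D) (z_tau w))
                 (subdiff (reg D) (z_tau w)))
          <= (B * eps)%:E)%E) /\
     (total_iterations sch (K eps))%:R <= B / eps `^ ((1 + 3 * nu) / nu)).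
Proof.
move=> K.
have [g0 [ell [b [[g00 ell0 b0] hsch hcs hvar]]]] := solver_facts hD hnu hL hG hc hcase.
have [A A0 hA] := tau_rate hD hnu halpha hG hDelta hC hx1 g00 ell0 hsch hcs hvar.
have /andP[bt0 bt1] := beta_bounds hnu.
(* [B1] collects the constant and linear parts of the split of L d^nu and the term gamma d; [B2] is
   the complexity constant. *)
pose B1 := L + L * A + A; pose B2 := b * (C + 1) `^ (2 - (1 - nu) / (1 + nu)).
have B10 : 0 < B1 by rewrite !addr_gt0// mulr_gt0.
have B20 : 0 < B2 by rewrite mulr_gt0// powR_gt0 ?addr_gt0.
have hB0 : 0 < B1 + B2 by exact: addr_gt0.
have total eps : 0 < eps <= 1 ->
    (total_iterations sch (K eps))%:R <= (B1 + B2) / eps `^ ((1 + 3 * nu) / nu).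
  move=> heps; apply: (le_trans (total_iterations_le _ hsch (ltW b0) (ltW bt1))).
  have [_ _ h] := stage_count_beta hnu hC heps.
  apply: (le_trans (ler_wpM2l (ltW b0) h)); rewrite mulrA ler_wpM2r ?invr_ge0 ?powR_ge0//.
  by rewrite lerDr ltW.
(* S stands for either set distance, about which only nonnegativity and the pointwise bound are
   known. *)
have critical eps (W : stagewise_run D opt sch G alpha x1 (K eps))
    (S : run_space W -> \bar R) : 0 < eps <= 1 -> gap_bounded W Delta ->
    (forall w, 0 <= S w)%E ->
    (forall w, S w <= (L * enorm (x_tau w - z_tau w) `^ nu +
       gam sch (tau_ W w) * enorm (x_tau w - z_tau w))%:E)%E ->
    (\int[run_prob W]_w S w <= ((B1 + B2) * eps)%:E)%E.
  move=> heps gapW S0 hS; have /andP[e0 _] := heps.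
  have s0 : 0 < eps `^ (1 / nu) by exact: powR_gt0.
  (* By [holder_split], L d^nu <= L eps + L (eps / s) d; so [hA] is used with c = L eps, u = L eps /
     s and v = 1. *)
  have u0 : 0 <= L * (eps / eps `^ (1 / nu)) by rewrite mulr_ge0// ?divr_ge0// ltW.
  apply: (le_trans (ge0_le_integral_nomeas _ S0 _)); last first.
    apply: (le_trans (hA eps heps W gapW (L * eps) _ 1 _ u0 ler01)).
      by rewrite mulr_ge0// ltW.
    rewrite lee_fin [1 * (A * eps)]mul1r.
    have -> : L * (eps / eps `^ (1 / nu)) * (A * eps `^ (1 / nu)) = L * A * eps.
      by field; rewrite gt_eqF.
    by rewrite -!mulrDl ler_wpM2r ?(ltW e0)// lerDl ltW.
  move=> w; apply: (le_trans (hS w)); rewrite lee_fin [1 * (gam _ _ * _)]mul1r.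
  rewrite lerD2r -[_ * _ * enorm _]mulrA -mulrDr.
  by rewrite ler_wpM2l ?(ltW hL)//; apply: holder_split => //; exact: enorm_ge0.
split=> [rfin hol|hol]; exists (B1 + B2) => // eps heps;
  (split; last exact: total) => W gapW.
- apply: critical => // w; first exact: setdist_ge0.
  apply: critical_smooth_gr => //; apply: power_gam_gt0 g00 hsch _ _.
  by case/andP: (tau_range w).
- split.
    have := hA eps heps W gapW 0 1 0 (lexx _) ler01 (lexx _).
    under eq_integral do rewrite mul0r addr0 add0r mul1r.
    move=> /le_trans; apply; rewrite lee_fin mul0r addr0 add0r [1 * (A * _)]mul1r.
    apply: ler_wpM2r; first exact: powR_ge0.
    have : 0 <= L * A by rewrite mulr_ge0// ltW.
    by rewrite /B1; lra.
  apply: critical => // w; first exact: setdist_ge0.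
  apply: critical_smooth_h => //; apply: power_gam_gt0 g00 hsch _ _.
  by case/andP: (tau_range w).
Qed.
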